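(* Let $[t_0,t_1]$ be a fixed finite time horizon, and let $\boldsymbol{A}_t\in\mathbb{R}^{n\times n}$, $\boldsymbol{B}_t\in\mathbb{R}^{n\times m}$, $\boldsymbol{Q}_t\in\mathbb{S}^n$ ($t\in[t_0,t_1]$) and $\boldsymbol{\Sigma}_0,\boldsymbol{\Sigma}_d$ satisfy assumptions A1, A2, A3 given in the context. Consider the problem of minimizing $$\tfrac12\operatorname{trace}\big((\boldsymbol{\Sigma}_1-\boldsymbol{\Sigma}_d)^2\big)+\int_{t_0}^{t_1}\mathbb{E}\big(\|\boldsymbol{u}_t\|_2^2+\boldsymbol{x}_t^{\top}\boldsymbol{Q}_t\boldsymbol{x}_t\big)\,dt$$ over admissible linear feedback controls $\boldsymbol{u}_t=\boldsymbol{K}_t\boldsymbol{x}_t$ with deterministic time-varying gain $\boldsymbol{K}_t:[t_0,t_1]\to\mathbb{R}^{m\times n}$, subject to $$d\boldsymbol{x}_t=\boldsymbol{A}_t\boldsymbol{x}_t\,dt+\boldsymbol{B}_t\boldsymbol{u}_t\,dt+\boldsymbol{B}_t\,d\boldsymbol{w}_t,\qquad \boldsymbol{x}_{t=t_0}\sim\mathcal{N}(\boldsymbol{0},\boldsymbol{\Sigma}_0),$$ where $\boldsymbol{\Sigma}_t$ denotes the covariance of $\boldsymbol{x}_t$ and $\boldsymbol{\Sigma}_1:=\boldsymbol{\Sigma}_{t=t_1}$. The necessary condition for optimality is the following coupled ODE boundary value problem on the cotangent bundle $\mathcal{T}^*\mathbb{S}^n_{++}=\mathbb{S}^n_{++}\times\mathbb{S}^n$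 in the unknown $(\boldsymbol{\Sigma}_t^{\mathrm{opt}},\boldsymbol{P}_t^{\mathrm{opt}})$, where $\boldsymbol{\Sigma}_t^{\mathrm{opt}}$ is the optimally controlled covariance and $\boldsymbol{P}_t^{\mathrm{opt}}$ its costate: $$\dot{\boldsymbol{\Sigma}}_t^{\mathrm{opt}}=(\boldsymbol{A}_t-\boldsymbol{B}_t\boldsymbol{B}_t^{\top}\boldsymbol{P}_t^{\mathrm{opt}})\boldsymbol{\Sigma}_t^{\mathrm{opt}}+\boldsymbol{\Sigma}_t^{\mathrm{opt}}(\boldsymbol{A}_t-\boldsymbol{B}_t\boldsymbol{B}_t^{\top}\boldsymbol{P}_t^{\mathrm{opt}})^{\top}+\boldsymbol{B}_t\boldsymbol{B}_t^{\top},$$ $$-\dot{\boldsymbol{P}}_t^{\mathrm{opt}}=\boldsymbol{A}_t^{\top}\boldsymbol{P}_t^{\mathrm{opt}}+\boldsymbol{P}_t^{\mathrm{opt}}\boldsymbol{A}_t-\boldsymbol{P}_t^{\mathrm{opt}}\boldsymbol{B}_t\boldsymbol{B}_t^{\top}\boldsymbol{P}_t^{\mathrm{opt}}+\boldsymbol{Q}_t,$$ $$\boldsymbol{\Sigma}^{\mathrm{opt}}_{t=t_0}=\boldsymbol{\Sigma}_0\succ\boldsymbol{0}\ \text{given},\qquad \boldsymbol{P}^{\mathrm{opt}}_{t=t_1}=\boldsymbol{\Sigma}^{\mathrm{opt}}_{t=t_1}-\boldsymbol{\Sigma}_d,\quad \boldsymbol{\Sigma}_d\succ\boldsymbol{0}\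 \text{given}.$$ The associated optimal gain is $\boldsymbol{K}_t^{\mathrm{opt}}=-\boldsymbol{B}_t^{\top}\boldsymbol{P}_t^{\mathrm{opt}}$, and the optimal control is $\boldsymbol{u}_t^{\mathrm{opt}}=\boldsymbol{K}_t^{\mathrm{opt}}\boldsymbol{x}_t$.
   Context: $\mathbb{S}^n$ is the set of real symmetric $n\times n$ matrices and $\mathbb{S}^n_{++}$ the cone of positive definite ones. $\boldsymbol{x}_t\in\mathbb{R}^n$, $\boldsymbol{u}_t\in\mathbb{R}^m$, and $\boldsymbol{w}_t\in\mathbb{R}^m$ is a standard Wiener process. $\mathcal{N}$ denotes a multivariate normal distribution and $\mathbb{E}$ is expectation with respect to the state. $\boldsymbol{\Sigma}_d$ is a desired terminal covariance. Assumptions: A1. $(\boldsymbol{A}_t,\boldsymbol{B}_t)$ is bounded and continuous with respect to $t\in[t_0,t_1]$ and uniformly controllable, i.e. the controllability Gramian is strictly positive definite for all $[s,t]\subseteq[t_0,t_1]$. A2. $\boldsymbol{Q}_t\succeq\boldsymbol{0}$ for all $t\in[t_0,t_1]$. A3. $\boldsymbol{\Sigma}_0,\boldsymbol{\Sigma}_d\succ\boldsymbol{0}$. Admissible controls are adapted policies $\boldsymbol{u}:[t_0,t_1]\times\mathbb{R}^n\to\mathbb{R}^m$ of finite energy, $\mathbb{E}_\rho\{\int_{t_0}^{t_1}\|\boldsymbol{u}\|_2^2\,dt\}<\infty$ for every probability density $\rho$ on $\mathbb{R}^n$ with finite second moment, such that the controlled SDE has a strong solution. Under $\boldsymbol{u}_t=\boldsymbol{K}_t\boldsymbol{x}_t$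 the state is $\mathcal{N}(\boldsymbol{0},\boldsymbol{\Sigma}_t)$ with $\dot{\boldsymbol{\Sigma}}_t=(\boldsymbol{A}_t+\boldsymbol{B}_t\boldsymbol{K}_t)\boldsymbol{\Sigma}_t+\boldsymbol{\Sigma}_t(\boldsymbol{A}_t+\boldsymbol{B}_t\boldsymbol{K}_t)^{\top}+\boldsymbol{B}_t\boldsymbol{B}_t^{\top}$; the covariance $\boldsymbol{\Sigma}_t\in\mathbb{S}^n_{++}$ is viewed as the state of the control problem and $\boldsymbol{P}_t\in\mathbb{S}^n$ as its costate. *)

(* Defs.v *)
From HB Require Import structures.
From mathcomp Require Import all_boot all_order all_algebra.
From mathcomp Require Import all_classical all_reals all_analysis.

Set Implicit Arguments.
Unset Strict Implicit.
Unset Printing Implicit Defensive.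

Import Order.TTheory GRing.Theory Num.Theory.
Import numFieldNormedType.Exports.

Local Open Scope classical_set_scope.
Local Open Scope ring_scope.

(** All time-dependent objects are total functions of [t : R]; only their values
    on [[t0, t1]] are ever constrained or used.  Vectors are columns. *)

Definition quad (R : realType) (n : nat) (M : 'M[R]_n) (v : 'cV[R]_n) : R :=
  (v^T *m M *m v) 0 0.

Definition sqnorm (R : realType) (n : nat) (v : 'cV[R]_n) : R :=
  (v^T *m v) 0 0.

Definition symmx (R : realType) (n : nat) (M : 'M[R]_n) : Prop := M^T = M.

Definition psdmx (R : realType) (n : nat) (M : 'M[R]_n) : Prop :=
  symmx M /\ forall v : 'cV[R]_n, 0 <= quad M v.

Definition pdmx (R : realType) (n : nat) (M : 'M[R]_n) : Prop :=
  symmx M /\ forall v : 'cV[R]_n, v != 0 -> 0 < quad M v.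

Definition mx_continuous_on (R : realType) (p q : nat) (a b : R)
    (M : R -> 'M[R]_(p, q)) : Prop :=
  forall i j, {within `[a, b], continuous (fun t => M t i j)}.

Definition mx_bounded_on (R : realType) (p q : nat) (a b : R)
    (M : R -> 'M[R]_(p, q)) : Prop :=
  exists C : R, forall t, t \in `[a, b] -> forall i j, `|M t i j| <= C.

Definition mx_measurable_on (R : realType) (p q : nat) (a b : R)
    (M : R -> 'M[R]_(p, q)) : Prop :=
  forall i j, measurable_fun `[a, b] (fun t => M t i j).

Definition mx_integrable_on (R : realType) (p q : nat) (a b : R)
    (M : R -> 'M[R]_(p, q)) : Prop :=
  forall i j,
    lebesgue_measure.-integrable `[a, b] (fun t => (M t i j)%:E).

Definition mx_integral (R : realType) (p q : nat) (a b : R)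
    (M : R -> 'M[R]_(p, q)) : 'M[R]_(p, q) :=
  \matrix_(i, j) Rintegral lebesgue_measure `[a, b] (fun t => M t i j).

(** [solves_ode a b X F]: [X] solves [dX/dt = F] on [[a, b]] in the sense of
    Caratheodory (the right-hand side, evaluated along the solution, is [F]).
    The last clause is the classical equation wherever [F] is continuous; it
    follows from the first two by the fundamental theorem of calculus and is
    kept so that the differential form of the equation is explicit. *)
Definition solves_ode (R : realType) (p q : nat) (a b : R)
    (X F : R -> 'M[R]_(p, q)) : Prop :=
  [/\ mx_integrable_on a b F,
      forall t, t \in `[a, b] -> X t = X a + mx_integral a t F &
      forall t, t \in `]a, b[ ->
        (forall i j, {for t, continuous (fun s => F s i j)}) ->
        forall i j, is_derive t 1 (fun s => X s i j) (F t i j)].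

(** [Phi t s], for [s <= t], is the state transition matrix of [dx/dt = A x]. *)
Definition transition_matrix (R : realType) (n : nat) (t0 t1 : R)
    (A : R -> 'M[R]_n) (Phi : R -> R -> 'M[R]_n) : Prop :=
  forall s, s \in `[t0, t1] ->
    Phi s s = 1%:M /\
    solves_ode s t1 (fun t => Phi t s) (fun t => A t *m Phi t s).

Definition gramian (R : realType) (n m : nat) (B : R -> 'M[R]_(n, m))
    (Phi : R -> R -> 'M[R]_n) (s t : R) : 'M[R]_n :=
  mx_integral s t
    (fun r => Phi t r *m B r *m (B r)^T *m (Phi t r)^T).

Definition uniformly_controllable (R : realType) (n m : nat) (t0 t1 : R)
    (A : R -> 'M[R]_n) (B : R -> 'M[R]_(n, m)) : Prop :=
  exists Phi : R -> R -> 'M[R]_n,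
    transition_matrix t0 t1 A Phi /\
    forall s t, t0 <= s -> s < t -> t <= t1 -> pdmx (gramian B Phi s t).

Definition filtration (R : realType) (d : measure_display)
    (T : measurableType d) (F : R -> set (set T)) : Prop :=
  [/\ forall t, sigma_algebra setT (F t),
      forall t, F t `<=` measurable &
      forall s t, s <= t -> F s `<=` F t].

Definition vec_measurable (R : realType) (d : measure_display)
    (T : measurableType d) (n : nat) (G : set (set T)) (X : T -> 'cV[R]_n) :
    Prop :=
  forall (i : 'I_n) (E : set R), measurable E ->
    G ((fun o => X o i 0) @^-1` E).

Definition adapted (R : realType) (d : measure_display)
    (T : measurableType d) (n : nat) (t0 t1 : R) (F : R -> set (set T))
    (X : R -> T -> 'cV[R]_n) : Prop :=
  forall t, t \in `[t0, t1] -> vec_measurable (F t) (X t).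

Definition continuous_paths (R : realType) (d : measure_display)
    (T : measurableType d) (n : nat) (t0 t1 : R) (X : R -> T -> 'cV[R]_n) :
    Prop :=
  forall o, mx_continuous_on t0 t1 (fun t => X t o).

(** Nondegenerate centred Gaussian vector: every nonzero linear functional of
    [X] is a centred normal variable.  [normal_prob] takes the standard
    deviation and is only meaningful when it is nonzero, so [S] must be
    positive definite. *)
Definition normal_vector (R : realType) (d : measure_display)
    (T : measurableType d) (Pr : probability T R) (n : nat) (S : 'M[R]_n)
    (X : T -> 'cV[R]_n) : Prop :=
  [/\ pdmx S, vec_measurable measurable X &
      forall (a : 'cV[R]_n), a != 0 -> forall E : set R, measurable E ->
        Pr ((fun o => (a^T *m X o) 0 0) @^-1` E) =
        normal_prob 0 (Num.sqrt (quad S a)) E].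

(** Standard [m]-dimensional Wiener process on [[t0, t1]] relative to [F].  The
    product formula expresses at once that the increment over [[s, t]] is
    independent of [F s], that its coordinates are independent, and that each
    of them is [N(0, t - s)]. *)
Definition wiener_process (R : realType) (d : measure_display)
    (T : measurableType d) (Pr : probability T R) (m : nat) (t0 t1 : R)
    (F : R -> set (set T)) (w : R -> T -> 'cV[R]_m) : Prop :=
  [/\ adapted t0 t1 F w,
      continuous_paths t0 t1 w,
      {ae Pr, forall o, w t0 o = 0} &
      forall s t, t0 <= s -> s < t -> t <= t1 ->
      forall G, F s G ->
      forall E : 'I_m -> set R, (forall k, measurable (E k)) ->
        (Pr (G `&` \bigcap_k ((fun o => w t o k 0 - w s o k 0)%R @^-1` E k)) =
         Pr G * \prod_(k < m) normal_prob 0%R (Num.sqrt (t - s)) (E k))%E].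

(** Left-endpoint sums of [B dw] over the uniform partition of [[a, b]] into
    [N + 1] intervals. *)
Definition wiener_sum (R : realType) (d : measure_display)
    (T : measurableType d) (n m : nat) (B : R -> 'M[R]_(n, m))
    (w : R -> T -> 'cV[R]_m) (a b : R) (N : nat) (o : T) : 'cV[R]_n :=
  let s k := a + (k%:R / N.+1%:R) * (b - a) in
  \sum_(k < N.+1) B (s k) *m (w (s k.+1) o - w (s k) o).

(** [M] is (a version of) the Ito integral of [B dw] over [[a, b]].  For a
    continuous deterministic integrand [B] the left-endpoint step functions
    converge to [B] uniformly, so that the Ito integral is exactly the
    mean-square limit of the sums above. *)
Definition ito_integral (R : realType) (d : measure_display)
    (T : measurableType d) (Pr : probability T R) (n m : nat)
    (B : R -> 'M[R]_(n, m)) (w : R -> T -> 'cV[R]_m) (a b : R)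
    (M : T -> 'cV[R]_n) : Prop :=
  vec_measurable measurable M /\
  forall i : 'I_n,
    ((fun N : nat =>
        'E_Pr[fun o => ((M o i 0 - wiener_sum B w a b N o i 0) ^+ 2)%R])
       @ \oo --> 0)%E.

(** [x] is a strong solution, on the given filtered probability space and for
    the given [w], of [dx = A x dt + B u dt + B dw], [x t0 = x0]. *)
Definition strong_solution (R : realType) (d : measure_display)
    (T : measurableType d) (Pr : probability T R) (n m : nat) (t0 t1 : R)
    (F : R -> set (set T)) (w : R -> T -> 'cV[R]_m) (x0 : T -> 'cV[R]_n)
    (A : R -> 'M[R]_n) (B : R -> 'M[R]_(n, m))
    (u : R -> T -> 'cV[R]_m) (x : R -> T -> 'cV[R]_n) : Prop :=
  let drift o t := A t *m x t o + B t *m u t o in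
  [/\ adapted t0 t1 F x,
      continuous_paths t0 t1 x,
      {ae Pr, forall o, x t0 o = x0 o},
      {ae Pr, forall o, mx_integrable_on t0 t1 (drift o)} &
      forall t, t \in `[t0, t1] ->
        exists M : T -> 'cV[R]_n,
          ito_integral Pr B w t0 t M /\
          {ae Pr, forall o, x t o = x0 o + mx_integral t0 t (drift o) + M o}].

(** Integral over [R^n] with respect to Lebesgue measure, as an iterated
    integral: by Tonelli the two agree on nonnegative Borel functions. *)
Fixpoint lebesgue_integral_tuple (R : realType) (n : nat) :
    (n.-tuple R -> \bar R) -> \bar R :=
  match n with
  | 0%N => fun f => f [tuple]
  | n'.+1 => fun f =>
      (\int[lebesgue_measure]_(a in [set: R])
         lebesgue_integral_tuple (fun v : n'.-tuple R => f [tuple of a :: v]))%E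
  end.

Definition tuple_col (R : realType) (n : nat) (v : n.-tuple R) : 'cV[R]_n :=
  \col_i tnth v i.

Definition density_finite_second_moment (R : realType) (n : nat)
    (rho : n.-tuple R -> R) : Prop :=
  [/\ measurable_fun [set: n.-tuple R] rho,
      forall v, 0 <= rho v,
      lebesgue_integral_tuple (fun v => (rho v)%:E) = 1%:E &
      (lebesgue_integral_tuple
         (fun v => (rho v * sqnorm (tuple_col v))%:E) < +oo)%E].

(** [u : [t0, t1] * R^n -> R^m] is a feedback policy; the expectation is taken
    over a state with density [rho]. *)
Definition finite_energy (R : realType) (n m : nat) (t0 t1 : R)
    (u : R -> 'cV[R]_n -> 'cV[R]_m) : Prop :=
  forall rho : n.-tuple R -> R, density_finite_second_moment rho ->
    (lebesgue_integral_tuple (fun v =>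
       (rho v)%:E *
       \int[lebesgue_measure]_(t in `[t0, t1]) (sqnorm (u t (tuple_col v)))%:E)
     < +oo)%E.

Definition linear_policy (R : realType) (n m : nat) (K : R -> 'M[R]_(m, n)) :
    R -> 'cV[R]_n -> 'cV[R]_m := fun t v => K t *m v.

Definition feedback (R : realType) (d : measure_display)
    (T : measurableType d) (n m : nat) (u : R -> 'cV[R]_n -> 'cV[R]_m)
    (x : R -> T -> 'cV[R]_n) : R -> T -> 'cV[R]_m := fun t o => u t (x t o).

(** [(K, x)] is an admissible linear feedback together with the state process
    that it generates. *)
Definition feasible (R : realType) (d : measure_display)
    (T : measurableType d) (Pr : probability T R) (n m : nat) (t0 t1 : R)
    (F : R -> set (set T)) (w : R -> T -> 'cV[R]_m) (x0 : T -> 'cV[R]_n)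
    (A : R -> 'M[R]_n) (B : R -> 'M[R]_(n, m))
    (K : R -> 'M[R]_(m, n)) (x : R -> T -> 'cV[R]_n) : Prop :=
  [/\ mx_measurable_on t0 t1 K,
      finite_energy t0 t1 (linear_policy K) &
      strong_solution Pr t0 t1 F w x0 A B (feedback (linear_policy K) x) x].

Definition covmx (R : realType) (d : measure_display) (T : measurableType d)
    (Pr : probability T R) (n : nat) (X : T -> 'cV[R]_n) : 'M[R]_n :=
  \matrix_(i, j)
    fine (covariance Pr (fun o => X o i 0) (fun o => X o j 0)).

Definition cost (R : realType) (d : measure_display) (T : measurableType d)
    (Pr : probability T R) (n m : nat) (t0 t1 : R) (Q : R -> 'M[R]_n)
    (Sigmad : 'M[R]_n) (u : R -> T -> 'cV[R]_m) (x : R -> T -> 'cV[R]_n) :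
    \bar R :=
  let D := covmx Pr (x t1) - Sigmad in
  ((2^-1 * \tr (D *m D))%:E +
   \int[lebesgue_measure]_(t in `[t0, t1])
     'E_Pr[fun o => (sqnorm (u t o) + quad (Q t) (x t o))%R])%E.

Definition optimal (R : realType) (d : measure_display)
    (T : measurableType d) (Pr : probability T R) (n m : nat) (t0 t1 : R)
    (F : R -> set (set T)) (w : R -> T -> 'cV[R]_m) (x0 : T -> 'cV[R]_n)
    (A : R -> 'M[R]_n) (B : R -> 'M[R]_(n, m)) (Q : R -> 'M[R]_n)
    (Sigmad : 'M[R]_n)
    (K : R -> 'M[R]_(m, n)) (x : R -> T -> 'cV[R]_n) : Prop :=
  feasible Pr t0 t1 F w x0 A B K x /\
  forall (K' : R -> 'M[R]_(m, n)) (x' : R -> T -> 'cV[R]_n),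
    feasible Pr t0 t1 F w x0 A B K' x' ->
    (cost Pr t0 t1 Q Sigmad (feedback (linear_policy K) x) x <=
     cost Pr t0 t1 Q Sigmad (feedback (linear_policy K') x') x')%E.

(** The coupled boundary value problem for [(Sigma_t, P_t)]. *)
Definition coupled_bvp (R : realType) (n m : nat) (t0 t1 : R)
    (A : R -> 'M[R]_n) (B : R -> 'M[R]_(n, m)) (Q : R -> 'M[R]_n)
    (Sigma0 Sigmad : 'M[R]_n) (Sigma P : R -> 'M[R]_n) : Prop :=
  let Acl t := A t - B t *m (B t)^T *m P t in
  [/\ forall t, t \in `[t0, t1] -> pdmx (Sigma t) /\ symmx (P t),
      solves_ode t0 t1 Sigma (fun t =>
        Acl t *m Sigma t + Sigma t *m (Acl t)^T + B t *m (B t)^T),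
      solves_ode t0 t1 P (fun t =>
        - ((A t)^T *m P t + P t *m A t - P t *m B t *m (B t)^T *m P t + Q t)),
      Sigma t0 = Sigma0 &
      P t1 = Sigma t1 - Sigmad].

(* Main.v *)
Require Import Defs.
From HB Require Import structures.
From mathcomp Require Import all_boot all_order all_algebra.
From mathcomp Require Import all_classical all_reals all_analysis.
From mathcomp Require Import measurable_realfun.
From mathcomp Require Import ring lra.

Set Implicit Arguments.
Unset Strict Implicit.
Unset Printing Implicit Defensive.

Import Order.TTheory GRing.Theory Num.Theory.
Import numFieldNormedType.Exports.

Local Open Scope classical_set_scope.
Local Open Scope ring_scope.

(** Write [a = A + B K] and let [Th] be the inverse of its transition matrix.
    Then [Th t *m x t - x0] is the Wiener integral of [Th B] over [[t0, t]], and
    the isometry shows that the covariance [S] of the state solves the Lyapunov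
    equation of the informal statement.  Moreover a linear policy has finite
    energy exactly when its gain is square integrable.

    For an optimal gain [K], let [P] solve the linear adjoint equation
    [- P' = a^T P + P a + K^T K + Q], [P t1 = S t1 - Sigmad], and put
    [G = K + B^T P].  The gain [K - eps G] is feasible; if [S'] and [J'] are its
    covariance and cost, pairing [P] with [S' - S] gives the exact identity
      [J' - J = 1/2 tr ((S'(t1) - S(t1))^2) - (2 eps - eps^2) int tr (G^T G S')].
    As [S' - S = O(eps)], optimality forces [int tr (G^T G S) = 0], so [G = 0]
    almost everywhere because [S] is positive definite.  Substituting
    [K = - B^T P] turns the adjoint equation into the Riccati equation. *)

(** * Integrability classes *)

(** The noise is additive with a deterministic coefficient, so every stochastic argument reduces to
    integrals of deterministic integrands and to linear equations solved path by path; no Ito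
    formula is used. The obstacle is regularity: finite energy makes a gain square integrable in
    time, but neither bounded nor continuous. All differential equations are therefore kept in
    integral form ([primitive], [mxprim]), and the product rule behind duality and variation of
    constants comes from Stieltjes sums instead of pointwise derivatives. The same sums present
    [Th x - x0] as an almost sure limit of Wiener integrals.

    The derivative of the Hamiltonian in the gain is [2 G S]; the direction [- G] drops the positive
    definite factor. It is itself only square integrable, which is the class in which feasibility
    survives. The forcing of [S' - S] is written with [S'] instead of [S]; this makes the cost
    identity exact, so that differentiability in [eps] never enters and a bound linear in [eps]
    suffices. The gain is identified only off a null set, which the integral form of the equations
    does not see. *)

Section integrable_helpers.
Context {d : measure_display} {T : measurableType d} {R : realType}.
Variables (mu : {measure set T -> \bar R}) (D : set T).
Hypothesis mD : measurable D.
Implicit Types f g : T -> R.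

Definition rintegrable f := mu.-integrable D (EFin \o f).

Lemma rintegrable_meas f : rintegrable f -> measurable_fun D f.
Proof. by case/integrableP => /measurable_EFinP. Qed.

Lemma eq_rintegrable f g : {in D, f =1 g} -> rintegrable f -> rintegrable g.
Proof. by move=> fg; apply: eq_integrable => // x xD /=; rewrite fg. Qed.

Lemma rintegrableD f g :
  rintegrable f -> rintegrable g -> rintegrable (fun x => f x + g x).
Proof. by move=> hf hg; have := integrableD mD hf hg; apply: eq_integrable. Qed.

Lemma rintegrableB f g :
  rintegrable f -> rintegrable g -> rintegrable (fun x => f x - g x).
Proof. by move=> hf hg; have := integrableB mD hf hg; apply: eq_integrable. Qed.

Lemma rintegrableZ c f : rintegrable f -> rintegrable (fun x => c * f x).
Proof. by move=> hf; have := integrableZl mD c hf; apply: eq_integrable. Qed.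

Lemma rintegrableN f : rintegrable f -> rintegrable (fun x => - f x).
Proof. by move=> hf; have := integrableN hf; apply: eq_integrable. Qed.

Lemma rintegrable0 : rintegrable (fun=> 0).
Proof. exact: integrable0. Qed.

Lemma rintegrable_sum I (s : seq I) (P : pred I) (F : I -> T -> R) :
  (forall i, P i -> rintegrable (F i)) ->
  rintegrable (fun x => \sum_(i <- s | P i) F i x).
Proof.
move=> hF; elim: s => [|i s ih].
  by apply: eq_rintegrable rintegrable0 => x _; rewrite big_nil.
apply: (@eq_rintegrable
    (fun x => (if P i then F i x else 0) + \sum_(j <- s | P j) F j x)).
  by move=> x _; rewrite big_cons; case: (P i) => //; rewrite add0r.
apply: rintegrableD ih; case: (P i) (hF i) => [|_]; [exact|exact: rintegrable0].
Qed.

Lemma le_rintegrable f g : measurable_fun D f ->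
  (forall x, D x -> `|f x| <= `|g x|) -> rintegrable g -> rintegrable f.
Proof.
by move=> mf fg hg; apply: le_integrable hg => //; exact/measurable_EFinP.
Qed.

Lemma rintegral_sum I (s : seq I) (P : pred I) (F : I -> T -> R) :
  (forall i, P i -> rintegrable (F i)) ->
  \int[mu]_(x in D) (\sum_(i <- s | P i) F i x) =
  \sum_(i <- s | P i) \int[mu]_(x in D) F i x.
Proof.
move=> hF; elim: s => [|i s ih].
  rewrite big_nil; under eq_Rintegral do rewrite big_nil.
  by rewrite /Rintegral integral0.
rewrite big_cons; under eq_Rintegral do rewrite big_cons.
case: ifPn => // Pi; rewrite RintegralD ?ih//; first exact: hF.
exact: rintegrable_sum.
Qed.

Lemma rintegralN f : rintegrable f ->
  \int[mu]_(x in D) (- f x) = - \int[mu]_(x in D) f x.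
Proof.
move=> hf; rewrite -mulN1r -RintegralZl//.
by apply: eq_Rintegral => x _; rewrite mulN1r.
Qed.

Lemma rintegral0 : \int[mu]_(x in D) (0 : R) = 0.
Proof. by rewrite /Rintegral integral0. Qed.

Lemma rintegral_EFin f : rintegrable f ->
  (\int[mu]_(x in D) (f x)%:E)%E = (\int[mu]_(x in D) f x)%:E.
Proof. by move=> hf; rewrite /Rintegral fineK//; exact: integrable_fin_num. Qed.

Lemma le_norm_rintegral f g : measurable_fun D f -> rintegrable g ->
  (forall x, D x -> `|f x| <= g x) ->
  `|\int[mu]_(x in D) f x| <= \int[mu]_(x in D) g x.
Proof.
move=> mf hg fg.
have hf : rintegrable f.
  by apply: le_rintegrable hg => // x Dx; rewrite (le_trans (fg x Dx))// ler_norm.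
apply: le_trans (le_normr_Rintegral mD hf) _; apply: le_Rintegral => //.
exact: integrable_norm.
Qed.

Definition sqintegrable f :=
  measurable_fun D f /\ rintegrable (fun x => f x ^+ 2).

Lemma sqintegrable_mul f g : sqintegrable f -> sqintegrable g ->
  rintegrable (fun x => f x * g x).
Proof.
move=> [mf hf] [mg hg].
apply: (@le_rintegrable _ (fun x => f x ^+ 2 + g x ^+ 2)).
- exact: measurable_funM.
- move=> x Dx; rewrite normrM [leRHS]ger0_norm ?addr_ge0 ?sqr_ge0//.
  rewrite -(real_normK (num_real (f x))) -(real_normK (num_real (g x))).
  have := sqr_ge0 (`|f x| - `|g x|).
  have := mulr_ge0 (normr_ge0 (f x)) (normr_ge0 (g x)); nra.
- exact: rintegrableD.
Qed.

Lemma sqintegrableD f g : sqintegrable f -> sqintegrable g ->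
  sqintegrable (fun x => f x + g x).
Proof.
move=> hf hg; have hfg := sqintegrable_mul hf hg.
move: hf hg => [mf hf] [mg hg]; split; first exact: measurable_funD.
apply: (@eq_rintegrable (fun x => f x ^+ 2 + g x ^+ 2 + 2 * (f x * g x))).
  by move=> x _ /=; ring.
by apply: rintegrableD; [exact: rintegrableD|exact: rintegrableZ].
Qed.

Lemma sqintegrableZ c f : sqintegrable f -> sqintegrable (fun x => c * f x).
Proof.
move=> [mf hf]; split; first exact: measurable_funM.
apply: (@eq_rintegrable (fun x => c ^+ 2 * (f x ^+ 2))).
  by move=> x _ /=; ring.
exact: rintegrableZ.
Qed.

Lemma sqintegrable0 : sqintegrable (fun=> 0).
Proof.
split; first exact: measurable_cst.
by apply: eq_rintegrable rintegrable0 => x _ /=; rewrite expr0n.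
Qed.

Lemma sqintegrableB f g : sqintegrable f -> sqintegrable g ->
  sqintegrable (fun x => f x - g x).
Proof.
move=> hf hg; have := sqintegrableD hf (sqintegrableZ (-1) hg).
by rewrite (_ : (fun _ => _) = (fun x => f x - g x))//; apply/funext => x; ring.
Qed.

Lemma sqintegrable_sum I (s : seq I) (P : pred I) (F : I -> T -> R) :
  (forall i, P i -> sqintegrable (F i)) ->
  sqintegrable (fun x => \sum_(i <- s | P i) F i x).
Proof.
move=> hF; elim: s => [|i s ih].
  rewrite (_ : (fun _ => _) = fun=> 0); first exact: sqintegrable0.
  by apply/funext => x; rewrite big_nil.
rewrite (_ : (fun _ => _) =
    fun x => (if P i then F i x else 0) + \sum_(j <- s | P j) F j x); last first.
  by apply/funext => x; rewrite big_cons; case: (P i) => //; rewrite add0r.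
apply: sqintegrableD ih; case: (P i) (hF i) => [|_]; [exact|exact: sqintegrable0].
Qed.

(** The multipliers of the calculus: a bounded measurable factor preserves [rintegrable], whereas
    two [sqintegrable] factors only give a [rintegrable] product. Continuous coefficients,
    transition matrices and covariances fall in this class, gains in the square-integrable one. *)
Definition bmeasurable f :=
  measurable_fun D f /\ exists C, forall x, D x -> `|f x| <= C.

Lemma bmeasurableD f g : bmeasurable f -> bmeasurable g ->
  bmeasurable (fun x => f x + g x).
Proof.
move=> [mf [C hf]] [mg [E hg]]; split; first exact: measurable_funD.
by exists (C + E) => x Dx; rewrite (le_trans (ler_normD _ _))// lerD ?hf ?hg.
Qed.

Lemma bmeasurableM f g : bmeasurable f -> bmeasurable g ->
  bmeasurable (fun x => f x * g x).
Proof.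
move=> [mf [C hf]] [mg [E hg]]; split; first exact: measurable_funM.
by exists (C * E) => x Dx; rewrite normrM ler_pM ?hf ?hg.
Qed.

Lemma bmeasurable_cst c : bmeasurable (fun=> c).
Proof. by split; [exact: measurable_cst|exists `|c|]. Qed.

Lemma bmeasurable_sum I (s : seq I) (P : pred I) (F : I -> T -> R) :
  (forall i, P i -> bmeasurable (F i)) ->
  bmeasurable (fun x => \sum_(i <- s | P i) F i x).
Proof.
move=> hF; elim: s => [|i s ih].
  rewrite (_ : (fun _ => _) = fun=> 0); first exact: bmeasurable_cst.
  by apply/funext => x; rewrite big_nil.
rewrite (_ : (fun _ => _) =
    fun x => (if P i then F i x else 0) + \sum_(j <- s | P j) F j x); last first.
  by apply/funext => x; rewrite big_cons; case: (P i) => //; rewrite add0r.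
apply: bmeasurableD ih; case: (P i) (hF i) => [|_]; [exact|exact: bmeasurable_cst].
Qed.

Lemma bmeasurable_mul f g : bmeasurable f -> rintegrable g ->
  rintegrable (fun x => f x * g x).
Proof.
move=> [mf [C hf]] hg.
apply: (@le_rintegrable _ (fun x => C * g x)).
- by apply: measurable_funM => //; exact: rintegrable_meas.
- move=> x Dx; rewrite !normrM ler_wpM2r//.
  by rewrite (le_trans (hf x Dx))// ler_norm.
- exact: rintegrableZ.
Qed.

Lemma bmeasurable_mulr f g : bmeasurable f -> rintegrable g ->
  rintegrable (fun x => g x * f x).
Proof.
move=> hf hg; apply: eq_rintegrable (bmeasurable_mul hf hg) => x _.
by rewrite mulrC.
Qed.

End integrable_helpers.
Arguments rintegrable {d T R} mu D f.
Arguments sqintegrable {d T R} mu D f.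
Arguments bmeasurable {d T R} D f.

Section finite_measure_helpers.
Context {d : measure_display} {T : measurableType d} {R : realType}.
Variables (mu : {measure set T -> \bar R}) (D : set T).
Hypothesis mD : measurable D.
Hypothesis fD : (mu D < +oo)%E.

Lemma bmeasurable_rintegrable (f : T -> R) : bmeasurable D f -> rintegrable mu D f.
Proof.
move=> [mf [C hC]]; apply: measurable_bounded_integrable => //.
exists C; split; first exact: num_real.
by move=> y Cy x Dx /=; exact: le_trans (hC _ Dx) (ltW Cy).
Qed.

Lemma sqintegrable_rintegrable (f : T -> R) :
  sqintegrable mu D f -> rintegrable mu D f.
Proof.
move=> hf.
have h1 : sqintegrable mu D (fun=> 1).
  split; first exact: measurable_cst.
  by apply: bmeasurable_rintegrable; exact: bmeasurable_cst.
have := sqintegrable_mul mD hf h1.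
by apply: (eq_rintegrable mD) => x _; rewrite mulr1.
Qed.

Lemma bmeasurable_sqintegrable (f : T -> R) :
  bmeasurable D f -> sqintegrable mu D f.
Proof.
move=> hf; split; first by case: hf.
apply: (eq_rintegrable mD) (bmeasurable_rintegrable (bmeasurableM hf hf)) => x _ /=.
by rewrite expr2.
Qed.

End finite_measure_helpers.

(** * Absolutely continuous functions and Stieltjes sums *)

Section real_intervals.
Context {R : realType}.
Notation leb := (@lebesgue_measure R).
Implicit Types (a b s t : R) (h f X F : R -> R).

Lemma itv_meas a b : measurable (`[a, b] : set (measurableTypeR R)).
Proof. exact: measurable_itv. Qed.

Lemma itv_fin a b : (leb `[a, b]%classic < +oo)%E.
Proof. by rewrite lebesgue_measure_itv/=; case: ifPn; rewrite ?ltry. Qed.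

Lemma mem_itvcc a b t : (`[a, b]%classic t) = (a <= t <= b) :> Prop.
Proof. by rewrite /= in_itv. Qed.

Lemma within_contP a b h : {within `[a, b], continuous h} <->
  (forall x, a <= x <= b -> forall e, 0 < e -> exists2 r, 0 < r &
    forall y, a <= y <= b -> `|x - y| < r -> `|h x - h y| < e).
Proof.
split=> [/subspace_continuousP ch x abx e e0|H].
  have xI : `[a, b]%classic x by rewrite mem_itvcc.
  have := ch x xI => /cvgrPdist_lt /(_ e e0).
  rewrite near_withinE => -[r /= r0 hr]; exists r => // y aby xy.
  by apply: (hr y xy); rewrite /= in_itv.
apply/subspace_continuousP => x /=; rewrite in_itv/= => abx.
apply/cvgrPdist_lt => e e0; rewrite near_withinE.
have [r r0 hr] := H x abx e e0; exists r => // y /= xy.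
by rewrite in_itv/= => aby; exact: hr.
Qed.

(** Heine-Cantor through the near-covering form of compactness: the modulus at a centre, halved in
    radius and in [e], serves every nearby point. *)
Lemma within_unif_cont a b h : {within `[a, b], continuous h} ->
  forall e, 0 < e -> exists2 r, 0 < r &
    forall x y, a <= x <= b -> a <= y <= b -> `|x - y| < r ->
      `|h x - h y| < e.
Proof.
move=> /within_contP ch e e0.
have /compact_near_coveringP cab := @segment_compact R a b.
pose P (dl : R) (x : R) := a <= x <= b -> forall y, a <= y <= b ->
  `|x - y| < dl -> `|h x - h y| < e.
have H : \forall dl \near (0:R)^'+, `[a, b] `<=` P dl.
  apply: cab => x /=; rewrite in_itv/= => abx.
  have [r r0 hr] := ch x abx (e / 2) (divr_gt0 e0 (ltr0n _ 2)).
  have r20 : 0 < r / 2 by rewrite divr_gt0.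
  near=> y dl => /= aby z abz yz.
  have xy : `|x - y| < r / 2.
    near: y; exact: nbhsx_ballx.
  have dlr : dl < r / 2.
    near: dl; exact: nbhs_right_lt.
  have xz : `|x - z| < r.
    rewrite [r]splitr -(subrKA y) (le_lt_trans (ler_normD _ _))// ltrD//.
    exact: lt_trans yz dlr.
  have xyr : `|x - y| < r by rewrite (lt_trans xy)// ltr_pdivrMr// ltr_pMr// ltr1n.
  rewrite -(subrKA (h x)) (le_lt_trans (ler_normD _ _))// [e]splitr ltrD//.
    by rewrite distrC hr.
  exact: hr.
have [dl [dl0 hdl]] : exists dl : R, 0 < dl /\ `[a, b] `<=` P dl.
  near (0:R)^'+ => dl; exists dl; split => //.
  by near: dl.
by exists dl => // x y abx aby; apply: (hdl x) => //; rewrite mem_itvcc.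
Unshelve. all: by end_near. Qed.

Lemma within_cont_bmeas a b h :
  {within `[a, b], continuous h} -> bmeasurable (`[a, b] : set (measurableTypeR R)) h.
Proof.
move=> ch; split.
  by apply: subspace_continuous_measurable_fun => //; exact: itv_meas.
have /compact_bounded[M [_ mrt]] := continuous_compact ch (@segment_compact R a b).
by exists (M + 1) => x abx; apply: (mrt (M + 1)); rewrite ?ltrDl//; exists x.
Qed.

(** Absolute continuity with density [F], phrased as an integral equation since the densities met
    below are merely integrable. *)
Definition primitive a b X F := rintegrable leb `[a, b] F /\
  forall t, a <= t <= b -> X t = X a + \int[leb]_(x in `[a, t]) F x.

Lemma itv_sub s t a b : a <= s -> t <= b -> `[s, t] `<=` `[a, b].
Proof.
by move=> s1 t1 x; rewrite !mem_itvcc => /andP[sx xt]; rewrite (le_trans s1)//= (le_trans xt).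
Qed.

Lemma rintegrable_sub f a b s t : a <= s -> t <= b ->
  rintegrable leb `[a, b] f -> rintegrable leb `[s, t] f.
Proof. by move=> s1 t1; apply: integrableS => //; exact: itv_sub. Qed.

Lemma rintegral_split f a s t : a <= s -> s <= t ->
  rintegrable leb `[a, t] f ->
  \int[leb]_(x in `[a, t]) f x =
  \int[leb]_(x in `[a, s]) f x + \int[leb]_(x in `[s, t]) f x.
Proof.
move=> as_ st hf; apply/eqP; rewrite addrC -subr_eq; apply/eqP.
rewrite Rintegral_itvB ?bnd_simp//.
rewrite Rintegral_itv_obnd_cbnd//.
apply: integrableS hf => //.
by apply: subset_itvr; rewrite bnd_simp.
Qed.

Lemma primitive_incr a b X F s t : primitive a b X F ->
  a <= s -> s <= t -> t <= b -> X t - X s = \int[leb]_(x in `[s, t]) F x.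
Proof.
move=> [iF XF] as_ st tb.
rewrite (XF t) ?tb ?(le_trans as_)// (XF s) ?as_ ?(le_trans st)//.
rewrite (@rintegral_split F a s t)//; last exact: rintegrable_sub iF.
by ring.
Qed.

Lemma primitive_cont a b X F : primitive a b X F ->
  {within `[a, b], continuous X}.
Proof.
move=> [iF XF].
have [ab|ba] := leP a b; last first.
  by apply/within_contP => x /andP[/le_trans h /h]; rewrite leNgt ba.
have := @parameterized_integral_continuous R a b F ab iF.
move=> /within_contP H; apply/within_contP => x abx e e0.
have [r r0 hr] := H x abx e e0; exists r => // y aby xy.
rewrite (XF x)// (XF y)//; have := hr y aby xy.
rewrite /parameterized_integral.
by congr (`|_| < _); ring.
Qed.

Lemma primitive_cst a b c : primitive a b (fun=> c) (fun=> 0).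
Proof.
split; first exact: rintegrable0.
by move=> t _; rewrite rintegral0 addr0.
Qed.

Lemma primitiveD a b X Y F G : primitive a b X F -> primitive a b Y G ->
  primitive a b (fun t => X t + Y t) (fun t => F t + G t).
Proof.
move=> [iF XF] [iG YG]; split; first exact: rintegrableD.
move=> t /[dup] abt /andP[at_ tb].
rewrite XF// YG// RintegralD//; first by ring.
- exact: rintegrable_sub iF.
- exact: rintegrable_sub iG.
Qed.

Lemma primitiveZ a b X F c : primitive a b X F ->
  primitive a b (fun t => c * X t) (fun t => c * F t).
Proof.
move=> [iF XF]; split; first exact: rintegrableZ.
move=> t /[dup] abt /andP[at_ tb].
rewrite XF// RintegralZl//; first by ring.
exact: rintegrable_sub iF.
Qed.

Lemma primitive_sum a b I (r : seq I) (P : pred I) (X F : I -> R -> R) :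
  (forall i, P i -> primitive a b (X i) (F i)) ->
  primitive a b (fun t => \sum_(i <- r | P i) X i t)
                (fun t => \sum_(i <- r | P i) F i t).
Proof.
move=> hX; split; first by apply: rintegrable_sum => // i /hX [].
move=> t abt; rewrite rintegral_sum//; last first.
  move=> i /hX [iF _]; apply: rintegrable_sub iF => //.
  by case/andP: abt.
by rewrite -big_split/=; apply: eq_bigr => i /hX [_ ->].
Qed.

Lemma eq_primitive a b X F Y G : primitive a b X F ->
  (forall t, a <= t <= b -> X t = Y t) -> (forall t, a <= t <= b -> F t = G t) ->
  primitive a b Y G.
Proof.
move=> [iF XF] XY FG; split.
  apply: (eq_rintegrable (itv_meas a b)) iF => t.
  by rewrite inE mem_itvcc => /FG.
move=> t /[dup] abt /andP[at_ tb].
rewrite -XY// -XY ?lexx ?(le_trans at_)// XF//; congr (_ + _).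
apply: eq_Rintegral => x; rewrite inE mem_itvcc => /andP[ax xt].
by rewrite FG// ax (le_trans xt).
Qed.

Lemma primitive_integral a b F : rintegrable leb `[a, b] F ->
  primitive a b (fun t => \int[leb]_(x in `[a, t]) F x) F.
Proof.
by move=> iF; split => // t abt; rewrite set_itv1 Rintegral_set1 add0r.
Qed.

Lemma primitive_sub a b s t X F : a <= s -> s <= t -> t <= b ->
  primitive a b X F -> primitive s t X F.
Proof.
move=> as_ st tb pX; split; first by case: pX => iF _; exact: rintegrable_sub iF.
move=> r /andP[sr rt]; rewrite -(primitive_incr pX as_ sr (le_trans rt tb)).
by rewrite subrKC.
Qed.

End real_intervals.

(** * Uniform partitions, Stieltjes sums and integration by parts *)

Section uniform_grid.
Context {R : realType}.
Notation leb := (@lebesgue_measure R).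
Implicit Types (a b s t : R) (h f X F : R -> R).

(** The points are those of [wiener_sum], written so that both expressions agree by conversion. *)
Definition grid a b (N k : nat) : R := a + k%:R / N.+1%:R * (b - a).

Lemma grid0 a b N : grid a b N 0 = a.
Proof. by rewrite /grid mul0r mul0r addr0. Qed.

Lemma gridN a b N : grid a b N N.+1 = b.
Proof. by rewrite /grid divff ?pnatr_eq0// mul1r subrKC. Qed.

Lemma gridS a b N k : grid a b N k.+1 = grid a b N k + (b - a) / N.+1%:R.
Proof.
by rewrite /grid -natr1 mulrDl mulrDl mul1r addrA [N.+1%:R^-1 * _]mulrC.
Qed.

Lemma grid_mono a b N k l : a <= b -> (k <= l)%N -> grid a b N k <= grid a b N l.
Proof.
move=> ab kl; rewrite lerD2l ler_wpM2r ?subr_ge0// ler_wpM2r ?invr_ge0 ?ler0n//.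
by rewrite ler_nat.
Qed.

Lemma grid_in a b N k : a <= b -> (k <= N.+1)%N -> a <= grid a b N k <= b.
Proof.
move=> ab kN; have := grid_mono N ab (leq0n k); rewrite grid0 => ->.
by have := grid_mono N ab kN; rewrite gridN.
Qed.

Lemma grid_mesh a b (e : R) : 0 < e -> a <= b ->
  exists N0, forall N, (N0 <= N)%N -> (b - a) / N.+1%:R < e.
Proof.
move=> e0 ab; exists (Num.trunc ((b - a) / e)) => N hN.
rewrite ltr_pdivrMr ?ltr0n// mulrC -ltr_pdivrMr//.
have /andP[_ h] : (Num.trunc ((b - a) / e))%:R <= (b - a) / e
    < (Num.trunc ((b - a) / e)).+1%:R.
  by apply: trunc_itv; rewrite divr_ge0 ?subr_ge0// ltW.
by rewrite (lt_le_trans h)// ler_nat ltnS.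
Qed.

(** Half-open on the right, so that consecutive cells are disjoint, tile [[a, b[], and are
    differences of the cut-offs [r < t] used by [wiener_int_inc]. *)
Definition cell a b N k t : R := ((grid a b N k <= t) && (t < grid a b N k.+1))%:R.

Lemma cell_sum a b N t : a <= b ->
  \sum_(k < N.+1) cell a b N k t = ((a <= t) && (t < b))%:R.
Proof.
move=> ab.
have cE (k : nat) : cell a b N k t =
    ((t < grid a b N k.+1)%R)%:R - ((t < grid a b N k)%R)%:R.
  rewrite /cell leNgt; have := @grid_mono a b N k k.+1 ab (leqnSn k).
  case: ltP => h1; case: ltP => h2 h3 /=; rewrite ?subrr ?subr0//.
  by have := lt_le_trans h1 (le_trans h3 h2); rewrite ltxx.
under eq_bigr do rewrite cE.
rewrite -(big_mkord xpredT (fun k => ((t < grid a b N k.+1)%R)%:R - ((t < grid a b N k)%R)%:R)).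
rewrite telescope_sumr// gridN grid0 leNgt.
case: (ltP t a) => h1; case: (ltP t b) => h2 /=; rewrite ?subrr ?subr0//.
by have := lt_le_trans h1 (le_trans ab h2); rewrite ltxx.
Qed.

Lemma cell_near a b N k t (e : bool) : a <= b -> cell a b N k t != 0 ->
  `|grid a b N (k + e) - t| <= (b - a) / N.+1%:R.
Proof.
move=> ab; rewrite /cell; case: andP => [[h1 h2] _|]; last by rewrite eqxx.
have := gridS a b N k; move: ((b - a) / _) => m.
case: e; rewrite ?addn1 ?addn0 ler_norml => h3; apply/andP; split; lra.
Qed.

(** [e] selects the right ([true]) or left ([false]) endpoint of a cell. Uniform continuity controls
    the one cell that contains [t]; for [t] outside [[a, b[] both terms vanish, so the estimate
    holds on the whole line. *)
Lemma step_approx a b h (e : bool) : a <= b -> {within `[a, b], continuous h} ->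
  forall dl, 0 < dl -> exists N0, forall N, (N0 <= N)%N -> forall t,
   `|\sum_(k < N.+1) h (grid a b N (k + e)) * cell a b N k t
     - h t * ((a <= t) && (t < b))%:R| <= dl.
Proof.
move=> ab ch dl dl0.
have [r r0 hr] := within_unif_cont ch dl0.
have [N0 hN0] := grid_mesh r0 ab; exists N0 => N /hN0 hN t.
rewrite -(cell_sum N t ab) mulr_sumr -sumrB.
under eq_bigr do rewrite -mulrBl.
apply: le_trans (ler_norm_sum _ _ _) _.
apply: (@le_trans _ _ (\sum_(k < N.+1) dl * cell a b N k t)); last first.
  rewrite -mulr_sumr cell_sum//; case: andP => _ /=; rewrite ?mulr1 ?mulr0//.
  exact: ltW.
apply: ler_sum => k _; rewrite normrM.
have [->|ck] := eqVneq (cell a b N k t) 0; first by rewrite normr0 !mulr0.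
have tab : a <= t <= b.
  move: ck; rewrite /cell; case: andP => [[h1 h2] _|]; last by rewrite eqxx.
  have /andP[k1 _] := @grid_in a b N k ab (ltnW (ltn_ord k)).
  have /andP[_ k2] := @grid_in a b N k.+1 ab (ltn_ord k).
  by rewrite (le_trans k1)//= (le_trans (ltW h2)).
have c0 : 0 <= cell a b N k t by rewrite /cell ler0n.
rewrite (ger0_norm c0) ler_wpM2r//.
apply/ltW/hr => //; last exact: le_lt_trans (cell_near e ab ck) hN.
by apply: grid_in => //; case: e; rewrite ?addn1 ?addn0// ltnW.
Qed.

(** Over one cell the sum and the integral differ by the integral of [h x - h endpoint] times [F x].
    Uniform continuity bounds the first factor, and the integrals of [|F|] over the cells add up to
    [C]. The endpoint is left free because [primitiveM] needs both choices. *)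
Lemma stieltjes_cvg a b h X F (e : bool) : a <= b ->
  {within `[a, b], continuous h} -> primitive a b X F ->
  (fun N => \sum_(k < N.+1)
     h (grid a b N (k + e)) * (X (grid a b N k.+1) - X (grid a b N k)))
   @ \oo --> \int[leb]_(x in `[a, b]) (h x * F x).
Proof.
move=> ab ch pX; have [iF _] := pX.
have ihF : rintegrable leb `[a, b] (fun x => h x * F x).
  by apply: bmeasurable_mul => //; exact: within_cont_bmeas.
have inF : rintegrable leb `[a, b] (fun x => `|F x|) by exact: integrable_norm.
have pI := primitive_integral ihF.
have pn := primitive_integral inF.
set C := \int[leb]_(x in `[a, b]) `|F x|.
have C0 : 0 <= C by apply: Rintegral_ge0.
apply/cvgrPdist_le => dl dl0.
have d1 : 0 < dl / (C + 1) by rewrite divr_gt0// ltr_wpDl.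
have [r r0 hr] := within_unif_cont ch d1.
have [N0 hN0] := grid_mesh r0 ab.
exists N0 => // N /= /hN0 hN.
have tel Y G : primitive a b Y G ->
    Y b - Y a = \sum_(k < N.+1) (Y (grid a b N k.+1) - Y (grid a b N k)).
  move=> _; rewrite -(big_mkord xpredT (fun k => Y (grid a b N k.+1) - Y (grid a b N k))).
  by rewrite telescope_sumr// gridN grid0.
have := tel _ _ pI; rewrite set_itv1 Rintegral_set1 subr0 => ->.
rewrite -sumrB (le_trans (ler_norm_sum _ _ _))//.
apply: (@le_trans _ _ (\sum_(k < N.+1) dl / (C + 1) *
    \int[leb]_(x in `[grid a b N k, grid a b N k.+1]) `|F x|)); last first.
  rewrite -mulr_sumr.
  have := tel _ _ pn; rewrite set_itv1 Rintegral_set1 subr0 -/C => E.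
  rewrite (_ : \sum_(i < N.+1) _ = C); last first.
    rewrite E; apply: eq_bigr => k _; rewrite (primitive_incr pn)//.
    - by case/andP: (@grid_in a b N k ab (ltnW (ltn_ord k))).
    - exact: grid_mono.
    - by case/andP: (@grid_in a b N k.+1 ab (ltn_ord k)).
  by rewrite mulrAC ler_pdivrMr ?ltr_wpDl// ler_pM2l// lerDl.
apply: ler_sum => k _.
have /andP[k1 _] := @grid_in a b N k ab (ltnW (ltn_ord k)).
have /andP[_ k2] := @grid_in a b N k.+1 ab (ltn_ord k).
have k12 : grid a b N k <= grid a b N k.+1 by exact: grid_mono.
rewrite (primitive_incr pX)// (primitive_incr pI)//.
have sF := rintegrable_sub k1 k2 iF.
have shF := rintegrable_sub k1 k2 ihF.
have snF := rintegrable_sub k1 k2 inF.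
rewrite -RintegralZl// -RintegralZl// -RintegralB//; last exact: rintegrableZ.
apply: le_norm_rintegral => //.
- by apply: (rintegrable_meas (mu := leb)); apply: rintegrableB => //; exact: rintegrableZ.
- exact: rintegrableZ.
- move=> x; rewrite mem_itvcc => /andP[kx xk].
  rewrite -mulrBl normrM ler_wpM2r//; apply/ltW/hr => //.
  + by rewrite (le_trans k1)//= (le_trans xk).
  + by apply: grid_in => //; case: e; rewrite ?addn1 ?addn0// ltnW.
  + rewrite (le_lt_trans _ hN)//; have := gridS a b N k.
    move: ((b - a) / _) => m.
    by case: e; rewrite ?addn1 ?addn0 ler_norml => h3; apply/andP; split; lra.
Qed.

(** Telescoping of [X * Y] along the grid: each increment is [Y] at the right endpoint times the
    increment of [X], plus [X] at the left endpoint times the increment of [Y]. Both Stieltjes sums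
    converge by [stieltjes_cvg]. *)
Lemma primitiveM a b X Y F G : primitive a b X F -> primitive a b Y G ->
  primitive a b (fun t => X t * Y t) (fun t => F t * Y t + X t * G t).
Proof.
move=> pX pY; have [iF _] := pX; have [iG _] := pY.
have cX := primitive_cont pX; have cY := primitive_cont pY.
split.
  apply: rintegrableD => //.
    by apply: bmeasurable_mulr => //; exact: within_cont_bmeas.
  by apply: bmeasurable_mul => //; exact: within_cont_bmeas.
move=> t /andP[at_ tb].
have pXt := primitive_sub (lexx a) at_ tb pX.
have pYt := primitive_sub (lexx a) at_ tb pY.
have cXt := primitive_cont pXt; have cYt := primitive_cont pYt.
have h1 := @stieltjes_cvg a t Y X F true at_ cYt pXt.
have h2 := @stieltjes_cvg a t X Y G false at_ cXt pYt.
have h3 : (fun _ : nat => X t * Y t - X a * Y a) @ \oo -->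
    \int[leb]_(x in `[a, t]) (Y x * F x) + \int[leb]_(x in `[a, t]) (X x * G x).
  apply: cvg_trans (cvgD h1 h2); apply: near_eq_cvg; near=> N.
  rewrite fctE -big_split/=.
  have := @telescope_sumr R 0 N.+1 (fun k => X (grid a t N k) * Y (grid a t N k)) (leq0n _).
  rewrite big_mkord gridN grid0 => <-; apply: eq_bigr => k _.
  by rewrite addn1 addn0; ring.
have E := cvg_unique (@Rhausdorff R) (cvg_cst _) h3.
rewrite RintegralD//; last 2 first.
- apply: bmeasurable_mulr => //; first exact: within_cont_bmeas.
  exact: rintegrable_sub iF.
- apply: bmeasurable_mul => //; first exact: within_cont_bmeas.
  exact: rintegrable_sub iG.
rewrite (_ : \int[leb]_(x in `[a, t]) (F x * Y x) = \int[leb]_(x in `[a, t]) (Y x * F x)).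
  by rewrite -E; ring.
by apply: eq_Rintegral => x _; rewrite mulrC.
Unshelve. all: by end_near. Qed.

Lemma primitive_exp a b X F k : primitive a b X F ->
  primitive a b (fun t => X t ^+ k.+1) (fun t => k.+1%:R * (X t ^+ k * F t)).
Proof.
move=> pX; elim: k => [|k ih].
  by apply: (eq_primitive pX) => t _; [rewrite expr1|rewrite expr0 !mul1r].
apply: (eq_primitive (primitiveM pX ih)) => t _; first by rewrite [RHS]exprS.
by rewrite -[in RHS]natr1 exprS; ring.
Qed.

End uniform_grid.

(** * Matrix-valued functions and linear differential equations *)

Section matrix_functions.
Context {R : realType}.
Notation leb := (@lebesgue_measure R).
Implicit Types (a b s t : R).

(** One entrywise predicate serves [mxbnd], [mxint] and [mxsq], so that closure under each matrix
    operation is reduced once and for all to the scalar case. *)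
Definition mxall (P : (R -> R) -> Prop) p q (M : R -> 'M[R]_(p, q)) :=
  forall i j, P (fun t => M t i j).

Lemma mxall_mul (P1 P2 P3 : (R -> R) -> Prop) :
  (forall f g, P1 f -> P2 g -> P3 (fun t => f t * g t)) ->
  (forall n (F : 'I_n -> R -> R), (forall i, P3 (F i)) ->
     P3 (fun t => \sum_i F i t)) ->
  forall p q r (M : R -> 'M[R]_(p, q)) (N : R -> 'M[R]_(q, r)),
  mxall P1 M -> mxall P2 N -> mxall P3 (fun t => M t *m N t).
Proof.
move=> H1 H2 p q r M N hM hN i j.
rewrite (_ : (fun t => _) = fun t => \sum_k M t i k * N t k j).
  by apply: H2 => k; apply: H1.
by apply/funext => t; rewrite mxE.
Qed.

Lemma mxall_tr P p q (M : R -> 'M[R]_(p, q)) :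
  mxall P M -> mxall P (fun t => (M t)^T).
Proof.
move=> hM i j; rewrite (_ : (fun t => _) = fun t => M t j i)//.
by apply/funext => t; rewrite mxE.
Qed.

Lemma mxall_D (P : (R -> R) -> Prop) :
  (forall f g, P f -> P g -> P (fun t => f t + g t)) ->
  forall p q (M N : R -> 'M[R]_(p, q)),
  mxall P M -> mxall P N -> mxall P (fun t => M t + N t).
Proof.
move=> H p q M N hM hN i j; rewrite (_ : (fun t => _) = fun t => M t i j + N t i j).
  exact: H.
by apply/funext => t; rewrite mxE.
Qed.

Lemma mxall_Z (P : (R -> R) -> Prop) c :
  (forall f, P f -> P (fun t => c * f t)) ->
  forall p q (M : R -> 'M[R]_(p, q)),
  mxall P M -> mxall P (fun t => c *: M t).
Proof.
move=> H p q M hM i j; rewrite (_ : (fun t => _) = fun t => c * M t i j).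
  exact: H.
by apply/funext => t; rewrite mxE.
Qed.

Lemma mxall_N (P : (R -> R) -> Prop) :
  (forall f, P f -> P (fun t => -1 * f t)) ->
  forall p q (M : R -> 'M[R]_(p, q)),
  mxall P M -> mxall P (fun t => - M t).
Proof.
move=> H p q M hM; rewrite (_ : (fun t => _) = fun t => (-1) *: M t).
  exact: mxall_Z.
by apply/funext => t; rewrite scaleN1r.
Qed.

Section on_interval.
Variables a b : R.
Notation I := (`[a, b]%classic : set (measurableTypeR R)).

Definition mxbnd p q (M : R -> 'M[R]_(p, q)) := mxall (bmeasurable I) M.
Definition mxint p q (M : R -> 'M[R]_(p, q)) := mxall (rintegrable leb I) M.
Definition mxsq p q (M : R -> 'M[R]_(p, q)) := mxall (sqintegrable leb I) M.
Definition mxprim p q (X F : R -> 'M[R]_(p, q)) :=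
  forall i j, primitive a b (fun t => X t i j) (fun t => F t i j).

Lemma mxbndM p q r (M : R -> 'M[R]_(p, q)) (N : R -> 'M[R]_(q, r)) :
  mxbnd M -> mxbnd N -> mxbnd (fun t => M t *m N t).
Proof.
apply: mxall_mul => [f g|n F hF]; first exact: bmeasurableM.
by apply: bmeasurable_sum => i _.
Qed.

Lemma mxbndD p q (M N : R -> 'M[R]_(p, q)) :
  mxbnd M -> mxbnd N -> mxbnd (fun t => M t + N t).
Proof. by apply: mxall_D => f g; exact: bmeasurableD. Qed.

Lemma mxbndN p q (M : R -> 'M[R]_(p, q)) : mxbnd M -> mxbnd (fun t => - M t).
Proof.
by apply: mxall_N => f hf; apply: bmeasurableM => //; exact: bmeasurable_cst.
Qed.

Lemma mxbndB p q (M N : R -> 'M[R]_(p, q)) :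
  mxbnd M -> mxbnd N -> mxbnd (fun t => M t - N t).
Proof. by move=> hM hN; apply: mxbndD => //; exact: mxbndN. Qed.

Lemma mxbnd_tr p q (M : R -> 'M[R]_(p, q)) : mxbnd M -> mxbnd (fun t => (M t)^T).
Proof. exact: mxall_tr. Qed.

Lemma mxbnd_cst p q (M : 'M[R]_(p, q)) : mxbnd (fun=> M).
Proof. by move=> i j; exact: bmeasurable_cst. Qed.

Let sum_int n (F : 'I_n -> R -> R) : (forall i, rintegrable leb I (F i)) ->
  rintegrable leb I (fun t => \sum_i F i t).
Proof. by move=> hF; apply: rintegrable_sum => // i _. Qed.

Lemma mxbnd_int p q r (M : R -> 'M[R]_(p, q)) (N : R -> 'M[R]_(q, r)) :
  mxbnd M -> mxint N -> mxint (fun t => M t *m N t).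
Proof. by apply: mxall_mul => [f g|n F hF]; [exact: bmeasurable_mul|exact: sum_int]. Qed.

Lemma mxint_bnd p q r (M : R -> 'M[R]_(p, q)) (N : R -> 'M[R]_(q, r)) :
  mxint M -> mxbnd N -> mxint (fun t => M t *m N t).
Proof.
apply: mxall_mul => [f g hf hg|n F hF]; [exact: bmeasurable_mulr|exact: sum_int].
Qed.

Lemma mxsqM p q r (M : R -> 'M[R]_(p, q)) (N : R -> 'M[R]_(q, r)) :
  mxsq M -> mxsq N -> mxint (fun t => M t *m N t).
Proof.
by apply: mxall_mul => [f g|n F hF]; [exact: sqintegrable_mul|exact: sum_int].
Qed.

Lemma mxintD p q (M N : R -> 'M[R]_(p, q)) :
  mxint M -> mxint N -> mxint (fun t => M t + N t).
Proof. by apply: mxall_D => f g; exact: rintegrableD. Qed.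

Lemma mxintN p q (M : R -> 'M[R]_(p, q)) : mxint M -> mxint (fun t => - M t).
Proof. by apply: mxall_N => f hf; exact: rintegrableZ. Qed.

Lemma mxint_tr p q (M : R -> 'M[R]_(p, q)) : mxint M -> mxint (fun t => (M t)^T).
Proof. exact: mxall_tr. Qed.

Lemma mxsqD p q (M N : R -> 'M[R]_(p, q)) :
  mxsq M -> mxsq N -> mxsq (fun t => M t + N t).
Proof. by apply: mxall_D => f g; exact: sqintegrableD. Qed.

Lemma mxsqZ c p q (M : R -> 'M[R]_(p, q)) : mxsq M -> mxsq (fun t => c *: M t).
Proof. by apply: mxall_Z => f; exact: sqintegrableZ. Qed.

Lemma mxsq_tr p q (M : R -> 'M[R]_(p, q)) : mxsq M -> mxsq (fun t => (M t)^T).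
Proof. exact: mxall_tr. Qed.

Lemma mxsq_int p q (M : R -> 'M[R]_(p, q)) : mxsq M -> mxint M.
Proof.
by move=> hM i j; apply: sqintegrable_rintegrable => //; exact: itv_fin.
Qed.

Lemma mxbnd_sqint p q (M : R -> 'M[R]_(p, q)) : mxbnd M -> mxsq M.
Proof.
by move=> hM i j; apply: bmeasurable_sqintegrable => //; exact: itv_fin.
Qed.

Lemma mxbnd_mxint p q (M : R -> 'M[R]_(p, q)) : mxbnd M -> mxint M.
Proof.
by move=> hM i j; apply: bmeasurable_rintegrable => //; exact: itv_fin.
Qed.

Lemma mxbnd_bound p q (M : R -> 'M[R]_(p, q)) : mxbnd M ->
  exists2 C, 0 <= C & forall t, a <= t <= b -> forall i j, `|M t i j| <= C.
Proof.
move=> hM.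
have H i j : exists C, forall t, a <= t <= b -> `|M t i j| <= C.
  by have [_ [C hC]] := hM i j; exists C => t abt; apply: hC; rewrite mem_itvcc.
pose C i j := projT1 (cid (H i j)).
have hC i j : forall t, a <= t <= b -> `|M t i j| <= `|C i j|.
  by move=> t abt; apply: le_trans (projT2 (cid (H i j)) t abt) (ler_norm _).
exists (\sum_i \sum_j `|C i j|).
  by apply: sumr_ge0 => i _; apply: sumr_ge0.
move=> t abt i j; apply: le_trans (hC i j t abt) _.
rewrite (bigD1 i)//= (bigD1 j)//= -addrA lerDl addr_ge0//.
  by apply: sumr_ge0.
by apply: sumr_ge0 => k _; apply: sumr_ge0.
Qed.

Lemma mxprim_cont p q (X F : R -> 'M[R]_(p, q)) : mxprim X F ->
  mx_continuous_on a b X.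
Proof. by move=> pX i j; exact: primitive_cont (pX i j). Qed.

Lemma mxcont_bnd p q (X : R -> 'M[R]_(p, q)) : mx_continuous_on a b X -> mxbnd X.
Proof. by move=> cX i j; exact: within_cont_bmeas. Qed.

Lemma mxprim_bnd p q (X F : R -> 'M[R]_(p, q)) : mxprim X F -> mxbnd X.
Proof. by move=> /mxprim_cont/mxcont_bnd. Qed.

Lemma mxprim_int p q (X F : R -> 'M[R]_(p, q)) : mxprim X F -> mxint F.
Proof. by move=> pX i j; case: (pX i j). Qed.

Lemma mxprimE p q (X F : R -> 'M[R]_(p, q)) : mxprim X F <->
  mxint F /\ forall t, a <= t <= b -> X t = X a + mx_integral a t F.
Proof.
split=> [pX|[iF XF] i j].
  split; first exact: mxprim_int pX.
  by move=> t abt; apply/matrixP => i j; rewrite !mxE; have [_ ->] := pX i j.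
split; first exact: iF.
by move=> t abt; rewrite XF// !mxE.
Qed.

Lemma eq_mxprim p q (X F Y G : R -> 'M[R]_(p, q)) : mxprim X F ->
  (forall t, a <= t <= b -> X t = Y t) -> (forall t, a <= t <= b -> F t = G t) ->
  mxprim Y G.
Proof.
by move=> pX XY FG i j; apply: eq_primitive (pX i j) _ _ => t abt; rewrite ?XY ?FG.
Qed.

Lemma mxprim_cst p q (M : 'M[R]_(p, q)) : mxprim (fun=> M) (fun=> 0).
Proof. by move=> i j; under [X in primitive _ _ _ X]eq_fun do rewrite mxE;
  exact: primitive_cst. Qed.

Lemma mxprimD p q (X F Y G : R -> 'M[R]_(p, q)) : mxprim X F -> mxprim Y G ->
  mxprim (fun t => X t + Y t) (fun t => F t + G t).
Proof.
by move=> pX pY i j; apply: (eq_primitive (primitiveD (pX i j) (pY i j))) => t _;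
  rewrite mxE.
Qed.

Lemma mxprimZ c p q (X F : R -> 'M[R]_(p, q)) : mxprim X F ->
  mxprim (fun t => c *: X t) (fun t => c *: F t).
Proof.
by move=> pX i j; apply: (eq_primitive (primitiveZ c (pX i j))) => t _;
  rewrite mxE.
Qed.

Lemma mxprimN p q (X F : R -> 'M[R]_(p, q)) : mxprim X F ->
  mxprim (fun t => - X t) (fun t => - F t).
Proof.
by move=> pX; apply: (eq_mxprim (mxprimZ (-1) pX)) => t _; rewrite scaleN1r.
Qed.

Lemma mxprimB p q (X F Y G : R -> 'M[R]_(p, q)) : mxprim X F -> mxprim Y G ->
  mxprim (fun t => X t - Y t) (fun t => F t - G t).
Proof. by move=> pX pY; apply: mxprimD => //; exact: mxprimN. Qed.

Lemma mxprim_tr p q (X F : R -> 'M[R]_(p, q)) : mxprim X F ->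
  mxprim (fun t => (X t)^T) (fun t => (F t)^T).
Proof.
by move=> pX i j; apply: (eq_primitive (pX j i)) => t _; rewrite mxE.
Qed.

Lemma mxprimM p q r (X F : R -> 'M[R]_(p, q)) (Y G : R -> 'M[R]_(q, r)) :
  mxprim X F -> mxprim Y G ->
  mxprim (fun t => X t *m Y t) (fun t => F t *m Y t + X t *m G t).
Proof.
move=> pX pY i j.
have H k := primitiveM (pX i k) (pY k j).
have := @primitive_sum _ a b _ (index_enum 'I_q) xpredT _ _ (fun k _ => H k).
move=> /eq_primitive; apply => t _; rewrite !mxE//.
by rewrite -big_split.
Qed.

Lemma mxprim_integral p q (F : R -> 'M[R]_(p, q)) : mxint F ->
  mxprim (fun t => mx_integral a t F) F.
Proof.
by move=> iF i j; apply: (eq_primitive (primitive_integral (iF i j))) => t _;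
  rewrite ?mxE.
Qed.

Lemma mx_integral_aa p q (F : R -> 'M[R]_(p, q)) : mx_integral a a F = 0.
Proof.
by apply/matrixP => i j; rewrite !mxE set_itv1 Rintegral_set1.
Qed.

Lemma mxprim0_eq p q (X F : R -> 'M[R]_(p, q)) : mxprim X F ->
  (forall t, a <= t <= b -> F t = 0) -> forall t, a <= t <= b -> X t = X a.
Proof.
move=> /mxprimE[_ XF] F0 t /[dup] abt /andP[_ tb]; rewrite XF//.
apply/matrixP => i j; rewrite !mxE (@eq_Rintegral _ _ _ _ _ (cst 0)).
  by rewrite rintegral0 addr0.
move=> x; rewrite inE mem_itvcc => /andP[ax xt].
by rewrite F0 ?mxE// ax (le_trans xt).
Qed.

End on_interval.

Lemma mxprim_sub a b s t p q (X F : R -> 'M[R]_(p, q)) :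
  a <= s -> s <= t -> t <= b -> mxprim a b X F -> mxprim s t X F.
Proof. by move=> h1 h2 h3 pX i j; apply: primitive_sub (pX i j). Qed.

End matrix_functions.

(** * Transition matrices of linear equations with integrable coefficients *)

Section linear_ode.
Context {R : realType}.
Notation leb := (@lebesgue_measure R).
Variables (t0 t1 : R) (n : nat) (a : R -> 'M[R]_n).
Hypothesis t01 : t0 <= t1.
Hypothesis ia : mxint t0 t1 a.

(** Terms, not partial sums, of the Peano-Baker series of iterated integrals, whose sum is the
    transition matrix from [t0]. *)
Fixpoint picard (k : nat) : R -> 'M[R]_n :=
  if k is k'.+1 then fun t => mx_integral t0 t (fun s => a s *m picard k' s)
  else fun=> 1%:M.

Definition picard_dom (t : R) : R :=
  \sum_i \sum_j \int[leb]_(s in `[t0, t]) `|a s i j|.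

Let dalpha (t : R) := \sum_i \sum_j `|a t i j|.

Let palpha : primitive t0 t1 picard_dom dalpha.
Proof.
apply: primitive_sum => i _; apply: primitive_sum => j _.
by apply: primitive_integral; exact: (integrable_norm (ia i j)).
Qed.

Let alpha0 : picard_dom t0 = 0.
Proof.
by rewrite /picard_dom big1// => i _; rewrite big1// => j _;
  rewrite set_itv1 Rintegral_set1.
Qed.

Let alpha_ge0 t : 0 <= picard_dom t.
Proof.
by apply: sumr_ge0 => i _; apply: sumr_ge0 => j _; apply: Rintegral_ge0.
Qed.

Let alpha_le t : t0 <= t <= t1 -> picard_dom t <= picard_dom t1.
Proof.
move=> /andP[h1 h2]; rewrite -subr_ge0 (primitive_incr palpha)//.
by apply: Rintegral_ge0 => x _; apply: sumr_ge0 => i _; apply: sumr_ge0.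
Qed.

Let picard_bnd k : mxbnd t0 t1 (picard k).
Proof.
elim: k => [|k ih] /=; first exact: mxbnd_cst.
by apply: (mxprim_bnd (F := fun s => a s *m picard k s));
  apply: mxprim_integral; exact: mxint_bnd.
Qed.

(** With [alpha = picard_dom], the induction integrates [alpha ^ k * alpha'], which by
    [primitive_exp] is the increment of [alpha ^ k.+1 / k.+1]; this is where the factorial comes
    from. The exponential series then dominates the iteration whatever the size of [a]. *)
Lemma picard_le k t : t0 <= t <= t1 -> forall i j,
  `|picard k t i j| <= picard_dom t ^+ k / k`!%:R.
Proof.
elim: k t => [|k ih] t abt i j.
  by rewrite /= mxE fact0 expr0 divr1; case: eqP; rewrite ?normr1 ?normr0.
rewrite /= mxE.
have /andP[at_ tb] := abt.
have pe := primitive_sub (lexx t0) at_ tb (primitive_exp k palpha).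
have pz := primitiveZ ((k.+1)`!%:R^-1) pe.
have := primitive_incr pz (lexx t0) at_ (lexx t).
rewrite alpha0 expr0n/= mulr0 subr0 mulrC => ->.
apply: le_norm_rintegral => //.
- have : mxint t0 t (fun s => a s *m picard k s).
    by move=> p q; apply: rintegrable_sub (mxint_bnd ia (picard_bnd k) p q).
  by move=> /(_ i j)/rintegrable_meas; apply.
- by case: pz.
- move=> x; rewrite mem_itvcc => /andP[ax xt].
  have abx : t0 <= x <= t1 by rewrite ax (le_trans xt).
  rewrite mxE (le_trans (ler_norm_sum _ _ _))//.
  apply: (@le_trans _ _ (\sum_l `|a x i l| * (picard_dom x ^+ k / k`!%:R))).
    by apply: ler_sum => l _; rewrite normrM ler_wpM2l// ih.
  rewrite -mulr_suml factS natrM invfM.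
  rewrite [leRHS](_ : _ = dalpha x * (picard_dom x ^+ k / k`!%:R)); last first.
    by field; rewrite nat1r !pnatr_eq0/= -lt0n fact_gt0.
  rewrite ler_wpM2r//; first by rewrite divr_ge0// exprn_ge0.
  rewrite /dalpha [leRHS](bigD1 i)//= lerDl.
  by apply: sumr_ge0 => p _; apply: sumr_ge0.
Qed.

Let c := picard_dom t1.

Let u i j t : nat -> R := fun k => picard k t i j.

Let u_le i j t k : t0 <= t <= t1 -> `|u i j t k| <= exp_coeff c k.
Proof.
move=> abt; apply: le_trans (picard_le k abt i j) _.
rewrite /exp_coeff/= ler_wpM2r ?invr_ge0//.
by rewrite lerXn2r ?nnegrE ?alpha_ge0// alpha_le.
Qed.

Let u_cvg i j t : t0 <= t <= t1 -> cvgn (series (u i j t)).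
Proof.
move=> abt; apply: normed_cvg.
apply: (@series_le_cvg _ _ (exp_coeff c)) => [k|k|k|].
- exact: normr_ge0.
- by apply: exp_coeff_ge0; exact: alpha_ge0.
- exact: u_le.
- exact: is_cvg_series_exp_coeff.
Qed.

Let U t : 'M[R]_n := \matrix_(i, j) limn (series (u i j t)).

(** Remainder of the scalar exponential series at [c]: a bound on the matrix remainder that is
    uniform in [t]. *)
Let tail N : R := limn (series (exp_coeff c)) - series (exp_coeff c) N.

Let tail_cvg : tail @ \oo --> 0.
Proof.
rewrite -[X in _ --> X](subrr (limn (series (exp_coeff c)))).
apply: cvgB; first exact: cvg_cst.
exact: is_cvg_series_exp_coeff.
Qed.

Let U_tail t i j N : t0 <= t <= t1 ->
  `|U t i j - series (u i j t) N| <= tail N.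
Proof.
move=> abt; rewrite mxE.
have h1 : (fun M => `|series (u i j t) M - series (u i j t) N|) @ \oo -->
    `|limn (series (u i j t)) - series (u i j t) N|.
  apply: cvg_norm; apply: cvgB; last exact: cvg_cst.
  exact: u_cvg.
have h2 : (fun M => series (exp_coeff c) M - series (exp_coeff c) N) @ \oo -->
    tail N.
  apply: cvgB; last exact: cvg_cst.
  exact: is_cvg_series_exp_coeff.
apply: ler_cvg_to h1 h2 _; near=> M.
have NM : (N <= M)%N by near: M; exists N.
rewrite !sub_series_geq// (le_trans (ler_norm_sum _ _ _))//.
by apply: ler_sum => k _; exact: u_le.
Unshelve. all: by end_near. Qed.

Let pi_ N t : 'M[R]_n := \sum_(0 <= k < N) picard k t.

Let pi_E N t i j : pi_ N t i j = series (u i j t) N.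
Proof. by rewrite /series/= /pi_ summxE. Qed.

Let pi_bnd N : mxbnd t0 t1 (pi_ N).
Proof.
move=> i j; rewrite (_ : (fun t => _) = fun t => \sum_(0 <= k < N) picard k t i j).
  by apply: bmeasurable_sum => k _; exact: picard_bnd.
by apply/funext => t; rewrite /pi_ summxE.
Qed.

Let pi_S N t : t0 <= t <= t1 ->
  pi_ N.+1 t = 1%:M + mx_integral t0 t (fun s => a s *m pi_ N s).
Proof.
move=> /andP[at_ tb].
elim: N => [|N ih].
  rewrite /pi_ big_nat1/= (_ : mx_integral _ _ _ = 0) ?addr0//.
  apply/matrixP => i j; rewrite !mxE -[RHS](@rintegral0 _ _ _ leb `[t0, t]).
  by apply: eq_Rintegral => x _; rewrite /pi_ big_nil mulmx0 mxE.
rewrite /pi_ big_nat_recr//= -/(pi_ N.+1 t) ih -addrA; congr (_ + _).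
apply/matrixP => i j; rewrite !mxE -RintegralD//.
- by apply: eq_Rintegral => x _; rewrite big_nat_recr//= mulmxDr [RHS]mxE.
- by apply: rintegrable_sub (mxint_bnd ia (pi_bnd N) i j).
- by apply: rintegrable_sub (mxint_bnd ia (picard_bnd N) i j).
Qed.

Let U_bnd : mxbnd t0 t1 U.
Proof.
move=> i j; split.
  apply: (measurable_fun_cvg (h := fun N t => pi_ N t i j)) => // [N|t].
    by case: (pi_bnd N i j).
  rewrite mem_itvcc => abt; rewrite mxE.
  by under eq_fun do rewrite pi_E; exact: u_cvg.
exists (tail 0) => t; rewrite mem_itvcc => abt.
by have := U_tail i j 0 abt; rewrite seriesEnat/= big_geq// subr0.
Qed.

Lemma linear_ode_exists : exists2 Phi : R -> 'M[R]_n,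
  mxprim t0 t1 Phi (fun t => a t *m Phi t) & Phi t0 = 1%:M.
Proof.
have iaU := mxint_bnd ia U_bnd.
have UE t : t0 <= t <= t1 -> U t = 1%:M + mx_integral t0 t (fun s => a s *m U s).
  move=> abt; apply/matrixP => i j; apply/eqP; rewrite -subr_eq0 -normr_le0.
  (* The defect of the integral equation splits into the remainder of [U] at rank [N.+1] and the
     integral of [a *m (pi_ N - U)], bounded by [tail N] times the mass of [a] on [[t0, t]]. The
     defect does not depend on [N], so it vanishes. *)
  have h : (fun N => tail N.+1 + tail N * picard_dom t) @ \oo --> (0 : R).
    rewrite -[X in _ --> X](addr0 0) -[X in _ --> _ + X](mul0r (picard_dom t)).
    apply: cvgD; first by rewrite cvg_shiftS.
    by apply: cvgM => //; exact: cvg_cst.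
  apply: ler_cvg_to (cvg_cst _) h _; near=> N.
  have := pi_S N abt => /matrixP/(_ i j).
  rewrite !mxE => E.
  rewrite -(subrKA (pi_ N.+1 t i j)) (le_trans (ler_normD _ _))// lerD//.
    by rewrite pi_E; have := U_tail i j N.+1 abt; rewrite mxE.
  rewrite E opprD addrACA subrr add0r.
  have /andP[at_ tb] := abt.
  have i1 := rintegrable_sub (lexx t0) tb (mxint_bnd ia (pi_bnd N) i j).
  have i2 := rintegrable_sub (lexx t0) tb (iaU i j).
  rewrite -RintegralB//.
  have pz := primitiveZ (tail N) (primitive_sub (lexx t0) at_ tb palpha).
  have := primitive_incr pz (lexx t0) at_ (lexx t).
  rewrite alpha0 mulr0 subr0 => ->.
  apply: le_norm_rintegral => //.
  - by apply: (rintegrable_meas (mu := leb)); exact: rintegrableB.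
  - by case: pz.
  - move=> x; rewrite mem_itvcc => /andP[ax xt].
    have abx : t0 <= x <= t1 by rewrite ax (le_trans xt).
    rewrite !mxE -sumrB (le_trans (ler_norm_sum _ _ _))//.
    rewrite /dalpha mulr_sumr [leRHS](bigD1 i)//= mulr_sumr.
    rewrite ler_wpDr//.
      have tN : 0 <= tail N.
        by apply: le_trans (U_tail i j N abx); exact: normr_ge0.
      by apply: sumr_ge0 => p _; rewrite mulr_ge0//; apply: sumr_ge0.
    apply: ler_sum => l _; rewrite -mulrBr normrM mulrC ler_wpM2r//.
    by rewrite distrC pi_E; exact: U_tail.
exists U; last by rewrite UE ?lexx// mx_integral_aa addr0.
apply/mxprimE; split => // t abt.
by rewrite [LHS]UE// [in RHS]UE ?lexx// mx_integral_aa addr0.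
Unshelve. all: by end_near. Qed.

End linear_ode.

(** The inverse is built as a solution, not by matrix inversion: the transpose of the flow of
    [- a^T] satisfies [Th' = - Th a], so [Th *m Phi] has zero density and stays at the identity.
    Squareness gives the other product. *)
Lemma transition_exists {R : realType} (t0 t1 : R) n (a : R -> 'M[R]_n) :
  t0 <= t1 -> mxint t0 t1 a ->
  exists Phi Th : R -> 'M[R]_n,
  [/\ mxprim t0 t1 Phi (fun t => a t *m Phi t),
      mxprim t0 t1 Th (fun t => - (Th t *m a t)),
      Phi t0 = 1%:M, Th t0 = 1%:M &
      forall t, t0 <= t <= t1 -> Th t *m Phi t = 1%:M /\ Phi t *m Th t = 1%:M].
Proof.
move=> t01 ia.
have [Phi pP P0] := linear_ode_exists t01 ia.
have ia' : mxint t0 t1 (fun t => (- a t)^T) by apply: mxint_tr; exact: mxintN.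
have [Th pT T0] := linear_ode_exists t01 ia'.
exists Phi, (fun t => (Th t)^T); split => //.
- apply: (eq_mxprim (mxprim_tr pT)) => // t _.
  by rewrite trmx_mul trmxK mulmxN.
- by rewrite T0 trmx1.
- move=> t abt; suff h : (Th t)^T *m Phi t = 1%:M by split => //; exact: mulmx1C.
  have := mxprim0_eq (mxprimM (mxprim_tr pT) pP) _ abt.
  rewrite T0 P0 trmx1 mulmx1; apply => s _.
  by rewrite trmx_mul trmxK mulmxN mulNmx mulmxA addNr.
Qed.

(** * Gaussian moments and independence *)

Section density_change_of_variables.
Local Open Scope ereal_scope.
Context {d : measure_display} {T : measurableType d} {R : realType}.
Variables (mu nu : {measure set T -> \bar R}) (g : T -> R).
Hypothesis mg : measurable_fun setT g.
Hypothesis g0 : forall x, (0 <= g x)%R.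
Hypothesis nuE : forall A, measurable A -> nu A = \int[mu]_(x in A) (g x)%:E.

Import HBNNSimple.

Let integral_density_nnsfun (h : {nnsfun T >-> R}) :
  \int[nu]_x (h x)%:E = \int[mu]_x ((h x)%:E * (g x)%:E).
Proof.
under [LHS]eq_integral do rewrite fimfunE -fsumEFin//.
rewrite [LHS]ge0_integral_fsum//; last 2 first.
  - by move=> r; exact/measurable_EFinP/measurableT_comp.
  - by move=> n x _; rewrite EFinM nnfun_muleindic_ge0.
under [RHS]eq_integral.
  move=> x xD; rewrite fimfunE -fsumEFin// muleC ge0_mule_fsumr; last first.
    by move=> r; rewrite EFinM nnfun_muleindic_ge0.
  over.
rewrite [RHS]ge0_integral_fsum//; last 2 first.
  - move=> r; apply/measurable_EFinP; apply: measurable_funM => //.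
    exact: measurable_funM.
  - move=> n x _; apply: mule_ge0; first by rewrite lee_fin.
    by rewrite EFinM nnfun_muleindic_ge0.
apply: eq_fsbigr => r; rewrite inE /= => -[x _ hx].
rewrite [LHS]integralZl_indic_nnsfun//= integral_indic//= setIT nuE//.
have r0 : (0 <= r)%R by rewrite -hx.
rewrite -ge0_integralZl//=; first last.
- by move=> y _; rewrite lee_fin.
- by apply: measurable_funTS; exact/measurable_EFinP.
rewrite [LHS]integral_mkcond.
apply: eq_integral => y _; rewrite patchE indicE.
by case: ifPn => yA; rewrite /= -!EFinM; congr EFin; ring.
Qed.

(** [nuE] speaks of sets only; the formula passes from indicators to simple functions, then to [f]
    by monotone convergence. *)
Lemma integral_density (f : T -> \bar R) :
  measurable_fun setT f -> (forall x, 0 <= f x) ->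
  \int[nu]_x f x = \int[mu]_x (f x * (g x)%:E).
Proof.
move=> mf f0.
pose f_ := nnsfun_approx measurableT mf.
transitivity (limn (fun n => \int[nu]_x (f_ n x)%:E)).
  rewrite -monotone_convergence//=.
  - apply: eq_integral => ? /[!inE] xD; apply/esym/cvg_lim => //=.
    exact: cvg_nnsfun_approx.
  - by move=> n; exact/measurable_EFinP/measurable_funTS.
  - by move=> n ? _; rewrite lee_fin.
  - by move=> ? _ ? ? mn; rewrite lee_fin; exact/lefP/nd_nnsfun_approx.
under eq_fun do rewrite integral_density_nnsfun.
rewrite -monotone_convergence//=.
- apply: eq_integral => x /[!inE] xD; apply/cvg_lim => //=.
  by apply: cvgeZr => //; exact: cvg_nnsfun_approx.
- by move=> n; apply: emeasurable_funM; apply/measurable_EFinP.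
- by move=> n x _; rewrite mule_ge0 ?lee_fin.
- move=> x _ m n mn; rewrite lee_wpmul2r ?lee_fin//.
  exact/lefP/nd_nnsfun_approx.
Qed.

End density_change_of_variables.

Section normal_moments.
Context {R : realType}.
Variable s : R.
Hypothesis s0 : 0 < s.
Notation leb := (@lebesgue_measure R).
Notation phi := (normal_pdf 0 s).

Let s_neq0 : s != 0. Proof. by rewrite gt_eqF. Qed.

Let phiE x : phi x = normal_peak s * expR (- x ^+ 2 / (s ^+ 2 *+ 2)).
Proof. by rewrite normal_pdfE// /normal_fun subr0. Qed.

Let phi_even x : phi (- x) = phi x.
Proof. by rewrite !phiE sqrrN. Qed.

Let dphi (x : R) : is_derive x 1 phi (- (x / s ^+ 2) * phi x).
Proof.
have E : phi = (fun y => normal_peak s * expR y) \o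
    (fun y => - y ^+ 2 / (s ^+ 2 *+ 2)).
  by apply/funext => y; rewrite phiE.
have h1 : is_derive x 1 (fun y : R => - y ^+ 2 / (s ^+ 2 *+ 2)) (- (x / s ^+ 2)).
  by apply: is_derive_eq; rewrite /GRing.scale/=; field.
have h2 (y : R) : is_derive y 1 (fun y => normal_peak s * expR y) (normal_peak s * expR y).
  by apply: is_derive_eq; rewrite /GRing.scale/=; ring.
have := @is_derive1_comp R _ _ x _ _ (h2 _) h1; rewrite -E phiE.
by move/is_derive_eq; apply; ring.
Qed.

(** An antiderivative of [x ^ 2 * phi - s ^ 2 * phi], because [phi' = - (x / s ^ 2) * phi]. Its
    boundary values vanish at infinity, which identifies the second moment with [s ^ 2]. *)
Let F y := - s ^+ 2 * (y * phi y).

Let dF (x : R) : is_derive x 1 F (x ^+ 2 * phi x - s ^+ 2 * phi x).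
Proof.
have h := dphi x.
apply: is_derive_eq; rewrite /GRing.scale/=; field; exact: s_neq0.
Qed.

Let phi_cont : continuous phi. Proof. exact: continuous_normal_pdf. Qed.

Let f_cont : continuous (fun x : R => x ^+ 2 * phi x - s ^+ 2 * phi x).
Proof.
move=> x; apply: cvgB; apply: cvgM => //; try exact: phi_cont.
  exact: exprn_continuous.
exact: cvg_cst.
Qed.

Let mphi : measurable_fun setT phi. Proof. exact: measurable_normal_pdf. Qed.

Let x2phi_ge0 x : 0 <= x ^+ 2 * phi x.
Proof. by rewrite mulr_ge0 ?sqr_ge0 ?normal_pdf_ge0. Qed.

Let mx2phi : measurable_fun setT (fun x : R => x ^+ 2 * phi x).
Proof. by apply: measurable_funM => //; exact: measurable_funX. Qed.

Let I n : set R := `[- n.+1%:R, n.+1%:R]%classic.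

Let I_cvg (g : R -> R) : measurable_fun setT g -> (forall x, 0 <= g x) ->
  (\int[leb]_(x in I n) (g x)%:E @[n --> \oo] --> \int[leb]_x (g x)%:E)%E.
Proof.
move=> mg g0.
have -> : setT = \bigcup_n I n.
  apply/esym/seteqP; split => // x _; exists (Num.trunc `|x|) => //=.
  rewrite /I /= in_itv/= -ler_norml.
  have /andP[_ /ltW//] := trunc_itv (normr_ge0 x).
apply: ge0_nondecreasing_set_cvg_integral => //.
- apply/nondecreasing_seqP => n; apply/subsetPset => x.
  rewrite /I /= !in_itv/= -!ler_norml => /le_trans; apply.
  by rewrite ler_nat.
- by move=> n; exact: measurable_itv.
- by move=> n; apply: measurable_funTS; exact/measurable_EFinP.
- by move=> n x _; rewrite lee_fin.
Qed.

(** Since [y <= expR y] for [y = N ^ 2 / c] with [c = 2 * s ^ 2], the quantity [N * expR (- y)] is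
    at most [c / N]. This removes the boundary terms of [FTC]. *)
Let nphi_cvg : (fun n => n.+1%:R * phi n.+1%:R) @ \oo --> (0 : R).
Proof.
pose C := normal_peak s * (s ^+ 2 *+ 2).
apply: (@squeeze_cvgr _ _ _ _ (fun=> 0) (fun n => C * harmonic n)).
- near=> n; rewrite mulr_ge0 ?ler0n ?normal_pdf_ge0//= phiE /C /harmonic.
  rewrite mulrCA -!mulrA ler_wpM2l ?normal_peak_ge0//.
  rewrite mulNr expRN.
  set N := n.+1%:R; set c := s ^+ 2 *+ 2; set y := N ^+ 2 / c.
  have N0 : 0 < N by rewrite ltr0n.
  have c0 : 0 < c by rewrite pmulrn_lgt0// exprn_gt0.
  rewrite ler_pdivrMr ?expR_gt0//.
  have aux (u v : R) : u != 0 -> v != 0 -> u = v / u * (u ^+ 2 / v).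
    by move=> u0 v0; field; rewrite u0 v0.
  rewrite [leLHS](aux N c) ?gt_eqF//.
  rewrite ler_wpM2l//; first by rewrite mulr_ge0 ?invr_ge0 ?ltW.
  by apply: le_trans (expR_ge1Dx y); rewrite lerDr.
- exact: cvg_cst.
- rewrite -[X in _ --> X](mulr0 C); apply: cvgM; first exact: cvg_cst.
  exact: cvg_harmonic.
Unshelve. all: by end_near. Qed.

Let int_I n (g : R -> R) : continuous g -> rintegrable leb (I n) g.
Proof.
move=> cg; apply: continuous_compact_integrable; first exact: segment_compact.
exact: continuous_subspaceT.
Qed.

Let FTC n : \int[leb]_(x in I n) (x ^+ 2 * phi x) =
  s ^+ 2 * \int[leb]_(x in I n) phi x - s ^+ 2 * 2 * (n.+1%:R * phi n.+1%:R).
Proof.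
have NN : - n.+1%:R < n.+1%:R :> R by rewrite gtrN// ltr0n.
have := @continuous_FTC2 R _ F _ _ NN (continuous_subspaceT f_cont).
have dFd x : derivable F x 1 by have [] := dF x.
have cF : continuous F.
  by move=> x; apply: differentiable_continuous; apply/derivable1_diffP; exact: dFd.
have H : derivable_oo_LRcontinuous F (- n.+1%:R) n.+1%:R.
  split => [x _||]; first exact: dFd.
  - exact: cvg_at_right_filter (cF _).
  - exact: cvg_at_left_filter (cF _).
have H' : {in `](- n.+1%:R), n.+1%:R[,
    F^`()%classic =1 (fun x => x ^+ 2 * phi x - s ^+ 2 * phi x)}.
  by move=> x _; rewrite derive1E; have [_ ->] := dF x.
move=> /(_ H H') E.
have i1 : rintegrable leb (I n) (fun x => x ^+ 2 * phi x).
  apply: int_I => x; apply: cvgM; last exact: phi_cont.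
  exact: exprn_continuous.
have i2 : rintegrable leb (I n) (fun x => phi x) by exact: int_I.
have mI : measurable (I n : set (measurableTypeR R)) by exact: measurable_itv.
have : \int[leb]_(x in I n) (x ^+ 2 * phi x - s ^+ 2 * phi x) = F n.+1%:R - F (- n.+1%:R).
  by rewrite /Rintegral E.
rewrite RintegralB//; last exact: rintegrableZ.
rewrite RintegralZl// /F phi_even => E2.
rewrite -[LHS](subrK (s ^+ 2 * \int[leb]_(x in I n) phi x)) E2.
by ring.
Qed.

Let int_x2phi : (\int[leb]_x (x ^+ 2 * phi x)%:E = (s ^+ 2)%:E)%E.
Proof.
have h1 := I_cvg mx2phi x2phi_ge0.
apply: (cvg_unique (@ereal_hausdorff R) h1).
have h2 := I_cvg mphi (normal_pdf_ge0 0 s).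
rewrite integral_normal_pdf in h2.
have h3 : (fun n => \int[leb]_(x in I n) phi x) @ \oo --> (1 : R).
  by move/fine_cvgP : h2 => [].
have -> : (fun n => \int[leb]_(x in I n) (x ^+ 2 * phi x)%:E)%E =
    EFin \o (fun n => s ^+ 2 * \int[leb]_(x in I n) phi x -
       s ^+ 2 * 2 * (n.+1%:R * phi n.+1%:R)).
  apply/funext => n /=; rewrite -FTC rintegral_EFin//.
    exact: measurable_itv.
  apply: int_I => x; apply: cvgM; last exact: phi_cont.
  exact: exprn_continuous.
apply: cvg_EFin; first by apply: nearW.
rewrite -[X in _ --> X]subr0 -[X in _ --> X - _]mulr1 -[X in _ --> _ - X](mulr0 (s ^+ 2 * 2)).
by apply: cvgB; apply: cvgM => //; exact: cvg_cst.
Qed.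

Section normal_variable.
Context {d : measure_display} {T : measurableType d} (P : probability T R).
Variable X : T -> R.
Hypothesis mX : measurable_fun setT X.
Hypothesis XN : forall E : set R, measurable E -> P (X @^-1` E) = normal_prob 0 s E.

Let dist (f : R -> \bar R) : measurable_fun setT f -> (forall x, (0 <= f x)%E) ->
  (\int[P]_o f (X o) = \int[leb]_x (f x * (phi x)%:E))%E.
Proof.
move=> mf f0.
rewrite -(@integral_density _ (measurableTypeR R) R leb (normal_prob 0 s) phi)//;
  last exact: normal_pdf_ge0.
have := @ge0_integral_pushforward _ _ T (measurableTypeR R) R X mX P setT f measurableT.
rewrite preimage_setT => E; rewrite -[LHS]E//.
by apply: eq_measure_integral => A mA _; first [exact: XN | exact: (esym (XN mA))].
Qed.

Lemma normal_sqintegrable : sqintegrable P setT X /\ (\int[P]_o (X o ^+ 2)%:E = (s ^+ 2)%:E)%E.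
Proof.
have E : (\int[P]_o (X o ^+ 2)%:E = (s ^+ 2)%:E)%E.
  rewrite (dist (f := fun x => (x ^+ 2)%:E)) => [|| x]; last first.
  - by rewrite lee_fin sqr_ge0.
  - by apply/measurable_EFinP; exact: measurable_funX.
  rewrite -int_x2phi; apply: eq_integral => x _.
  by rewrite -EFinM.
split => //; split => //.
apply/integrableP; split.
  by apply/measurable_EFinP; exact: measurable_funX.
under eq_integral do rewrite /= ger0_norm ?sqr_ge0//.
by rewrite E ltry.
Qed.

(** Positive and negative parts have equal integrals by reflection: [phi] is even and Lebesgue
    measure is invariant under [-%R]. Square integrability makes both finite, so that their
    difference is zero. *)
Lemma normal_mean : \int[P]_o X o = 0.
Proof.
have [sX _] := normal_sqintegrable.
have iX : rintegrable P setT X.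
  apply: sqintegrable_rintegrable sX => //.
  by rewrite (@le_lt_trans _ _ 1%E) ?probability_le1 ?ltry.
rewrite /Rintegral integralE.
have mid : measurable_fun [set: R] (EFin \o @id R) by exact/measurable_EFinP.
have E1 : (\int[P]_o (fun o => (X o)%:E)^\+ o =
    \int[leb]_x ((EFin \o @id R)^\+ x * (phi x)%:E))%E.
  rewrite -dist//; first by apply: eq_integral => o _; rewrite ?funeposE ?funenegE.
  exact: measurable_funepos.
have E2 : (\int[P]_o (fun o => (X o)%:E)^\- o =
    \int[leb]_x ((EFin \o @id R)^\- x * (phi x)%:E))%E.
  rewrite -dist//; first by apply: eq_integral => o _; rewrite ?funeposE ?funenegE.
  exact: measurable_funeneg.
have EE : (\int[leb]_x ((EFin \o @id R)^\+ x * (phi x)%:E) =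
   \int[leb]_x ((EFin \o @id R)^\- x * (phi x)%:E))%E.
  have mN : measurable_fun setT (-%R : measurableTypeR R -> measurableTypeR R).
    exact: oppr_measurable.
  rewrite (@eq_measure_integral _ _ _ setT
    (pushforward leb (-%R : measurableTypeR R -> measurableTypeR R))); last first.
    by move=> A mA _; rewrite [RHS]lebesgue_measureN.
  rewrite ge0_integral_pushforward//.
  - rewrite preimage_setT; apply: eq_integral => x _ /=.
    by rewrite phi_even funeposE funenegE /= EFinN.
  - apply: emeasurable_funM; first exact: measurable_funepos.
    exact/measurable_EFinP.
  - by move=> x _; rewrite mule_ge0// lee_fin normal_pdf_ge0.
rewrite E1 EE -E2.
have : (\int[P]_o (fun o => (X o)%:E)^\- o \is a fin_num)%E.
  by apply: integrable_neg_fin_num.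
by move=> /fineK <-; rewrite -EFinB subrr.
Qed.

End normal_variable.
End normal_moments.

Section independence.
Context {R : realType} {d : measure_display} {T : measurableType d}.
Variable (P : probability T R).
Variables X Y : T -> R.
Hypotheses (sX : sqintegrable P setT X) (sY : sqintegrable P setT Y).
Hypothesis XY : forall A B : set R, measurable A -> measurable B ->
  P (X @^-1` A `&` Y @^-1` B) = (P (X @^-1` A) * P (Y @^-1` B))%E.

(** Factorisation on events makes the joint law the product of the marginals; by Fubini the integral
    over the first coordinate is a multiple of the mean of [X]. *)
Lemma independent_mean_mul : \int[P]_o X o = 0 -> \int[P]_o (X o * Y o) = 0.
Proof.
move=> EX; have [mX _] := sX; have [mY _] := sY.
have fP : (P setT < +oo)%E by rewrite probability_setT ltry.
have iX := sqintegrable_rintegrable measurableT fP sX.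
have iXY := sqintegrable_mul measurableT sX sY.
pose mX_ := isMeasurableFun.Build _ _ _ _ X mX.
pose mY_ := isMeasurableFun.Build _ _ _ _ Y mY.
pose X' : {RV P >-> R} := HB.pack X mX_.
pose Y' : {RV P >-> R} := HB.pack Y mY_.
pose Z (o : T) : R * R := (X o, Y o).
have mZ : measurable_fun setT Z by exact: measurable_fun_pair.
pose m1 := distribution P X'; pose m2 := distribution P Y'.
have PE A : measurable A -> (m1 \x m2)%E A = pushforward P Z A.
  apply: product_measure_unique => A' B mA mB.
  by rewrite /pushforward /= -XY//.
pose f (z : R * R) := (z.1 * z.2)%:E.
have mf : measurable_fun setT f.
  by apply/measurable_EFinP; apply: measurable_funM.
have if_ : (pushforward P Z).-integrable setT f.
  by apply: integrable_pushforward => //; rewrite preimage_setT.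
have if2 : (m1 \x m2)%E.-integrable setT f.
  apply/integrableP; split => //; move/integrableP : if_ => [_].
  by rewrite (eq_measure_integral (m1 \x m2)%E) // => A mA _;
    first [exact: PE | exact: (esym (PE _ mA))].
rewrite /Rintegral.
have -> : (\int[P]_o (X o * Y o)%:E = \int[pushforward P Z]_z f z)%E.
  by rewrite integral_pushforward//= preimage_setT.
rewrite (eq_measure_integral (m1 \x m2)%E);
  last by move=> A mA _; first [exact: PE | exact: (esym (PE _ mA))].
rewrite -integral21_prod_meas1//.
rewrite (@eq_integral _ _ _ m2 setT (cst 0%E)) ?integral0// => y _.
rewrite /fubini_G /f /=.
have iid : m1.-integrable setT (EFin \o @id R).
  by apply: integrable_pushforward => //; rewrite ?preimage_setT//; exact/measurable_EFinP.
under eq_integral do rewrite mulrC EFinM.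
rewrite integralZl//= [X in (_ * X)%E](_ : _ = 0%E) ?mule0//.
rewrite integral_pushforward//= ?preimage_setT//.
by rewrite (rintegral_EFin _ iX)// EX.
Qed.

End independence.

(** * Wiener integrals of deterministic functions *)

Section inner_product.
Context {R : realType} {d : measure_display} {T : measurableType d}.
Variable (Pr : probability T R).
Implicit Types X Y Z : T -> R.
Notation L2 := (sqintegrable Pr setT).

Definition eip X Y : R := \int[Pr]_o (X o * Y o).

Lemma prob_fin : (Pr setT < +oo)%E.
Proof. by rewrite (@le_lt_trans _ _ 1%E) ?probability_le1 ?ltry. Qed.

Lemma L2_int X : L2 X -> rintegrable Pr setT X.
Proof. by apply: sqintegrable_rintegrable => //; exact: prob_fin. Qed.

Lemma L2_cst c : L2 (fun=> c).
Proof.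
apply: bmeasurable_sqintegrable => //; first exact: prob_fin.
exact: bmeasurable_cst.
Qed.

Lemma eipC X Y : eip X Y = eip Y X.
Proof. by apply: eq_Rintegral => o _; rewrite mulrC. Qed.

Lemma eipDl X Y Z : L2 X -> L2 Y -> L2 Z ->
  eip (fun o => X o + Y o) Z = eip X Z + eip Y Z.
Proof.
move=> hX hY hZ; rewrite -RintegralD//; try exact: sqintegrable_mul.
by apply: eq_Rintegral => o _; rewrite mulrDl.
Qed.

Lemma eipZl c X Z : L2 X -> L2 Z -> eip (fun o => c * X o) Z = c * eip X Z.
Proof.
move=> hX hZ; rewrite -RintegralZl//; last exact: sqintegrable_mul.
by apply: eq_Rintegral => o _; rewrite mulrA.
Qed.

Lemma eipBl X Y Z : L2 X -> L2 Y -> L2 Z ->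
  eip (fun o => X o - Y o) Z = eip X Z - eip Y Z.
Proof.
move=> hX hY hZ; rewrite -RintegralB//; try exact: sqintegrable_mul.
by apply: eq_Rintegral => o _; rewrite mulrBl.
Qed.

Lemma eip_ge0 X : 0 <= eip X X.
Proof. by apply: Rintegral_ge0 => o _; rewrite -expr2 sqr_ge0. Qed.

(** A weighted inequality in the role of Cauchy-Schwarz; the free weight [c] is tuned in
    [eip_cvg]. *)
Lemma eip_AMGM X Y (c : R) : L2 X -> L2 Y -> 0 < c ->
  `|eip X Y| <= c * eip X X + c^-1 * eip Y Y.
Proof.
move=> hX hY c0.
have hXX := sqintegrable_mul measurableT hX hX.
have hYY := sqintegrable_mul measurableT hY hY.
rewrite -RintegralZl// -RintegralZl// -RintegralD//; try exact: rintegrableZ.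
apply: le_norm_rintegral => //.
- by case: hX hY => mX _ [mY _]; exact: measurable_funM.
- by apply: rintegrableD => //; exact: rintegrableZ.
- move=> o _; rewrite normrM.
  rewrite -[X o * X o](real_normK (num_real _)) -[Y o * Y o](real_normK (num_real _)).
  have -> : c * `|X o| ^+ 2 + c^-1 * `|Y o| ^+ 2 =
      c^-1 * ((c * `|X o|) ^+ 2 + `|Y o| ^+ 2) by field; rewrite gt_eqF.
  rewrite -ler_pdivrMl ?invr_gt0// invrK mulrA.
  have u0 : 0 <= c * `|X o| by rewrite mulr_ge0// ltW.
  have v0 := normr_ge0 (Y o).
  move: (c * `|X o|) (`|Y o|) u0 v0 => u v u0 v0.
  have := sqr_ge0 (u - v); have := mulr_ge0 u0 v0; nra.
Qed.

Lemma eip_cvg X Y (Xn : nat -> T -> R) : L2 X -> L2 Y -> (forall N, L2 (Xn N)) ->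
  (fun N => eip (fun o => X o - Xn N o) (fun o => X o - Xn N o)) @ \oo --> (0:R) ->
  (fun N => eip (Xn N) Y) @ \oo --> eip X Y.
Proof.
move=> hX hY hXn h; apply/cvgrPdist_le => e e0.
pose C := eip Y Y + 1.
have C0 : 0 < C by rewrite ltr_wpDl// eip_ge0.
(* This weight leaves at most [e / 2] for the term in [Y], as [C] exceeds its second moment; the
   other half fixes the accuracy [e / (2 * c)] asked of [Xn]. *)
pose c := 2 * C / e.
have c0 : 0 < c by rewrite divr_gt0// mulr_gt0.
move/cvgrPdist_le : h => /(_ (e / (2 * c))) h.
have /h : 0 < e / (2 * c) by rewrite divr_gt0// mulr_gt0.
apply: filterS => N; rewrite sub0r normrN ger0_norm ?eip_ge0// => hN.
rewrite -eipBl//; apply: le_trans (eip_AMGM _ hY c0) _.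
  exact: sqintegrableB.
rewrite [e]splitr lerD//.
  by rewrite mulrC -ler_pdivlMr// -mulrA -invfM.
rewrite ler_pdivrMl//.
have -> : c * (e / 2) = C by rewrite /c; field; rewrite gt_eqF.
by rewrite /C lerDl.
Qed.

End inner_product.
Local Notation L2 Pr := (sqintegrable Pr setT).

Section wiener_increments.
Context {R : realType} {d : measure_display} {T : measurableType d}.
Variables (Pr : probability T R) (m : nat) (t0 t1 : R).
Variables (F : R -> set (set T)) (w : R -> T -> 'cV[R]_m).
Hypothesis hF : filtration F.
Hypothesis hw : wiener_process Pr t0 t1 F w.

Lemma vec_meas_sub n t (X : T -> 'cV[R]_n) i : vec_measurable (F t) X ->
  measurable_fun setT (fun o => X o i 0).
Proof.
case: hF => _ hm _ hX _ B mB; rewrite setTI.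
by apply: (hm t); exact: hX.
Qed.

Lemma wiener_meas t k : t0 <= t <= t1 -> measurable_fun setT (fun o => w t o k 0).
Proof.
by move=> tt; case: hw => ad _ _ _; apply: (vec_meas_sub (t := t)); apply: ad;
  rewrite in_itv.
Qed.

Definition winc s t k o := w t o k 0 - w s o k 0.

Lemma winc_joint s t k G (A : set R) : t0 <= s -> s < t -> t <= t1 -> F s G ->
  measurable A ->
  (Pr (G `&` winc s t k @^-1` A) = Pr G * normal_prob 0 (Num.sqrt (t - s)) A)%E.
Proof.
move=> h1 h2 h3 FG mA; case: hw => _ _ _ H.
(* The events on the remaining coordinates are the whole line, whose factors in the product formula
   are one. *)
pose E (j : 'I_m) := if j == k then A else setT.
have mE j : measurable (E j) by rewrite /E; case: ifP.
have := H s t h1 h2 h3 G FG E mE.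
rewrite (_ : \bigcap_j _ = winc s t k @^-1` A); last first.
  apply/seteqP; split => o /=.
    by move=> /(_ k I); rewrite /E eqxx.
  by move=> Ao j _; rewrite /E; case: eqP => // ->.
move=> ->; congr (_ * _)%E.
rewrite (bigD1 k)//= {1}/E eqxx big1 ?mule1// => j jk.
by rewrite /E (negbTE jk) probability_setT.
Qed.

Lemma filtration_setT s : F s setT.
Proof.
by case: hF => + _ _ => /(_ s)[h0 hC _]; rewrite -(setD0 setT); apply: hC.
Qed.

Lemma winc_pair s t k l (A B : set R) : t0 <= s -> s < t -> t <= t1 -> k != l ->
  measurable A -> measurable B ->
  (Pr (winc s t k @^-1` A `&` winc s t l @^-1` B) =
   normal_prob 0 (Num.sqrt (t - s)) A * normal_prob 0 (Num.sqrt (t - s)) B)%E.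
Proof.
move=> h1 h2 h3 kl mA mB; case: hw => _ _ _ H.
pose E (j : 'I_m) := if j == k then A else if j == l then B else setT.
have mE j : measurable (E j) by rewrite /E; case: ifP => // _; case: ifP.
have := H s t h1 h2 h3 setT (filtration_setT s) E mE.
rewrite setTI (_ : \bigcap_j _ = winc s t k @^-1` A `&` winc s t l @^-1` B); last first.
  apply/seteqP; split => o /=.
    move=> h; split; first by have := h k I; rewrite /= /E eqxx.
    by have := h l I; rewrite /= /E eqxx eq_sym (negbTE kl).
  by move=> [Ao Bo] j _; rewrite /E; case: eqP => [->//|_]; case: eqP => // ->.
move=> ->; rewrite probability_setT mul1e.
rewrite (bigD1 k)//= {1}/E eqxx (bigD1 l)//=; last by rewrite eq_sym.
rewrite {1}/E eq_sym (negbTE kl) eqxx big1 ?mule1// => j /andP[jk jl].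
by rewrite /E (negbTE jk) (negbTE jl) probability_setT.
Qed.

Lemma winc_law s t k (A : set R) : t0 <= s -> s < t -> t <= t1 ->
  measurable A -> Pr (winc s t k @^-1` A) = normal_prob 0 (Num.sqrt (t - s)) A.
Proof.
move=> h1 h2 h3 mA.
by rewrite -[X in Pr X]setTI (winc_joint _ h1 h2 h3 (filtration_setT s) mA)
  probability_setT mul1e.
Qed.

Lemma winc_meas s t k : t0 <= s <= t1 -> t0 <= t <= t1 ->
  measurable_fun setT (winc s t k).
Proof. by move=> h1 h2; apply: measurable_funB; exact: wiener_meas. Qed.

Lemma winc_moments s t k : t0 <= s -> s < t -> t <= t1 ->
  [/\ L2 Pr (winc s t k), \int[Pr]_o winc s t k o = 0 &
      eip Pr (winc s t k) (winc s t k) = t - s].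
Proof.
move=> h1 h2 h3.
have st0 : 0 < Num.sqrt (t - s) by rewrite sqrtr_gt0 subr_gt0.
have mW : measurable_fun setT (winc s t k).
  apply: winc_meas; first by rewrite h1 (le_trans (ltW h2)).
  by rewrite (le_trans h1 (ltW h2)).
have law (A : set R) : measurable A ->
  Pr (winc s t k @^-1` A) = normal_prob 0 (Num.sqrt (t - s)) A by exact: winc_law.
have [sq E] := normal_sqintegrable st0 mW law.
split => //; first exact: (normal_mean st0 mW law).
rewrite /eip /Rintegral.
under eq_integral do rewrite -expr2.
by rewrite E sqr_sqrtr// subr_ge0 ltW.
Qed.

Definition Fmeas s (X : T -> R) := forall B : set R, measurable B -> F s (X @^-1` B).

Lemma winc_orth s t k X : t0 <= s -> s < t -> t <= t1 -> L2 Pr X -> Fmeas s X ->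
  eip Pr (winc s t k) X = 0.
Proof.
move=> h1 h2 h3 sX FX; have [sq E0 _] := winc_moments k h1 h2 h3.
apply: independent_mean_mul => // A B mA mB.
rewrite setIC (winc_joint _ h1 h2 h3 (FX B mB) mA) (winc_law _ h1 h2 h3 mA).
by rewrite muleC.
Qed.

Lemma winc_orth2 s t k l : t0 <= s -> s < t -> t <= t1 -> k != l ->
  eip Pr (winc s t k) (winc s t l) = 0.
Proof.
move=> h1 h2 h3 kl.
have [sk E0 _] := winc_moments k h1 h2 h3.
have [sl _ _] := winc_moments l h1 h2 h3.
apply: independent_mean_mul => // A B mA mB.
by rewrite winc_pair// !(winc_law _ h1 h2 h3).
Qed.

(** Equipping [T] with the measurable structure generated by [F s] turns [Fmeas] into ordinary
    measurability, under which differences are available. *)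
Lemma sigma_meas_sub s (X Y : T -> R) : Fmeas s X -> Fmeas s Y ->
  Fmeas s (fun o => X o - Y o).
Proof.
move=> hX hY B mB.
have sF : sigma_algebra setT (F s) by case: hF.
pose T' := g_sigma_algebraType (F s).
have E : (@measurable _ T') = F s by rewrite /measurable/= sigma_algebra_id.
have mX : measurable_fun (setT : set T') X by move=> _ C mC; rewrite setTI E; exact: hX.
have mY : measurable_fun (setT : set T') Y by move=> _ C mC; rewrite setTI E; exact: hY.
have mXY : measurable_fun (setT : set T') (fun o => X o - Y o) by exact: measurable_funB.
by have := mXY measurableT B mB; rewrite setTI E.
Qed.

Lemma Fmeas_mono s t X : s <= t -> Fmeas s X -> Fmeas t X.
Proof. by case: hF => _ _ mono st hX B mB; apply: (mono s) => //; exact: hX. Qed.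

Lemma wiener_Fmeas t k : t0 <= t <= t1 -> Fmeas t (fun o => w t o k 0).
Proof. by move=> tt B mB; case: hw => ad _ _ _; apply: ad => //; rewrite in_itv. Qed.

Hypothesis t01 : t0 <= t1.

Lemma winc_L2 t k : t0 <= t <= t1 -> L2 Pr (winc t0 t k).
Proof.
move=> /andP[]; rewrite le_eqVlt => /predU1P[<- _|h1 h2].
  rewrite (_ : winc _ _ _ = fun=> 0); first exact: sqintegrable0.
  by apply/funext => o; rewrite /winc subrr.
by have [] := winc_moments k (lexx t0) h1 h2.
Qed.

Lemma winc0 t k o : winc t t k o = 0.
Proof. by rewrite /winc subrr. Qed.

Lemma eip0l X : eip Pr (fun=> 0) X = 0.
Proof. by rewrite /eip; under eq_Rintegral do rewrite mul0r; exact: rintegral0. Qed.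

(** The part of the increment after [s] is orthogonal to everything known at [s], so only the common
    part over [[t0, s]] contributes. The cases [s = t0] and [s = t] are separated because the law of
    an increment is given for distinct times only. *)
Lemma winc_gram_le s t k l : t0 <= s -> s <= t -> t <= t1 ->
  eip Pr (winc t0 s k) (winc t0 t l) = (k == l)%:R * (s - t0).
Proof.
move=> h1 h2 h3.
have s1 : t0 <= s <= t1 by rewrite h1 (le_trans h2).
have t1' : t0 <= t <= t1 by rewrite h3 (le_trans h1).
have Es : eip Pr (winc t0 s k) (winc t0 s l) = (k == l)%:R * (s - t0).
  move: h1; rewrite le_eqVlt => /predU1P[<-|h1].
    rewrite subrr mulr0 (_ : winc _ _ k = fun=> 0) ?eip0l//.
    by apply/funext => o; rewrite winc0.
  have [<-|kl] := eqVneq k l.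
    by rewrite mul1r; have [] := winc_moments k (lexx t0) h1 (le_trans h2 h3).
  by rewrite mul0r winc_orth2// (le_trans h2).
have wsum : winc t0 t l = fun o => winc s t l o + winc t0 s l o.
  by apply/funext => o; rewrite /winc; ring.
move: h2; rewrite le_eqVlt => /predU1P[<-//|h2].
have [sq _ _] := winc_moments l h1 h2 h3.
rewrite eipC wsum eipDl//; try exact: winc_L2.
rewrite winc_orth//; last 2 first.
- exact: winc_L2.
- apply: sigma_meas_sub; first exact: wiener_Fmeas.
  apply: (Fmeas_mono h1); apply: wiener_Fmeas.
  by rewrite lexx.
by rewrite add0r eipC.
Qed.

End wiener_increments.

Section wiener_integral.
Context {R : realType} {d : measure_display} {T : measurableType d}.
Variables (Pr : probability T R) (m : nat) (t0 t1 : R).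
Variables (F : R -> set (set T)) (w : R -> T -> 'cV[R]_m).
Notation leb := (@lebesgue_measure R).
Notation I := (`[t0, t1]%classic : set (measurableTypeR R)).
Implicit Types (X Y : T -> R) (f g : R -> 'I_m -> R).

Definition unif_cvg (fn : nat -> R -> 'I_m -> R) (f : R -> 'I_m -> R) :=
  forall e, 0 < e -> exists N0, forall N, (N0 <= N)%N ->
    forall r, t0 <= r <= t1 -> forall k, `|f r k - fn N r k| <= e.

(* [wiener_int X f]: the random variable [X] is a version of the integral
   over [[t0, t1]] of the deterministic row-valued integrand [f] against [dw].  The
   generators are indicator integrands, so the isometry follows by a double
   induction without constructing the integral. *)
Inductive wiener_int : (T -> R) -> (R -> 'I_m -> R) -> Prop :=
| wiener_int_0 : wiener_int (fun=> 0) (fun _ _ => 0)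
| wiener_int_inc t k : t0 <= t <= t1 ->
    wiener_int (winc w t0 t k) (fun r l => ((r < t) && (k == l))%:R)
| wiener_int_add X Y f g : wiener_int X f -> wiener_int Y g ->
    wiener_int (fun o => X o + Y o) (fun r l => f r l + g r l)
| wiener_int_scale c X f : wiener_int X f ->
    wiener_int (fun o => c * X o) (fun r l => c * f r l)
| wiener_int_lim X f Xn fn : sqintegrable Pr setT X ->
    (forall N, wiener_int (Xn N) (fn N)) ->
    (fun N => eip Pr (fun o => X o - Xn N o) (fun o => X o - Xn N o))
      @ \oo --> (0:R) ->
    unif_cvg fn f -> wiener_int X f.

Hypothesis hF : filtration F.
Hypothesis hw : wiener_process Pr t0 t1 F w.
Hypothesis t01 : t0 <= t1.

Definition fip (f g : R -> 'I_m -> R) : R := \int[leb]_(r in I) \sum_k f r k * g r k.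

Lemma unif_cvg_bmeas fn f : (forall N k, bmeasurable I (fun r => fn N r k)) ->
  unif_cvg fn f -> forall k, bmeasurable I (fun r => f r k).
Proof.
move=> hfn uf k; split.
  apply: (measurable_fun_cvg (h := fun N r => fn N r k)) => // [N|r].
    by case: (hfn N k).
  rewrite mem_itvcc => rI; apply/cvgrPdist_le => e e0.
  have [N0 hN0] := uf e e0; exists N0 => // N /= hN.
  exact: hN0.
have [N0 hN0] := uf 1 ltr01.
have [_ [C hC]] := hfn N0 k; exists (1 + C) => r rI.
rewrite -(subrK (fn N0 r k) (f r k)) (le_trans (ler_normD _ _))// lerD ?hC//.
by apply: hN0 => //; move: rI; rewrite mem_itvcc.
Qed.

Lemma wiener_int_L2 X f : wiener_int X f ->
  sqintegrable Pr setT X /\ forall k, bmeasurable I (fun r => f r k).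
Proof.
elim=> {X f} [|t k tt|X Y f g _ [hX hf] _ [hY hg]|c X f _ [hX hf]|X f Xn fn hX _ hXn _ uf].
- split; first exact: sqintegrable0.
  by move=> k; exact: bmeasurable_cst.
- split; first exact: (winc_L2 hF hw).
  move=> l; split; last first.
    by exists 1 => r _; case: (_ && _); rewrite ?normr1 ?normr0.
  case: (k == l); last first.
    rewrite (_ : (fun r => _) = cst 0); first exact: measurable_cst.
    by apply/funext => r; rewrite andbF.
  rewrite (_ : (fun r => _) = \1_(`]-oo, t[%classic : set (measurableTypeR R))).
    apply: measurable_indic; exact: measurable_itv.
  by apply/funext => r; rewrite andbT indicE/= mem_setE in_itv.
- split; first exact: sqintegrableD.
  by move=> k; exact: bmeasurableD.
- split; first exact: sqintegrableZ.
  by move=> k; apply: bmeasurableM => //; exact: bmeasurable_cst.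
- by split => //; apply: unif_cvg_bmeas uf => N k; case: (hXn N).
Qed.

(** Each generator is an increment after [t0], hence orthogonal to what is known at [t0], and
    orthogonality survives linear operations and mean-square limits. With the initial state for [xi]
    it removes the cross moments; with [xi = 1] it gives mean zero. *)
Lemma wiener_int_orth X f xi : wiener_int X f -> sqintegrable Pr setT xi ->
  Fmeas F t0 xi -> eip Pr X xi = 0.
Proof.
move=> + sxi Fxi.
elim=> {X f} [|t k /andP[]|X Y f g hX ihX hY ihY|c X f hX ihX|X f Xn fn hX hXn ih cX uf].
- exact: eip0l.
- rewrite le_eqVlt => /predU1P[<- _|h1 h2]; last first.
    exact: (winc_orth hF hw k (lexx t0) h1 h2 sxi Fxi).
  rewrite (_ : winc _ _ _ _ = fun=> 0) ?eip0l//.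
  by apply/funext => o; rewrite winc0.
- have [lX _] := wiener_int_L2 hX; have [lY _] := wiener_int_L2 hY.
  by rewrite eipDl// ihX ihY addr0.
- have [lX _] := wiener_int_L2 hX.
  by rewrite eipZl// ihX mulr0.
- have lXn N : sqintegrable Pr setT (Xn N) by case: (wiener_int_L2 (hXn N)).
  have := eip_cvg hX sxi lXn cX.
  rewrite (_ : (fun N => _) = fun=> 0); last by apply/funext => N; exact: ih.
  by move=> /(cvg_unique (@Rhausdorff R) (cvg_cst _)).
Qed.

Lemma fip_int f g : (forall k, bmeasurable I (fun r => f r k)) ->
  (forall k, bmeasurable I (fun r => g r k)) ->
  rintegrable leb I (fun r => \sum_k f r k * g r k).
Proof.
move=> hf hg; apply: rintegrable_sum => // k _.
apply: bmeasurable_rintegrable => //; first exact: itv_fin.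
exact: bmeasurableM.
Qed.

Lemma fipC f g : fip f g = fip g f.
Proof. by apply: eq_Rintegral => r _; apply: eq_bigr => k _; rewrite mulrC. Qed.

Lemma fip0l g : fip (fun _ _ => 0) g = 0.
Proof.
rewrite /fip -[RHS](@rintegral0 _ _ _ leb I); apply: eq_Rintegral => r _.
by apply: big1 => k _; rewrite mul0r.
Qed.

Lemma fip_cvg f fn g : (forall N k, bmeasurable I (fun r => fn N r k)) ->
  (forall k, bmeasurable I (fun r => g r k)) -> unif_cvg fn f ->
  (fun N => fip (fn N) g) @ \oo --> fip f g.
Proof.
move=> hfn hg uf; have hf := unif_cvg_bmeas hfn uf.
have ig : rintegrable leb I (fun r => \sum_k `|g r k|).
  apply: rintegrable_sum => // k _; apply: integrable_norm.
  by apply: bmeasurable_rintegrable => //; exact: itv_fin.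
set C := \int[leb]_(r in I) \sum_k `|g r k|.
have C0 : 0 <= C by apply: Rintegral_ge0 => r _; apply: sumr_ge0.
apply/cvgrPdist_le => e e0.
have e1 : 0 < e / (C + 1) by rewrite divr_gt0// ltr_wpDl.
have [N0 hN0] := uf _ e1; exists N0 => // N /= hN.
have i1 := fip_int hf hg; have i2 := fip_int (hfn N) hg.
rewrite /fip -RintegralB//.
apply: (@le_trans _ _ (e / (C + 1) * C)); last first.
  by rewrite mulrAC ler_pdivrMr ?ltr_wpDl// ler_pM2l// lerDl.
rewrite -RintegralZl//; apply: le_norm_rintegral => //.
- by apply: (rintegrable_meas (mu := leb)); exact: rintegrableB.
- exact: rintegrableZ.
- move=> r; rewrite mem_itvcc => rI.
  rewrite -sumrB (le_trans (ler_norm_sum _ _ _))// mulr_sumr ler_sum// => k _.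
  by rewrite -mulrBl normrM ler_wpM2r// hN0.
Qed.

(** The deterministic counterpart of [winc_gram_le]; together they form the base case of the
    isometry. *)
Lemma fip_inc s t k l : t0 <= s -> s <= t -> t <= t1 ->
  fip (fun r j => ((r < s) && (k == j))%:R) (fun r j => ((r < t) && (l == j))%:R)
  = (k == l)%:R * (s - t0).
Proof.
move=> h1 h2 h3; rewrite /fip.
transitivity (\int[leb]_(r in I)
    ((k == l)%:R * \1_(`]-oo, s[%classic : set (measurableTypeR R)) r)).
  apply: eq_Rintegral => r _; rewrite indicE/= mem_setE in_itv/=.
  rewrite (bigD1 k)//= eqxx andbT big1 ?addr0; last first.
    by move=> j jk; rewrite [k == j]eq_sym (negbTE jk) andbF mul0r.
  rewrite [l == k]eq_sym; case: (k == l); rewrite ?andbT ?andbF ?mulr0 ?mul0r// mul1r.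
  case: ltP => rs; last by rewrite mul0r.
  by rewrite (lt_le_trans rs h2) mulr1.
have iI : rintegrable leb I (\1_(`]-oo, s[%classic : set (measurableTypeR R))).
  apply: bmeasurable_rintegrable => //; first exact: itv_fin.
  split; first by apply: measurable_indic; exact: measurable_itv.
  by exists 1 => r _; rewrite indicE; case: (_ \in _); rewrite ?normr1 ?normr0.
have E : (leb `[t0, s[%classic = (s - t0)%:E)%E.
  rewrite lebesgue_measure_itv/= lte_fin; move: h1; rewrite le_eqVlt.
  by move=> /predU1P[<-|h1]; rewrite ?ltxx ?subrr// h1.
rewrite RintegralZl//; congr (_ * _).
rewrite /Rintegral integral_indic//.
rewrite (_ : _ `&` _ = `[t0, s[%classic); last first.
  apply/seteqP; split => r /=; rewrite !in_itv/=.
    by move=> [-> /andP[-> _]].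
  move=> /andP[-> rs]; split => //=.
  by rewrite (le_trans (ltW rs) (le_trans h2 h3)).
exact: (congr1 fine E).
Qed.

(** The outer induction on [X] settles the linear and limit cases for arbitrary [Y]; only for a
    generator [X] is an inner induction on [Y] opened. Limits pass on both sides by [eip_cvg] and
    [fip_cvg]. *)
Theorem wiener_isometry X f Y g : wiener_int X f -> wiener_int Y g ->
  eip Pr X Y = fip f g.
Proof.
move=> hX; elim: hX Y g => {X f}
  [|s k ss|X1 X2 f1 f2 h1 ih1 h2 ih2|c X f hX ihX|X f Xn fn hX hXn ih cX uf] Y g hY.
- by rewrite eip0l fip0l.
- elim: hY => {Y g} [|t l tt|X1 X2 f1 f2 h1 ih1 h2 ih2|c X f hX ihX|X f Xn fn hX hXn ih cX uf].
  + by rewrite eipC eip0l fipC fip0l.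
  + case/andP: ss => s1 s2; case/andP: tt => t1' t2.
    have [st|/ltW ts] := leP s t.
      by rewrite (winc_gram_le hF hw t01)// fip_inc.
    by rewrite eipC fipC (winc_gram_le hF hw t01)// fip_inc.
  + have [lX b1] := wiener_int_L2 h1; have [lY b2] := wiener_int_L2 h2.
    have [l3 b3] := wiener_int_L2 (wiener_int_inc k ss).
    rewrite eipC eipDl// eipC ih1 eipC ih2 [RHS]fipC /fip.
    rewrite -RintegralD//; try exact: fip_int.
    apply: eq_Rintegral => r _; rewrite -big_split/=; apply: eq_bigr => j _.
    by ring.
  + have [lX b1] := wiener_int_L2 hX.
    have [l3 b3] := wiener_int_L2 (wiener_int_inc k ss).
    rewrite eipC eipZl// eipC ihX [RHS]fipC fipC /fip.
    rewrite -RintegralZl//; try exact: fip_int.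
    by apply: eq_Rintegral => r _; rewrite mulr_sumr; apply: eq_bigr => j _; ring.
  + have lXn N : sqintegrable Pr setT (Xn N) by case: (wiener_int_L2 (hXn N)).
    have bXn N j : bmeasurable I (fun r => fn N r j) by case: (wiener_int_L2 (hXn N)).
    have [l3 b3] := wiener_int_L2 (wiener_int_inc k ss).
    have c1 := eip_cvg hX l3 lXn cX.
    have c2 := fip_cvg bXn b3 uf.
    rewrite eipC fipC; apply: (cvg_unique (@Rhausdorff R) c1).
    apply: cvg_trans c2; apply: near_eq_cvg; apply: nearW => N.
    by rewrite eipC ih fipC.
- have [lX b1] := wiener_int_L2 h1; have [lY b2] := wiener_int_L2 h2.
  have [l3 b3] := wiener_int_L2 hY.
  rewrite eipDl// (ih1 _ _ hY) (ih2 _ _ hY) /fip.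
  rewrite -RintegralD//; try exact: fip_int.
  apply: eq_Rintegral => r _; rewrite -big_split/=; apply: eq_bigr => j _.
  by ring.
- have [lX b1] := wiener_int_L2 hX.
  have [l3 b3] := wiener_int_L2 hY.
  rewrite eipZl// (ihX _ _ hY) /fip -RintegralZl//; try exact: fip_int.
  by apply: eq_Rintegral => r _; rewrite mulr_sumr; apply: eq_bigr => j _; ring.
- have lXn N : sqintegrable Pr setT (Xn N) by case: (wiener_int_L2 (hXn N)).
  have bXn N j : bmeasurable I (fun r => fn N r j) by case: (wiener_int_L2 (hXn N)).
  have [l3 b3] := wiener_int_L2 hY.
  have c1 := eip_cvg hX l3 lXn cX.
  have c2 := fip_cvg bXn b3 uf.
  apply: (cvg_unique (@Rhausdorff R) c1).
  apply: cvg_trans c2; apply: near_eq_cvg; apply: nearW => N.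
  by rewrite (ih _ _ _ hY).
Qed.

(** The limit constructor applied to a constant sequence also replaces representatives: the
    mean-square distance is zero, and the integrands have to agree on [[t0, t1]] only. *)
Lemma wiener_int_eq X f Y g : wiener_int X f -> X =1 Y ->
  (forall r, t0 <= r <= t1 -> f r =1 g r) -> wiener_int Y g.
Proof.
move=> hX XY fg; apply: (wiener_int_lim (Xn := fun=> X) (fn := fun=> f)) => //.
- by have [sX _] := wiener_int_L2 hX; rewrite (_ : Y = X)//; apply/funext.
- rewrite (_ : (fun N => _) = fun=> 0); first exact: cvg_cst.
  apply/funext => _; rewrite (_ : (fun o => _) = fun=> 0) ?eip0l//.
  by apply/funext => o; rewrite XY subrr.
- by move=> e e0; exists 0%N => N _ r rI k; rewrite fg// subrr normr0 ltW.
Qed.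

End wiener_integral.

(** * Almost sure limits of Wiener integrals, and the integrals given by [ito_integral] *)

Section wiener_integral_limits.
Context {R : realType} {d : measure_display} {T : measurableType d}.
Variables (Pr : probability T R) (m : nat) (t0 t1 : R).
Variables (F : R -> set (set T)) (w : R -> T -> 'cV[R]_m).
Notation leb := (@lebesgue_measure R).
Notation I := (`[t0, t1]%classic : set (measurableTypeR R)).
Notation wint := (wiener_int Pr t0 t1 w).
Implicit Types (X Y : T -> R) (f g : R -> 'I_m -> R).
Hypothesis hF : filtration F.
Hypothesis hw : wiener_process Pr t0 t1 F w.
Hypothesis t01 : t0 <= t1.

Lemma wiener_int_sum J (s : seq J) (X : J -> T -> R) (f : J -> R -> 'I_m -> R) :
  (forall i, wint (X i) (f i)) ->
  wint (fun o => \sum_(i <- s) X i o) (fun r l => \sum_(i <- s) f i r l).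
Proof.
move=> h; elim: s => [|i s ih].

  apply: (wiener_int_eq hF hw (@wiener_int_0 R d T Pr m t0 t1 w)) => [z | r _ l];
  by rewrite big_nil.
by apply: (wiener_int_eq hF hw (wiener_int_add (h i) ih)) => [z | r _ l];
  rewrite big_cons.
Qed.

Lemma wiener_intB X Y f g : wint X f -> wint Y g ->
  wint (fun o => X o - Y o) (fun r l => f r l - g r l).
Proof.
move=> hX hY.
by apply: (wiener_int_eq hF hw (wiener_int_add hX (wiener_int_scale (-1) hY)))
  => [z | r _ l]; rewrite mulN1r.
Qed.

Lemma wiener_int_winc s t k : t0 <= s <= t1 -> t0 <= t <= t1 ->
  wint (winc w s t k) (fun r l => (((r < t)%R)%:R - ((r < s)%R)%:R) * (k == l)%:R).
Proof.
move=> hs ht.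
apply: (wiener_int_eq hF hw (wiener_intB (wiener_int_inc Pr w k ht)
  (wiener_int_inc Pr w k hs))) => [z | r _ l].
  by rewrite /winc; ring.
by case: (k == l); rewrite ?andbT ?andbF ?mulr1 ?mulr0 ?subrr.
Qed.

Lemma limn_einf_le (u : nat -> \bar R) (c : \bar R) N0 :
  (forall n, (N0 <= n)%N -> (u n <= c)%E) -> (limn_einf u <= c)%E.
Proof.
move=> h; rewrite limn_einf_lim; apply: lime_le; first exact: is_cvg_einfs.
exists N0 => // n /= hn; apply: le_trans (h n hn).
by apply: ereal_inf_lbound; exists n => /=.
Qed.

Lemma eip_sqE X : sqintegrable Pr setT X ->
  (\int[Pr]_o (X o ^+ 2)%:E = (eip Pr X X)%:E)%E.
Proof.
by move=> sX; rewrite /eip -rintegral_EFin//; exact: sqintegrable_mul.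
Qed.

Lemma fip_le f (c : R) : 0 <= c ->
  (forall k, bmeasurable I (fun r => f r k)) ->
  (forall r, t0 <= r <= t1 -> forall k, `|f r k| <= c) ->
  fip t0 t1 f f <= c ^+ 2 * (m%:R * (t1 - t0)).
Proof.
move=> c0 bf hf.
have ifc : rintegrable leb I (fun=> c ^+ 2 * m%:R).
  by apply: bmeasurable_rintegrable; [exact: itv_meas|exact: itv_fin|exact: bmeasurable_cst].
apply: (@le_trans _ _ (\int[leb]_(r in I) (c ^+ 2 * m%:R))).
  apply: le_Rintegral => //; first exact: fip_int.
  move=> r; rewrite mem_itvcc => rI.
  apply: (@le_trans _ _ (\sum_(k < m) c ^+ 2)).
    apply: ler_sum => k _; rewrite -expr2 -real_normK ?num_real//.
    by rewrite lerXn2r ?nnegrE// hf.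
  by rewrite sumr_const card_ord mulr_natr.
rewrite Rintegral_cst// -mulrA ler_wpM2l ?sqr_ge0// ler_wpM2l//.
have E : (leb `[t0, t1]%classic = (t1 - t0)%:E)%E.
  rewrite lebesgue_measure_itv/= lte_fin; move: t01; rewrite le_eqVlt.
  by move=> /predU1P[<-|h1]; rewrite ?ltxx ?subrr// h1.
by have := congr1 fine E; rewrite /= => ->.
Qed.

(** By the isometry, uniform closeness of the integrands makes [Xn] Cauchy in mean square; Fatou's
    lemma carries the estimate over to the almost sure limit. Square integrability of [X] thus comes
    out of the argument. *)
Lemma wiener_int_ae_lim X f (Xn : nat -> T -> R) fn : measurable_fun setT X ->
  (forall N, wint (Xn N) (fn N)) ->
  {ae Pr, forall o, Xn ^~ o @ \oo --> X o} ->
  unif_cvg t0 t1 fn f -> wint X f.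
Proof.
move=> mX hXn cX uf.
have LX N : sqintegrable Pr setT (Xn N) by case: (wiener_int_L2 hF hw (hXn N)).
have bf N k : bmeasurable I (fun r => fn N r k) by case: (wiener_int_L2 hF hw (hXn N)).
set Q := m%:R * (t1 - t0).
have Q0 : 0 <= Q by rewrite mulr_ge0// subr_ge0.
have key e : 0 < e -> exists N0, forall N, (N0 <= N)%N ->
    (\int[Pr]_o ((X o - Xn N o) ^+ 2)%:E <= ((2 * e) ^+ 2 * Q)%:E)%E.
  move=> e0; have [N0 hN0] := uf e e0; exists N0 => N hN.
  pose G M o : \bar R := ((Xn M o - Xn N o) ^+ 2)%:E.
  have mG M : measurable_fun setT (G M).
    apply/measurable_EFinP; apply: measurable_funX.
    by apply: measurable_funB; [case: (LX M)|case: (LX N)].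
  have G0 M o : setT o -> (0 <= G M o)%E by rewrite lee_fin sqr_ge0.
  have := fatou Pr measurableT mG G0.
  have -> : (\int[Pr]_o limn_einf (G^~ o) = \int[Pr]_o ((X o - Xn N o) ^+ 2)%:E)%E.
    apply: ge0_ae_eq_integral => //.
    - apply: measurableT_comp => //.
      apply: (measurable_fun_limn_esup (f := fun M o => (- G M o)%E)) => M.
      exact: measurableT_comp.
    - apply/measurable_EFinP; apply: measurable_funX; apply: measurable_funB => //.
      by case: (LX N).
    - move=> o _; rewrite limn_einf_lim.
      apply: lime_ge; first exact: is_cvg_einfs.
      apply: nearW => n; apply: le_ereal_inf_tmp => _ [k _ <-].
      exact: G0.
    - by move=> o _; rewrite lee_fin sqr_ge0.
    apply: filterS cX => o co _.
    have h : (G^~ o) @ \oo --> ((X o - Xn N o) ^+ 2)%:E.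
      apply: cvg_EFin; first exact: nearW.
      rewrite (_ : _ \o _ = fun M => (Xn M o - Xn N o) * (Xn M o - Xn N o)).
        by rewrite expr2; apply: cvgM; apply: cvgB => //; exact: cvg_cst.
      by apply/funext => M /=; rewrite expr2.
    by have [-> _] := cvg_limn_einf_sup h.
  (* Beyond [N0] both integrands are within [e] of [f], hence within [2 * e] of each other. *)
  move=> /le_trans; apply; apply: (@limn_einf_le _ _ N0) => M hM.
  have wB := wiener_intB (hXn M) (hXn N).
  have [LB bB] := wiener_int_L2 hF hw wB.
  rewrite /G (_ : (\int[_]_o _ =
    (eip Pr (fun o => Xn M o - Xn N o) (fun o => Xn M o - Xn N o))%:E)%E).
    rewrite lee_fin (wiener_isometry hF hw t01 wB wB).
    apply: fip_le => //; first by rewrite mulr_ge0// ltW.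
    move=> r rI k.
    rewrite -(subrKA (f r k)) (le_trans (ler_normD _ _))// mulrDl mul1r lerD//.
      by rewrite distrC hN0.
    exact: hN0.
  exact: (eip_sqE LB).
have sqD N : measurable_fun setT (fun o => (X o - Xn N o) ^+ 2).
  by apply: measurable_funX; apply: measurable_funB => //; case: (LX N).
have LB N c : (\int[Pr]_o ((X o - Xn N o) ^+ 2)%:E <= c%:E)%E ->
    sqintegrable Pr setT (fun o => X o - Xn N o).
  move=> h; split; first by apply: measurable_funB => //; case: (LX N).
  apply/integrableP; split; first exact/measurable_EFinP.
  under eq_integral do rewrite /= ger0_norm ?sqr_ge0//.
  by rewrite (le_lt_trans h)// ltry.
have sX : sqintegrable Pr setT X.
  have [N0 /(_ N0 (leqnn _)) h] := key 1 ltr01.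
  have := sqintegrableD measurableT (LB _ _ h) (LX N0).
  rewrite (_ : (fun o => _) = X)//.
  by apply/funext => o; rewrite subrK.
apply: (wiener_int_lim sX hXn _ uf).
apply/cvgrPdist_le => e e0.
(* Chosen so that [(2 * dl) ^ 2 * Q] equals [e * Q / (Q + 1)]; the summand one covers [Q = 0]. *)
pose dl := Num.sqrt (e / (4 * (Q + 1))).
have q0 : 0 < e / (4 * (Q + 1)) by rewrite divr_gt0// mulr_gt0// ltr_wpDl.
have dl0 : 0 < dl by rewrite sqrtr_gt0.
have [N0 hN0] := key dl dl0; exists N0 => // N /= hN.
rewrite sub0r normrN ger0_norm ?eip_ge0//.
have sB : sqintegrable Pr setT (fun o => X o - Xn N o) by exact: sqintegrableB.
have := hN0 N hN.
rewrite (_ : (\int[_]_o _ =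
  (eip Pr (fun o => X o - Xn N o) (fun o => X o - Xn N o))%:E)%E); last first.
  exact: (eip_sqE sB).
rewrite lee_fin => /le_trans; apply.
rewrite exprMn sqr_sqrtr; last exact: ltW.
have Q1 : 0 < Q + 1 by rewrite ltr_wpDl.
have -> : 2 ^+ 2 * (e / (4 * (Q + 1))) * Q = e * (Q / (Q + 1)).
  by field; rewrite gt_eqF.
apply: ler_piMr; first exact: ltW.
by rewrite ler_pdivrMr// mul1r lerDl.
Qed.

Lemma cell_diff (a b : R) N k r : a <= b ->
  cell a b N k r = ((r < grid a b N k.+1)%R)%:R - ((r < grid a b N k)%R)%:R.
Proof.
move=> ab; rewrite /cell leNgt; have := @grid_mono R a b N k k.+1 ab (leqnSn k).
case: ltP => h1; case: ltP => h2 h3 /=; rewrite ?subrr ?subr0//.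
by have := lt_le_trans h1 (le_trans h3 h2); rewrite ltxx.
Qed.

Lemma grid_in_sub (t : R) N k : t0 <= t <= t1 -> (k <= N.+1)%N ->
  t0 <= grid t0 t N k <= t1.
Proof.
move=> /andP[h1 h2] kN; have /andP[-> h3] := @grid_in R t0 t N k h1 kN.
by rewrite (le_trans h3).
Qed.

Lemma step_approx_fin (J : finType) (t : R) (h : J -> R -> R) (e : bool) :
  t0 <= t -> (forall j, {within `[t0, t], continuous (h j)}) ->
  forall dl, 0 < dl -> exists N0, forall N, (N0 <= N)%N -> forall r j,
   `|\sum_(k < N.+1) h j (grid t0 t N (k + e)) * cell t0 t N k r
     - h j r * ((t0 <= r) && (r < t))%:R| <= dl.
Proof.
move=> tt ch dl dl0.
have H j := step_approx e tt (ch j) dl0.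
pose N1 j := projT1 (cid (H j)).
exists (\max_j N1 j)%N => N hN r j.
apply: (projT2 (cid (H j))).
by apply: leq_trans hN; exact: (leq_bigmax j).
Qed.

Lemma within_cont_sub (a b s t : R) (h : R -> R) : a <= s -> t <= b ->
  {within `[a, b], continuous h} -> {within `[s, t], continuous h}.
Proof. by move=> h1 h2; apply: continuous_subspaceW; exact: itv_sub. Qed.

(** The defining sums of [ito_integral] are integrals of left-endpoint step functions, which
    converge uniformly to [B] cut off at [t]. The cut-off lets integrals over different [[t0, t]] be
    subtracted within the fixed interval [[t0, t1]]. *)
Lemma ito_wiener_int n (B : R -> 'M[R]_(n, m)) t (M : T -> 'cV[R]_n) i :
  mx_continuous_on t0 t1 B -> t0 <= t <= t1 -> ito_integral Pr B w t0 t M ->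
  wint (fun o => M o i 0) (fun r l => ((r < t)%R)%:R * B r i l).
Proof.
move=> cB tt [mM cM].
have /andP[t0t tt1] := tt.
pose WS N o := wiener_sum B w t0 t N o i 0.
pose fn N r l := \sum_(k < N.+1) B (grid t0 t N (k + false)) i l * cell t0 t N k r.
have wWS N : wint (WS N) (fn N).
  have H (k : 'I_N.+1) : wint
      (fun o => \sum_j B (grid t0 t N k) i j * winc w (grid t0 t N k) (grid t0 t N k.+1) j o)
      (fun r l => \sum_j B (grid t0 t N k) i j *
         ((((r < grid t0 t N k.+1)%R)%:R - ((r < grid t0 t N k)%R)%:R) * (j == l)%:R)).
    apply: wiener_int_sum => j; apply: wiener_int_scale; apply: wiener_int_winc.
      by apply: grid_in_sub => //; apply: ltnW.
    exact: grid_in_sub.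
  apply: (wiener_int_eq hF hw (wiener_int_sum (index_enum _) H)) => [z | r _ l].
    rewrite /WS /wiener_sum summxE; apply: eq_bigr => k _.
    by rewrite mxE; apply: eq_bigr => j _; rewrite !mxE.
  rewrite /fn; apply: eq_bigr => k _; rewrite addn0 cell_diff//.
  rewrite (bigD1 l)//= eqxx mulr1 big1 ?addr0// => j jl.
  by rewrite (negbTE jl) !mulr0.
have mMi : measurable_fun setT (fun o => M o i 0).
  by move=> _ E mE; rewrite setTI; exact: mM.
have LW N : sqintegrable Pr setT (WS N) by case: (wiener_int_L2 hF hw (wWS N)).
have cE := cM i.
have mD N : measurable_fun setT (fun o => (M o i 0 - WS N o) ^+ 2).
  by apply: measurable_funX; apply: measurable_funB => //; case: (LW N).
have sM : sqintegrable Pr setT (fun o => M o i 0).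
  (* Extended reals that converge to zero are eventually finite; one finite mean-square error
     already makes [M] square integrable. *)
  have /fine_cvgP[fin _] := cE.
  have [N _ /(_ N (leqnn N)) /= fN] := fin.
  have sD : sqintegrable Pr setT (fun o => M o i 0 - WS N o).
    split; first by apply: measurable_funB => //; case: (LW N).
    apply/integrableP; split; first exact/measurable_EFinP.
    under eq_integral do rewrite /= ger0_norm ?sqr_ge0//.
    by move: fN; rewrite unlock => /fin_numPlt/andP[].
  have := sqintegrableD measurableT sD (LW N).
  by rewrite (_ : (fun o => _) = (fun o => M o i 0))//; apply/funext => o; rewrite subrK.
apply: (wiener_int_lim sM wWS).
  have /fine_cvgP[_] := cE.
  apply: cvg_trans; apply: near_eq_cvg; apply: nearW => N.
  rewrite /eip /Rintegral /= unlock.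
  by congr fine; apply: eq_integral => o _; rewrite expr2.
move=> e e0.
have cBt j : {within `[t0, t], continuous (fun r => B r i j)}.
  exact: within_cont_sub (cB i j).
have [N0 hN0] := step_approx_fin false t0t cBt e0.
exists N0 => N hN r /andP[r0 r1] k; rewrite distrC.
by have := hN0 N hN r k; rewrite r0/= mulrC.
Qed.

End wiener_integral_limits.

(** * Second moments of the state *)

Section gaussian_initial_state.
Context {R : realType} {d : measure_display} {T : measurableType d}.
Variables (Pr : probability T R) (n : nat) (S : 'M[R]_n) (x0 : T -> 'cV[R]_n).
Hypothesis hx0 : normal_vector Pr S x0.

Lemma delta_mulmx_delta (M : 'M[R]_n) i j :
  ((delta_mx i 0 : 'cV[R]_n)^T *m M *m (delta_mx j 0 : 'cV[R]_n)) 0 0 = M i j.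
Proof. by rewrite trmx_delta -rowE -colE !mxE. Qed.

Lemma delta_mulmx_vec (v : 'cV[R]_n) i :
  ((delta_mx i 0 : 'cV[R]_n)^T *m v) 0 0 = v i 0.
Proof. by rewrite trmx_delta -rowE mxE. Qed.

Let combo (a : 'cV[R]_n) : a != 0 ->
  [/\ sqintegrable Pr setT (fun o => (a^T *m x0 o) 0 0),
      \int[Pr]_o ((a^T *m x0 o) 0 0) = 0 &
      eip Pr (fun o => (a^T *m x0 o) 0 0) (fun o => (a^T *m x0 o) 0 0) = quad S a].
Proof.
move=> a0; have [[_ pS] mx hN] := hx0.
have q0 := pS a a0.
have s0 : 0 < Num.sqrt (quad S a) by rewrite sqrtr_gt0.
have mX : measurable_fun setT (fun o => (a^T *m x0 o) 0 0).
  rewrite (_ : (fun o => _) = fun o => \sum_j a^T 0 j * x0 o j 0).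
    apply: measurable_sum => j; apply: measurable_funM => //.
    by move=> _ E mE; rewrite setTI; exact: mx.
  by apply/funext => o; rewrite mxE.
have [sq E] := normal_sqintegrable s0 mX (hN a a0).
split => //; first exact: (normal_mean s0 mX (hN a a0)).
have := E; rewrite (eip_sqE sq) => -[->].
by rewrite sqr_sqrtr// ltW.
Qed.

Lemma delta_neq0 (i : 'I_n) : (delta_mx i 0 : 'cV[R]_n) != 0.
Proof.
apply/eqP => /matrixP/(_ i 0); rewrite !mxE !eqxx/= => /eqP.
by rewrite oner_eq0.
Qed.

Let x0E i : (fun o => ((delta_mx i 0 : 'cV[R]_n)^T *m x0 o) 0 0) = (fun o => x0 o i 0).
Proof. by apply/funext => o; exact: delta_mulmx_vec. Qed.

Lemma normal_vector_L2 i : sqintegrable Pr setT (fun o => x0 o i 0).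
Proof. by have [+ _ _] := combo (delta_neq0 i); rewrite x0E. Qed.

Lemma normal_vector_mean i : \int[Pr]_o (x0 o i 0) = 0.
Proof. by have [_ + _] := combo (delta_neq0 i); rewrite -[in _ -> \int[_]_o _ = _]x0E. Qed.

(** Polarisation: the variance along [delta_mx i 0 + delta_mx j 0], compared with the diagonal
    entries, gives the mixed moment. *)
Lemma normal_vector_moment i j :
  eip Pr (fun o => x0 o i 0) (fun o => x0 o j 0) = S i j.
Proof.
have D k : eip Pr (fun o => x0 o k 0) (fun o => x0 o k 0) = S k k.
  have [_ _] := combo (delta_neq0 k); rewrite x0E => ->.
  exact: delta_mulmx_delta.
have [->|ij] := eqVneq i j; first exact: D.
have a0 : (delta_mx i 0 + delta_mx j 0 : 'cV[R]_n) != 0.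
  apply/eqP => /matrixP/(_ i 0); rewrite !mxE !eqxx/= (negbTE ij)/= addr0 => /eqP.
  by rewrite oner_eq0.
have [_ _] := combo a0.
have -> : (fun o => ((delta_mx i 0 + delta_mx j 0 : 'cV[R]_n)^T *m x0 o) 0 0) =
    (fun o => x0 o i 0 + x0 o j 0).
  by apply/funext => o; rewrite [(_ + _)^T]linearD mulmxDl mxE !delta_mulmx_vec.
have Li := normal_vector_L2 i; have Lj := normal_vector_L2 j.
have Lij : sqintegrable Pr setT (fun o => x0 o i 0 + x0 o j 0) by exact: sqintegrableD.
rewrite eipDl// eipC eipDl// [eip _ (fun o => x0 o j 0) (fun o => _ + _)]eipC eipDl//.
rewrite !D [eip _ (fun o => x0 o j 0) _]eipC.
have -> : quad S (delta_mx i 0 + delta_mx j 0) = S i i + S i j + S j i + S j j.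
  rewrite /quad [(_ + _)^T]linearD !mulmxDl !mulmxDr [LHS]mxE [X in X + _]mxE [X in _ + X]mxE.
  by rewrite !delta_mulmx_delta; ring.
have [[sS _] _ _] := hx0.
have -> : S j i = S i j by rewrite -[in LHS]sS mxE.
move=> E; lra.
Qed.

End gaussian_initial_state.

Lemma cvg_sumr {R : realType} J (s : seq J) (u : J -> nat -> R) (l : J -> R) :
  (forall j, u j @ \oo --> l j) ->
  (fun N => \sum_(j <- s) u j N) @ \oo --> \sum_(j <- s) l j.
Proof.
move=> h; elim: s => [|j s ih].
  rewrite big_nil (_ : (fun _ => _) = fun=> 0); first exact: cvg_cst.
  by apply/funext => N; rewrite big_nil.
rewrite big_cons (_ : (fun _ => _) = fun N => u j N + \sum_(j <- s) u j N).
  exact: cvgD.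
by apply/funext => N; rewrite big_cons.
Qed.

Section state_moments.
Context {R : realType} {d : measure_display} {T : measurableType d}.
Variables (Pr : probability T R) (n m : nat) (t0 t1 : R).
Variables (F : R -> set (set T)) (w : R -> T -> 'cV[R]_m) (x0 : T -> 'cV[R]_n).
Variables (B : R -> 'M[R]_(n, m)) (a : R -> 'M[R]_n) (x : R -> T -> 'cV[R]_n).
Variable (S0 : 'M[R]_n).
Notation leb := (@lebesgue_measure R).
Notation I := (`[t0, t1]%classic : set (measurableTypeR R)).
Notation wint := (wiener_int Pr t0 t1 w).
Hypothesis hF : filtration F.
Hypothesis hw : wiener_process Pr t0 t1 F w.
Hypothesis t01 : t0 <= t1.
Hypothesis hx0 : vec_measurable (F t0) x0.
Hypothesis hx0N : normal_vector Pr S0 x0.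
Hypothesis cB : mx_continuous_on t0 t1 B.
Hypothesis ia : mxint t0 t1 a.
Hypothesis ad : adapted t0 t1 F x.
Hypothesis cx : continuous_paths t0 t1 x.
Hypothesis xx0 : {ae Pr, forall o, x t0 o = x0 o}.
Hypothesis hx : forall t, t \in `[t0, t1] -> exists M : T -> 'cV[R]_n,
  ito_integral Pr B w t0 t M /\
  {ae Pr, forall o, x t o = x0 o + mx_integral t0 t (fun s => a s *m x s o) + M o}.
Variables (Phi Th : R -> 'M[R]_n).
Hypothesis pTh : mxprim t0 t1 Th (fun t => - (Th t *m a t)).
Hypothesis Th0 : Th t0 = 1%:M.
Hypothesis PhiTh : forall t, t0 <= t <= t1 -> Phi t *m Th t = 1%:M.

Let tin t : t0 <= t <= t1 -> t \in `[t0, t1].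
Proof. by rewrite in_itv. Qed.

Let M_ex t : exists M : T -> 'cV[R]_n, t0 <= t <= t1 ->
  ito_integral Pr B w t0 t M /\
  {ae Pr, forall o, x t o = x0 o + mx_integral t0 t (fun s => a s *m x s o) + M o}.
Proof.
have [tt|tt] := boolP (t0 <= t <= t1); last by exists (fun=> 0).
by have [M hM] := hx (tin tt); exists M.
Qed.

Let M t := projT1 (cid (M_ex t)).

Let M_ito t : t0 <= t <= t1 -> ito_integral Pr B w t0 t (M t).
Proof. by move=> tt; case: (projT2 (cid (M_ex t)) tt). Qed.

Let M_eq t : t0 <= t <= t1 ->
  {ae Pr, forall o, x t o = x0 o + mx_integral t0 t (fun s => a s *m x s o) + M t o}.
Proof. by move=> tt; case: (projT2 (cid (M_ex t)) tt). Qed.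

Let y t o := Th t *m x t o - x0 o.

Let x_meas t i : t0 <= t <= t1 -> measurable_fun setT (fun o => x t o i 0).
Proof.
by move=> tt; apply: (vec_meas_sub (t := t) hF); apply: ad; exact: tin.
Qed.

Let x0_meas i : measurable_fun setT (fun o => x0 o i 0).
Proof. exact: (vec_meas_sub (t := t0) hF). Qed.

Let y_meas t i : t0 <= t <= t1 -> measurable_fun setT (fun o => y t o i 0).
Proof.
move=> tt; rewrite (_ : (fun o => _) = fun o => (\sum_j Th t i j * x t o j 0) - x0 o i 0).
  apply: measurable_funB => //.
  by apply: measurable_sum => j; apply: measurable_funM => //; exact: x_meas.
by apply/funext => o; rewrite !mxE.
Qed.

Let aexD o : mxprim t0 t1 (fun t => mx_integral t0 t (fun s => a s *m x s o))
  (fun s => a s *m x s o).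
Proof.
apply: mxprim_integral; apply: mxint_bnd => //.
by apply: mxcont_bnd => i j; exact: cx.
Qed.

Let path_sum t N i o := \sum_(k < N.+1) \sum_j Th (grid t0 t N k) i j *
  (M (grid t0 t N k.+1) o j 0 - M (grid t0 t N k) o j 0).

(** Summation by parts moves the increments from [M], for which no bounded variation is available,
    onto [Th], and [M] itself is replaced by means of the state equation. Every remaining sum is a
    Stieltjes sum against an absolutely continuous function, and the two drift integrals cancel
    because [Th' = - Th a]. *)
Let path_cvg t i : t0 <= t <= t1 ->
  {ae Pr, forall o, (fun N => path_sum t N i o) @ \oo --> y t o i 0}.
Proof.
move=> tt; have /andP[t0t tt1] := tt.
(* [M] at each time obeys the state equation off a null set that depends on that time; the grids for
   all [N] involve countably many times, so a single exceptional set suffices. *)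
have H : {ae Pr, forall o, forall N k, (k <= N.+1)%N ->
    M (grid t0 t N k) o = x (grid t0 t N k) o - x0 o -
      mx_integral t0 (grid t0 t N k) (fun s => a s *m x s o)}.
  apply: ae_foralln => N; apply: ae_foralln => k.
  have [kN|kN] := leqP k N.+1; last first.
    by apply: aeW => o; rewrite ?(leqNgt k) ?kN.
  have gI := grid_in_sub tt kN.
  apply: filterS (M_eq gI) => o E _.
  by rewrite E; apply/matrixP => p q; rewrite !mxE; ring.
apply: filterS2 xx0 H => o x0o Ho.
set D := fun t => mx_integral t0 t (fun s => a s *m x s o).
have pD := mxprim_sub (lexx t0) t0t tt1 (aexD o).
have pT := mxprim_sub (lexx t0) t0t tt1 pTh.
have cT := mxprim_cont pT.
have cxt j : {within `[t0, t], continuous (fun s => x s o j 0)}.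
  exact: (within_cont_sub (lexx t0) tt1 (@cx o j 0)).
have c1 j := @stieltjes_cvg R t0 t (fun s => Th s i j) _ _ false t0t (cT i j) (pD j 0).
have c2 j := @stieltjes_cvg R t0 t (fun s => x s o j 0) _ _ true t0t (cxt j) (pT i j).
pose L j : R := Th t i j * x t o j 0 - Th t0 i j * x t0 o j 0
   - \int[leb]_(s in `[t0, t]) (x s o j 0 * (- (Th s *m a s)) i j)
   - \int[leb]_(s in `[t0, t]) (Th s i j * (a s *m x s o) j 0).
have c3 j : (fun N => \sum_(k < N.+1) Th (grid t0 t N k) i j *
    (M (grid t0 t N k.+1) o j 0 - M (grid t0 t N k) o j 0)) @ \oo --> L j.
  pose s2 N := \sum_(k < N.+1) x (grid t0 t N (k + true)) o j 0 *
    (Th (grid t0 t N k.+1) i j - Th (grid t0 t N k) i j).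
  pose s1 N := \sum_(k < N.+1) Th (grid t0 t N (k + false)) i j *
    (D (grid t0 t N k.+1) j 0 - D (grid t0 t N k) j 0).
  have h : (fun N => Th t i j * x t o j 0 - Th t0 i j * x t0 o j 0 - s2 N - s1 N)
      @ \oo --> L j.
    apply: cvgB; last exact: c1.
    by apply: cvgB; [exact: cvg_cst|exact: c2].
  apply: cvg_trans h; apply: near_eq_cvg; apply: nearW => N.
  rewrite /s1 /s2.
  have := @telescope_sumr R 0 N.+1
    (fun k => Th (grid t0 t N k) i j * x (grid t0 t N k) o j 0) (leq0n _).
  rewrite big_mkord gridN grid0 => <-.
  rewrite -!sumrB; apply: eq_bigr => k _.
  rewrite !addn1 !addn0.
  have -> := Ho N k (ltnW (ltn_ord k)); have -> := Ho N k.+1 (ltn_ord k).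
  have sx p (v1 v2 v3 : 'cV[R]_n) : (v1 - v2 - v3) p 0 = v1 p 0 - v2 p 0 - v3 p 0.
    by rewrite !mxE.
  by rewrite !sx; ring.
have h : (fun N => path_sum t N i o) @ \oo --> \sum_j L j.
  rewrite (_ : (fun N => _) = fun N => \sum_j \sum_(k < N.+1) Th (grid t0 t N k) i j *
      (M (grid t0 t N k.+1) o j 0 - M (grid t0 t N k) o j 0)); last first.
    by apply/funext => N; rewrite /path_sum exchange_big.
  exact: cvg_sumr c3.
rewrite (_ : \sum_j L j = y t o i 0) in h; first exact: h.
rewrite /L !sumrB.
have bxt : mxbnd t0 t (fun s => x s o) by apply: mxcont_bnd => p q; rewrite ord1.
have iat : mxint t0 t a by move=> p q; exact: rintegrable_sub (ia p q).
have bT := mxcont_bnd cT.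
have E1 : \sum_j \int[leb]_(s in `[t0, t]) (x s o j 0 * (- (Th s *m a s)) i j) =
   - \int[leb]_(s in `[t0, t]) (Th s *m a s *m x s o) i 0.
  rewrite -rintegral_sum//; last first.
    move=> j _; apply: bmeasurable_mul => //.
    by apply: (mxintN (M := fun s => Th s *m a s)); exact: mxbnd_int.
  rewrite -rintegralN//; last first.
    by apply: (mxint_bnd _ bxt i 0); exact: mxbnd_int.
  apply: eq_Rintegral => s _; rewrite [in RHS]mxE -sumrN; apply: eq_bigr => j _.
  by rewrite [in LHS]mxE; ring.
have E2 : \sum_j \int[leb]_(s in `[t0, t]) (Th s i j * (a s *m x s o) j 0) =
   \int[leb]_(s in `[t0, t]) (Th s *m a s *m x s o) i 0.
  rewrite -rintegral_sum//; last first.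
    move=> j _; apply: bmeasurable_mul => //.
    by apply: (mxint_bnd iat bxt).
  by apply: eq_Rintegral => s _; rewrite -mulmxA [in RHS]mxE.
rewrite E1 E2 opprK Th0 /y.
rewrite [RHS]mxE [X in _ = X + _]mxE [X in _ = _ + X]mxE -x0o.
have -> : \sum_j (1%:M : 'M[R]_n) i j * x t0 o j 0 = x t0 o i 0.
  by have := congr1 (fun v : 'cV[R]_n => v i 0) (mul1mx (x t0 o)); rewrite mxE.
by ring.
Qed.

Lemma state_wiener_int t i : t0 <= t <= t1 ->
  wint (fun o => y t o i 0) (fun r l => ((r < t)%R)%:R * (Th r *m B r) i l).
Proof.
move=> tt; have /andP[t0t tt1] := tt.
pose fn N r l := \sum_(k < N.+1) \sum_j Th (grid t0 t N k) i j *
  (((r < grid t0 t N k.+1)%R)%:R * B r j l - ((r < grid t0 t N k)%R)%:R * B r j l).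
apply: (wiener_int_ae_lim hF hw t01 (Xn := fun N => path_sum t N i) (fn := fn)).
- exact: y_meas.
- move=> N; apply: (wiener_int_sum hF hw) => k; apply: (wiener_int_sum hF hw) => j.
  apply: wiener_int_scale.
  have k1 := grid_in_sub tt (ltn_ord k : (k.+1 <= N.+1)%N).
  have k2 := grid_in_sub tt (ltnW (ltn_ord k : (k.+1 <= N.+1)%N)).
  apply: (wiener_intB hF hw).
    exact: (ito_wiener_int hF hw j cB k1 (M_ito k1)).
  exact: (ito_wiener_int hF hw j cB k2 (M_ito k2)).
- exact: path_cvg.
- move=> e e0.
  have [C C0 hC] := mxbnd_bound (mxcont_bnd cB).
  (* Only [Th] is frozen at the grid points. The error is a sum of [n] terms, each a step error for
     [Th] times an entry of [B] bounded by [C], which dictates this tolerance. *)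
  have d0 : 0 < e / (n%:R * C + 1) by rewrite divr_gt0// ltr_wpDl// mulr_ge0.
  have cT j : {within `[t0, t], continuous (fun s => Th s i j)}.
    have cTh := mxprim_cont pTh.
    exact: (within_cont_sub (lexx t0) tt1 (cTh i j)).
  have [N0 hN0] := step_approx_fin false t0t cT d0.
  exists N0 => N hN r /[dup] rI /andP[r0 r1] l.
  have -> : fn N r l = \sum_j
      (\sum_(k < N.+1) Th (grid t0 t N (k + false)) i j * cell t0 t N k r) * B r j l.
    rewrite /fn exchange_big/=; apply: eq_bigr => j _.
    rewrite mulr_suml; apply: eq_bigr => k _.
    by rewrite addn0 cell_diff//; ring.
  rewrite [X in _ * X]mxE mulr_sumr -sumrB (le_trans (ler_norm_sum _ _ _))//.
  apply: (@le_trans _ _ (\sum_(j < n) e / (n%:R * C + 1) * C)).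
    apply: ler_sum => j _; rewrite mulrA -mulrBl normrM ler_pM ?hC//.
    by have := hN0 N hN r j; rewrite r0/= distrC mulrC.
  rewrite sumr_const card_ord -[_ *+ n]mulr_natr.
  have -> : e / (n%:R * C + 1) * C * n%:R = e * (n%:R * C) / (n%:R * C + 1) by ring.
  rewrite ler_pdivrMr; last by rewrite ltr_wpDl// mulr_ge0.
  by rewrite ler_pM2l// lerDl.
Qed.

Let z t o := y t o + x0 o.

Let x_z t o : t0 <= t <= t1 -> x t o = Phi t *m z t o.
Proof. by move=> tt; rewrite /z /y subrK mulmxA PhiTh// mul1mx. Qed.

(** The second moment of [Th t *m x t]: the initial covariance plus the Gram integral given by the
    isometry, the cross terms being zero. *)
Definition state_gram t := S0 + mx_integral t0 t
   (fun s => Th s *m B s *m (B s)^T *m (Th s)^T).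

Let y_L2 t i : t0 <= t <= t1 -> sqintegrable Pr setT (fun o => y t o i 0).
Proof. by move=> tt; case: (wiener_int_L2 hF hw (state_wiener_int i tt)). Qed.

Let x0_L2 i : sqintegrable Pr setT (fun o => x0 o i 0).
Proof. exact: (normal_vector_L2 hx0N). Qed.

Let z_L2 t i : t0 <= t <= t1 -> sqintegrable Pr setT (fun o => z t o i 0).
Proof.
move=> tt; have := sqintegrableD measurableT (y_L2 i tt) (x0_L2 i).
by rewrite (_ : (fun o => _) = (fun o => z t o i 0))//; apply/funext => o; rewrite [RHS]mxE.
Qed.

Let y_gram t i j : t0 <= t <= t1 ->
  eip Pr (fun o => y t o i 0) (fun o => y t o j 0) =
  \int[leb]_(s in `[t0, t]) (Th s *m B s *m (B s)^T *m (Th s)^T) i j.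
Proof.
move=> tt; have /andP[t0t tt1] := tt.
rewrite (wiener_isometry hF hw t01 (state_wiener_int i tt) (state_wiener_int j tt)).
have iG : mxint t0 t1 (fun s => Th s *m B s *m (B s)^T *m (Th s)^T).
  have bT := mxprim_bnd pTh; have bB := mxcont_bnd cB.
  apply: mxbnd_mxint; apply: mxbndM; last exact: mxbnd_tr.
  by apply: mxbndM; [exact: mxbndM|exact: mxbnd_tr].
(* The isometry yields an integrand cut off by [s < t], that is, an integral over [[t0, t[]; the
   endpoint is a null set. *)
rewrite -(Rintegral_itv_bndo_bndc (a := BLeft t0)); last first.
  apply: integrableS (iG i j) => //.
  move=> s /=; rewrite !in_itv/= => /andP[-> /ltW/le_trans]; exact.
rewrite /fip [RHS](_ : _ =
  \int[leb]_(s in I `&` (`[t0, t[%classic : set (measurableTypeR R)))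
    (Th s *m B s *m (B s)^T *m (Th s)^T) i j).
  rewrite Rintegral_mkcondr; apply: eq_Rintegral => s; rewrite inE mem_itvcc => /andP[s0 s1].
  rewrite patchE mem_setE in_itv/= s0/=.
  case: ltP => st; last by rewrite big1// => k _; rewrite !mul0r.
  rewrite -mulmxA -trmx_mul mxE; apply: eq_bigr => k _.
  by rewrite !mul1r [(_^T) _ _]mxE.
congr (Rintegral _ _ _); apply/seteqP; split => s /=; rewrite !in_itv/=; last by case.
move=> /andP[-> st]; split => //=.
by rewrite (le_trans (ltW st)).
Qed.

Let z_gram t i j : t0 <= t <= t1 ->
  eip Pr (fun o => z t o i 0) (fun o => z t o j 0) = state_gram t i j.
Proof.
move=> tt.
have zE k : (fun o => z t o k 0) = fun o => y t o k 0 + x0 o k 0.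
  by apply/funext => o; rewrite [LHS]mxE.
have Fx k : Fmeas F t0 (fun o => x0 o k 0) by move=> E mE; exact: hx0.
have yi := y_L2 i tt; have yj := y_L2 j tt.
have xi := x0_L2 i; have xj := x0_L2 j.
have yx k l : eip Pr (fun o => y t o k 0) (fun o => x0 o l 0) = 0.
  exact: (wiener_int_orth hF hw (state_wiener_int k tt) (x0_L2 l) (Fx l)).
rewrite !zE eipDl//; last exact: sqintegrableD.
rewrite eipC eipDl// [X in _ + X]eipC eipDl//.
rewrite [X in X + _ + _]eipC y_gram// [X in _ + X + _]eipC yx.
rewrite yx !addr0 ?add0r (normal_vector_moment hx0N) /state_gram !mxE.
have [[sS _] _ _] := hx0N.
by rewrite addrC; congr (_ + _); rewrite -[in LHS]sS mxE.
Qed.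

Let z_mean t i : t0 <= t <= t1 -> \int[Pr]_o (z t o i 0) = 0.
Proof.
move=> tt.
have h1 : Fmeas F t0 (fun=> 1 : R).
  move=> E mE; have [hm _ _] := hF.
  have sF := filtration_setT hF t0.
  have [E1|E1] := pselect (E 1).
    by rewrite (_ : _ @^-1` _ = setT)//; apply/seteqP; split.
  rewrite (_ : _ @^-1` _ = set0); first by case: (hm t0).
  by apply/seteqP; split => o.
have L1 := L2_cst Pr 1.
have := wiener_int_orth hF hw (state_wiener_int i tt) L1 h1.
rewrite /eip => Ey.
transitivity (\int[Pr]_o (y t o i 0 * 1 + x0 o i 0)).
  by apply: eq_Rintegral => o _; rewrite mulr1 [LHS]mxE.
rewrite RintegralD//.
- by rewrite Ey (normal_vector_mean hx0N) addr0.
- exact: sqintegrable_mul (y_L2 i tt) L1.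
- exact: L2_int.
Qed.

Lemma state_L2 t i : t0 <= t <= t1 -> sqintegrable Pr setT (fun o => x t o i 0).
Proof.
move=> tt; rewrite (_ : (fun o => _) = fun o => \sum_j Phi t i j * z t o j 0).
  by apply: sqintegrable_sum => // j _; apply: sqintegrableZ => //; exact: z_L2.
by apply/funext => o; rewrite x_z// mxE.
Qed.

Lemma state_moment t i j : t0 <= t <= t1 ->
  eip Pr (fun o => x t o i 0) (fun o => x t o j 0) =
  (Phi t *m state_gram t *m (Phi t)^T) i j.
Proof.
move=> tt.
have iz k l : rintegrable Pr setT (fun o => z t o k 0 * z t o l 0).
  by apply: sqintegrable_mul => //; exact: z_L2.
transitivity (\int[Pr]_o \sum_k \sum_l Phi t i l * Phi t j k * (z t o l 0 * z t o k 0)).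
  apply: eq_Rintegral => o _; rewrite x_z// mxE [X in _ * X]mxE.
  rewrite mulr_sumr; apply: eq_bigr => k _.
  by rewrite mulr_suml; apply: eq_bigr => l _; ring.
rewrite rintegral_sum//; last first.
  by move=> k _; apply: rintegrable_sum => // l _; apply: rintegrableZ.
rewrite mxE; apply: eq_bigr => k _.
rewrite rintegral_sum//; last by move=> l _; apply: rintegrableZ.
rewrite [X in _ = X * _]mxE [X in _ = _ * X]mxE mulr_suml; apply: eq_bigr => l _.
rewrite RintegralZl//; last exact: iz.
have := z_gram l k tt; rewrite /eip => ->; ring.
Qed.

Lemma state_mean t i : t0 <= t <= t1 -> \int[Pr]_o (x t o i 0) = 0.
Proof.
move=> tt; transitivity (\int[Pr]_o (\sum_j Phi t i j * z t o j 0)).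
  by apply: eq_Rintegral => o _; rewrite x_z// mxE.
have iz k : rintegrable Pr setT (fun o => z t o k 0) by apply: L2_int; exact: z_L2.
rewrite rintegral_sum//; last by move=> k _; apply: rintegrableZ.
by apply: big1 => k _; rewrite RintegralZl ?z_mean ?mulr0//; exact: iz.
Qed.

Lemma state_covmx t : t0 <= t <= t1 ->
  covmx Pr (x t) = Phi t *m state_gram t *m (Phi t)^T.
Proof.
move=> tt; apply/matrixP => i j; rewrite -state_moment// mxE.
rewrite covariance.unlock expectation.unlock /eip.
have E k : fine (\int[Pr]_o (x t o k 0)%:E)%E = 0 by exact: state_mean.
by rewrite !E; apply: eq_Rintegral => o _; rewrite !fctE /= !subr0.
Qed.

End state_moments.

(** * Finite energy of linear policies *)

Section lower_integral.
Local Open Scope ereal_scope.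
Context {d : measure_display} {T : measurableType d} {R : realType}.
Variable (mu : {measure set T -> \bar R}).

Import HBNNSimple.

(* The library integral of a nonnegative function is a supremum over simple
   minorants, so that monotonicity and positive homogeneity need no
   measurability. *)
Lemma le_lower_integral (f g : T -> \bar R) : (forall x, 0 <= f x) ->
  (forall x, f x <= g x) -> \int[mu]_x f x <= \int[mu]_x g x.
Proof.
move=> f0 fg.
have g0 x : 0 <= g x by apply: le_trans (fg x).
rewrite !ge0_integralTE//; apply: le_ereal_sup => _ [h hf <-].
by exists h => // x; apply: le_trans (fg x).
Qed.

Lemma lower_integralZl (c : R) (f : T -> \bar R) : (0 < c)%R ->
  (forall x, 0 <= f x) -> \int[mu]_x (c%:E * f x) <= c%:E * \int[mu]_x f x.
Proof.
move=> c0 f0.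
have cf0 x : 0 <= c%:E * f x by rewrite mule_ge0// lee_fin ltW.
rewrite !ge0_integralTE//; apply: ge_ereal_sup => _ [h hf <-].
have ci0 : (0 <= c^-1)%R by rewrite invr_ge0 ltW.
pose k := scale_nnsfun h ci0.
have E : sintegral mu h = c%:E * sintegral mu k.
  rewrite -sintegralrM; apply: eq_sintegral => x /=.
  by rewrite mulrA divff ?mul1r// gt_eqF.
rewrite E; apply: lee_wpmul2l; first by rewrite lee_fin ltW.
apply: ereal_sup_ubound; exists k => // x /=.
rewrite EFinM lee_pdivrMl//; exact: hf.
Qed.

End lower_integral.

Section iterated_integral.
Context {R : realType}.
Notation leb := (@lebesgue_measure R).
Notation L := lebesgue_integral_tuple.

(** Nonnegativity and comparison are proved together, since comparing the outer integrals requires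
    the inner ones to be nonnegative. *)
Lemma le_lebesgue_integral_tuple n (f g : n.-tuple R -> \bar R) :
  (forall v, (0 <= f v)%E) -> (forall v, (f v <= g v)%E) ->
  (0 <= L f)%E /\ (L f <= L g)%E.
Proof.
elim: n f g => [|n ih] f g f0 fg /=; first by split.
split.
  apply: integral_ge0 => a _.
  by case: (ih _ _ (fun v => f0 [tuple of a :: v]) (fun v => fg _)).
apply: le_lower_integral => a.
  by case: (ih _ _ (fun v => f0 [tuple of a :: v]) (fun v => fg _)).
by case: (ih _ _ (fun v => f0 [tuple of a :: v]) (fun v => fg _)).
Qed.

Lemma lebesgue_integral_tupleZl n (c : R) (f : n.-tuple R -> \bar R) : 0 < c ->
  (forall v, (0 <= f v)%E) -> (L (fun v => c%:E * f v) <= c%:E * L f)%E.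
Proof.
move=> c0; elim: n f => [|n ih] f f0 //=.
have g0 a : (0 <= L (fun v : n.-tuple R => f [tuple of a :: v]))%E.
  by case: (le_lebesgue_integral_tuple (fun v => f0 [tuple of a :: v])
     (fun v => lexx (f [tuple of a :: v]))).
apply: le_trans (lower_integralZl leb c0 g0).
apply: le_lower_integral => a; last exact: (ih (fun v : n.-tuple R => f [tuple of (a : R) :: v])).
have cf0 (v : n.-tuple R) : (0 <= c%:E * f [tuple of (a : R) :: v])%E.
  by rewrite mule_ge0// lee_fin ltW.
by case: (le_lebesgue_integral_tuple cf0 (fun v => lexx _)).
Qed.

Definition cube_density n (v : n.-tuple R) : R :=
  \prod_(i < n) (2^-1 * \1_(`[-1, 1]%classic : set R) (tnth v i)).

Lemma cube_density_ge0 n (v : n.-tuple R) : 0 <= cube_density v.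
Proof.
by apply: prodr_ge0 => i _; rewrite mulr_ge0 ?invr_ge0// indicE ler0n.
Qed.

Lemma cube_density_meas n : measurable_fun [set: n.-tuple R] (@cube_density n).
Proof.
apply: measurable_prod => i _; apply: measurable_funM => //.
apply: measurableT_comp; last exact: measurable_tnth.
apply: measurable_indic; exact: measurable_itv.
Qed.

Let P (p q r x : R) : R := p * x + q * (x ^+ 2 / 2) + r * (x ^+ 3 / 3).

Lemma integral_quadratic_itv (p q r : R) :
  (\int[leb]_(x in `[(-1)%R, 1%R]) (p + q * x + r * x ^+ 2)%:E = (2 * p + 2 / 3 * r)%:E)%E.
Proof.
have dP (x : R) : is_derive x 1 (P p q r) (p + q * x + r * x ^+ 2).
  apply: is_derive_eq; rewrite /GRing.scale/=.
  by rewrite /GRing.scale/=; field.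
have cP : continuous (P p q r).
  move=> x; apply: differentiable_continuous; apply/derivable1_diffP.
  by have [] := dP x.
have cf : continuous (fun x : R => p + q * x + r * x ^+ 2).
  move=> x; apply: cvgD; last by apply: cvgM; [exact: cvg_cst|exact: exprn_continuous].
  by apply: cvgD; [exact: cvg_cst|apply: cvgM; [exact: cvg_cst|exact: cvg_id]].
rewrite (@continuous_FTC2 R _ (P p q r)).
- by rewrite -EFinB; congr EFin; rewrite /P; field.
- by rewrite gtrN.
- exact: continuous_subspaceT.
- split => [x _||]; first by have [] := dP x.
  + exact: cvg_at_right_filter (cP _).
  + exact: cvg_at_left_filter (cP _).
- by move=> x _; rewrite derive1E; have [_ ->] := dP x.
Qed.

(** General coefficients make the induction close: with the first coordinate [a] fixed, the
    integrand is again of this form, with [al'], [be'], [M'] depending on [a]. Odd moments on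
    [[-1, 1]] vanish and each second moment is [1 / 3]. *)
Lemma cube_integral n (al : R) (be : 'I_n -> R) (M : 'I_n -> 'I_n -> R) :
  L (fun v => (cube_density v * (al + \sum_i be i * tnth v i +
     \sum_i \sum_j M i j * (tnth v i * tnth v j)))%:E) =
  (al + (\sum_i M i i) / 3)%:E.
Proof.
elim: n al be M => [|n ih] al be M /=.
  by rewrite /cube_density !big_ord0 mul1r !addr0 mul0r addr0.
pose u (a : R) : R := 2^-1 * \1_(`[-1, 1]%classic : set R) a.
pose c := (\sum_i M (lift ord0 i) (lift ord0 i)) / 3.
transitivity (\int[leb]_a (u a * (al + be ord0 * a + M ord0 ord0 * a ^+ 2 + c))%:E)%E.
  apply: eq_integral => a _.
  pose al' := u a * (al + be ord0 * a + M ord0 ord0 * a ^+ 2).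
  pose be' i := u a * (be (lift ord0 i) + a * (M ord0 (lift ord0 i) + M (lift ord0 i) ord0)).
  pose M' i j := u a * M (lift ord0 i) (lift ord0 j).
  have := ih al' be' M'.
  rewrite -mulr_sumr -mulrA -mulrDr => <-; congr (L _); apply/funext => v.
  congr EFin.
  rewrite /cube_density !big_ord_recl tnth0.
  have tS i : tnth [tuple of a :: v] (lift ord0 i) = tnth v i by rewrite tnthS.
  under eq_bigr do rewrite tS.
  under [X in _ * (_ + (_ + X) + _)]eq_bigr do rewrite tS.
  under [X in _ * (_ + _ + (_ + X + _))]eq_bigr do rewrite tS.
  under [X in _ * (_ + _ + (_ + X))]eq_bigr => i _.
    rewrite big_ord_recl tS tnth0.
    under eq_bigr do rewrite tS.
    over.
  rewrite /al' /be' /M' -/(u a).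
  have -> : \sum_i u a * (be (lift ord0 i) +
      a * (M ord0 (lift ord0 i) + M (lift ord0 i) ord0)) * tnth v i =
    u a * (\sum_i be (lift ord0 i) * tnth v i + \sum_i M ord0 (lift ord0 i) * (a * tnth v i)
       + \sum_i M (lift ord0 i) ord0 * (tnth v i * a)).
    by rewrite -!big_split/= mulr_sumr; apply: eq_bigr => i _; ring.
  have -> : \sum_i \sum_j u a * M (lift ord0 i) (lift ord0 j) * (tnth v i * tnth v j) =
    u a * \sum_i \sum_j M (lift ord0 i) (lift ord0 j) * (tnth v i * tnth v j).
    rewrite mulr_sumr; apply: eq_bigr => i _; rewrite mulr_sumr; apply: eq_bigr => j _.
    by ring.
  rewrite [\sum_i (M (lift ord0 i) ord0 * _ + _)]big_split/=.
  by ring.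
transitivity (\int[leb]_(a in `[(-1)%R, 1%R])
  (2^-1 * (al + c) + 2^-1 * be ord0 * a + 2^-1 * M ord0 ord0 * a ^+ 2)%:E)%E.
  rewrite [RHS]integral_mkcond; apply: eq_integral => a _.
  rewrite patchE /u indicE.
  by case: ifPn => ha; rewrite ?mulr1 ?mulr0 ?mul0r//; congr EFin; ring.
rewrite integral_quadratic_itv big_ord_recl; congr EFin; rewrite /c.
by field.
Qed.

End iterated_integral.

Lemma sqr_sum_le {R : realType} n (a : 'I_n -> R) :
  (\sum_i a i) ^+ 2 <= n%:R * \sum_i a i ^+ 2.
Proof.
rewrite expr2 mulr_suml.
apply: (@le_trans _ _ (\sum_i \sum_j (a i ^+ 2 + a j ^+ 2) / 2)).
  apply: ler_sum => i _; rewrite mulr_sumr; apply: ler_sum => j _.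
  by have := sqr_ge0 (a i - a j); nra.
have E i : \sum_j (a i ^+ 2 + a j ^+ 2) / 2 = (n%:R * a i ^+ 2 + \sum_j a j ^+ 2) / 2.
  by rewrite -mulr_suml big_split/= sumr_const card_ord mulr_natl.
under eq_bigr do rewrite E.
rewrite -mulr_suml big_split/= -mulr_sumr sumr_const card_ord -[X in _ + X]mulr_natl.
lra.
Qed.

Section finite_energy_L2.
Context {R : realType} (n m : nat) (t0 t1 : R) (K : R -> 'M[R]_(m, n)).
Notation leb := (@lebesgue_measure R).
Notation L := lebesgue_integral_tuple.
Notation I := (`[t0, t1]%classic : set (measurableTypeR R)).

Lemma sqnormE p (v : 'cV[R]_p) : sqnorm v = \sum_k v k 0 ^+ 2.
Proof. by rewrite /sqnorm mxE; apply: eq_bigr => k _; rewrite mxE expr2. Qed.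

Lemma sqnorm_ge0 p (v : 'cV[R]_p) : 0 <= sqnorm v.
Proof. by rewrite sqnormE; apply: sumr_ge0 => k _; rewrite sqr_ge0. Qed.

Lemma sqnorm_quadratic (v : 'cV[R]_n) t : sqnorm (K t *m v) =
  \sum_i \sum_j (\sum_k K t k i * K t k j) * (v i 0 * v j 0).
Proof.
rewrite sqnormE.
transitivity (\sum_k \sum_i \sum_j K t k i * K t k j * (v i 0 * v j 0)).
  apply: eq_bigr => k _; rewrite mxE expr2 mulr_suml; apply: eq_bigr => i _.
  by rewrite mulr_sumr; apply: eq_bigr => j _; ring.
rewrite exchange_big; apply: eq_bigr => i _; rewrite exchange_big.
by apply: eq_bigr => j _; rewrite mulr_suml.
Qed.

Lemma cube_density_second_moment : density_finite_second_moment (@cube_density R n).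
Proof.
split.
- exact: cube_density_meas.
- exact: cube_density_ge0.
- have := @cube_integral R n 1 (fun=> 0) (fun _ _ => 0).
  rewrite big1// mul0r addr0 => <-; congr (L _); apply/funext => v.
  rewrite [X in 1 + X + _]big1 ?addr0; last by move=> i _; rewrite mul0r.
  rewrite big1 ?addr0 ?mulr1// => i _; apply: big1 => j _; exact: mul0r.
- have := @cube_integral R n 0 (fun=> 0) (fun i j => (i == j)%:R).
  set r := (0 + _); move=> E; rewrite (_ : L _ = r%:E) ?ltry// -E.
  congr (L _); apply/funext => v; congr (EFin (_ * _)).
  rewrite [X in 0 + X + _]big1 ?addr0 ?add0r; last by move=> i _; rewrite mul0r.
  rewrite sqnormE; apply: eq_bigr => i _.
  rewrite (bigD1 i)//= eqxx mul1r big1 ?addr0; last first.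
    by move=> j ji; rewrite eq_sym (negbTE ji) mul0r.
  by rewrite mxE expr2.
Qed.

Hypothesis mK : mx_measurable_on t0 t1 K.

(* Test against the uniform density on the cube [[-1, 1]^n], whose second moment
   matrix is [1/3] of the identity, after truncating to [{sum |K| <= N}]. *)
Lemma finite_energy_L2 : finite_energy t0 t1 (linear_policy K) -> mxsq t0 t1 K.
Proof.
move=> /(_ _ cube_density_second_moment).
set l := L _ => lfin.
pose S t := \sum_k \sum_i `|K t k i|.
have mKI k i : measurable_fun I (fun t => K t k i) by exact: mK.
have mS : measurable_fun I S.
  rewrite /S; apply: measurable_sum => k; apply: measurable_sum => i.
  exact: measurableT_comp.
(* On [E N] all entries of [K] are bounded by [N], so the integrals below are finite and may be
   split into entries. *)
pose E (N : nat) : set (measurableTypeR R) := I `&` S @^-1` `]-oo, N%:R].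
have mE N : measurable (E N) by apply: mS; [exact: itv_meas|exact: measurable_itv].
have EI N : E N `<=` I by move=> t [].
have fE N : (leb (E N) < +oo)%E.
  apply: le_lt_trans (itv_fin t0 t1); apply: le_measure; rewrite ?inE//.
have KE N k i : bmeasurable (E N) (fun t => K t k i).
  split; first exact: measurable_funS (mKI k i).
  exists N%:R => t [_ /=]; rewrite in_itv/=; apply: le_trans.
  rewrite /S (bigD1 k)//= (bigD1 i)//= -addrA lerDl addr_ge0//.
    by apply: sumr_ge0.
  by apply: sumr_ge0 => p _; apply: sumr_ge0.
(* Gram matrix of the truncated gain: it turns the time integral of [|K v|^2] into a quadratic form
   in [v], so that the integration in [v] is an instance of [cube_integral] and no interchange of
   integrals is involved. *)
pose M N i j := \int[leb]_(t in E N) \sum_k K t k i * K t k j.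
have iM N i j : rintegrable leb (E N) (fun t => \sum_k K t k i * K t k j).
  apply: rintegrable_sum => // k _.
  exact: (bmeasurable_rintegrable (mE N) (fE N) (bmeasurableM (KE N k i) (KE N k j))).
have quadM N (v : 'cV[R]_n) : (\int[leb]_(t in E N) (sqnorm (K t *m v))%:E)%E =
    (\sum_i \sum_j M N i j * (v i 0 * v j 0))%:E.
  rewrite rintegral_EFin//; last first.
    apply: (eq_rintegrable (mE N)
      (f := fun t => \sum_i \sum_j v i 0 * v j 0 * (\sum_k K t k i * K t k j))).
      move=> t _; rewrite sqnorm_quadratic; apply: eq_bigr => i _.
      by apply: eq_bigr => j _; rewrite mulrC.
    apply: rintegrable_sum => // i _; apply: rintegrable_sum => // j _.
    exact: rintegrableZ.
  congr EFin.
  transitivity (\int[leb]_(t in E N)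
      (\sum_i \sum_j v i 0 * v j 0 * (\sum_k K t k i * K t k j))).
    apply: eq_Rintegral => t _; rewrite sqnorm_quadratic; apply: eq_bigr => i _.
    by apply: eq_bigr => j _; rewrite mulrC.
  rewrite rintegral_sum//; last first.
    by move=> i _; apply: rintegrable_sum => // j _; exact: rintegrableZ.
  apply: eq_bigr => i _; rewrite rintegral_sum//; last by move=> j _; exact: rintegrableZ.
  by apply: eq_bigr => j _; rewrite RintegralZl ?(mulrC _ (M N i j))//; exact: iM.
have trM N : (((\sum_i M N i i) / 3)%R%:E <= l)%E.
  have EL : ((\sum_i M N i i) / 3)%:E = L (fun v : n.-tuple R =>
      (cube_density v * (0 + \sum_i (0 : R) * tnth v i +
     \sum_i \sum_j M N i j * (tnth v i * tnth v j)))%:E).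
    by rewrite (@cube_integral R n 0 (fun=> 0) (M N)) add0r.
  rewrite EL.
  have msq (v : 'cV[R]_n) D : D `<=` I -> measurable D ->
      measurable_fun D (fun t => (sqnorm (K t *m v))%:E).
    move=> DI mD; apply/measurable_EFinP.
    rewrite (_ : (fun t => _) = fun t =>
      \sum_i \sum_j (\sum_k K t k i * K t k j) * (v i 0 * v j 0)).
      apply: measurable_sum => i; apply: measurable_sum => j; apply: measurable_funM => //.
      apply: measurable_sum => k; apply: measurable_funM; exact: measurable_funS (mKI _ _).
    by apply/funext => t; rewrite sqnorm_quadratic.
  have H (v : n.-tuple R) : ((cube_density v * (0 + \sum_i (0 : R) * tnth v i +
     \sum_i \sum_j M N i j * (tnth v i * tnth v j)))%:E =
     (cube_density v)%:E * \int[leb]_(t in E N) (sqnorm (K t *m tuple_col v))%:E)%E.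
    rewrite quadM EFinM; congr (_ * EFin _)%E.
    rewrite add0r big1 ?add0r => [|i _]; last exact: mul0r.
    by apply: eq_bigr => i _; apply: eq_bigr => j _; rewrite !mxE.
  apply: (le_lebesgue_integral_tuple _ _).2 => v; rewrite H.
    apply: mule_ge0; first by rewrite lee_fin cube_density_ge0.
    by apply: integral_ge0 => t _; rewrite lee_fin sqnorm_ge0.
  apply: lee_wpmul2l; first by rewrite lee_fin cube_density_ge0.
  apply: (ge0_subset_integral leb (mE N) (itv_meas t0 t1)) => //.
    by apply: msq => //; exact: itv_meas.
  by move=> t _; rewrite lee_fin sqnorm_ge0.
pose S2 t := \sum_i \sum_k K t k i ^+ 2.
have mS2 : measurable_fun I S2.
  by apply: measurable_sum => i; apply: measurable_sum => k; exact: measurable_funX.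
have S20 t : 0 <= S2 t by apply: sumr_ge0 => i _; apply: sumr_ge0 => k _; exact: sqr_ge0.
have UE : \bigcup_N E N = I.
  apply/seteqP; split => [t [N _ []]//|t It]; exists (Num.trunc (S t)).+1 => //.
  split => //=; rewrite in_itv/=.
  have S0 : 0 <= S t by apply: sumr_ge0 => k _; apply: sumr_ge0.
  by have /andP[_ /ltW] := trunc_itv S0.
have cE : (\int[leb]_(t in E N) (S2 t)%:E @[N --> \oo] --> \int[leb]_(t in I) (S2 t)%:E)%E.
  rewrite -UE; apply: ge0_nondecreasing_set_cvg_integral => //.
  - apply/nondecreasing_seqP => N; apply/subsetPset => t [It /=].
    rewrite in_itv/= => h; split => //=; rewrite in_itv/= (le_trans h)//.
    by rewrite ler_nat.
  - move=> N; apply: measurable_funS (EI N) _; first exact: itv_meas.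
    exact/measurable_EFinP.
  - by move=> N t _; rewrite lee_fin.
have iS2 : rintegrable leb I S2.
  apply/integrableP; split; first exact/measurable_EFinP.
  under eq_integral do rewrite /= ger0_norm//.
  have lf : l \is a fin_num.
    by rewrite fin_numElt lfin andbT (lt_le_trans (ltNyr _) (trM 0%N)).
  (* The factor three undoes the second moment of the cube; the bound is uniform in [N] and passes
     to the monotone limit [cE]. *)
  have h : (\int[leb]_(t in I) (S2 t)%:E <= (3 * fine l)%:E)%E.
    rewrite -(cvg_lim (@ereal_hausdorff R) cE).
    apply: lime_le; first by apply/cvg_ex; eexists; exact: cE.
    apply: nearW => N.
    have iS N' : rintegrable leb (E N') S2.
      apply: rintegrable_sum => // i _; apply: rintegrable_sum => // k _.
      exact: (bmeasurable_rintegrable (mE N') (fE N') (bmeasurableM (KE N' k i) (KE N' k i))).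
    rewrite rintegral_EFin// lee_fin.
    have := trM N; rewrite -(fineK lf) lee_fin ler_pdivrMr//= mulrC => h.
    apply: le_trans h; rewrite -rintegral_sum//.
  exact: le_lt_trans h (ltry _).
move=> k i; split; first exact: mKI.
apply: (le_rintegrable (itv_meas t0 t1)) iS2.
  by apply: measurable_funX; exact: mKI.
move=> t _; rewrite !ger0_norm ?sqr_ge0// /S2.
rewrite [leRHS](bigD1 i)//= [X in _ <= X + _](bigD1 k)//= -addrA lerDl addr_ge0//.
  by apply: sumr_ge0 => j _; exact: sqr_ge0.
by apply: sumr_ge0 => j _; apply: sumr_ge0 => p _; exact: sqr_ge0.
Qed.

(** Cauchy-Schwarz bounds [|K v|^2] by [n * S2 t * |v|^2], which separates time from state; what
    remains is the second moment of [rho]. *)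
Lemma L2_finite_energy : mxsq t0 t1 K -> finite_energy t0 t1 (linear_policy K).
Proof.
move=> sK rho [mrho rho0 _ rho2].
pose S2 t := \sum_k \sum_i K t k i ^+ 2.
have iS2 : rintegrable leb I S2.
  by apply: rintegrable_sum => // k _; apply: rintegrable_sum => // i _; case: (sK k i).
have S20 t : 0 <= S2 t.
  by apply: sumr_ge0 => k _; apply: sumr_ge0 => i _; exact: sqr_ge0.
(* The added one makes [C] positive, as [lebesgue_integral_tupleZl] requires. *)
pose C := n%:R * \int[leb]_(t in I) S2 t + 1.
have nS0 : 0 <= n%:R * \int[leb]_(t in I) S2 t.
  by rewrite mulr_ge0//; apply: Rintegral_ge0.
have C0 : 0 < C by rewrite ltr_wpDl.
have CS t (v : 'cV[R]_n) : sqnorm (K t *m v) <= n%:R * S2 t * sqnorm v.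
  rewrite sqnormE /S2 mulr_sumr mulr_suml; apply: ler_sum => k _.
  rewrite mxE; apply: le_trans (sqr_sum_le _) _.
  rewrite -mulrA ler_wpM2l// mulr_suml; apply: ler_sum => i _.
  rewrite exprMn ler_wpM2l ?sqr_ge0// sqnormE (bigD1 i)//= lerDl.
  by apply: sumr_ge0 => j _; exact: sqr_ge0.
have msq (v : 'cV[R]_n) : measurable_fun I (fun t => sqnorm (K t *m v)).
  rewrite (_ : (fun t => sqnorm _) = fun t => \sum_k (\sum_i K t k i * v i 0) ^+ 2).
    apply: measurable_sum => k; apply: measurable_funX; apply: measurable_sum => i.
    by apply: measurable_funM => //; exact: mK.
  by apply/funext => t; rewrite sqnormE; apply: eq_bigr => k _; rewrite mxE.
have H (v : n.-tuple R) : ((rho v)%:E *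
    \int[leb]_(t in I) (sqnorm (linear_policy K t (tuple_col v)))%:E
    <= C%:E * (rho v * sqnorm (tuple_col v))%:E)%E.
  rewrite [leRHS](_ : _ = (rho v)%:E * (C * sqnorm (tuple_col v))%:E)%E; last first.
    by rewrite -!EFinM; congr EFin; ring.
  apply: lee_wpmul2l; first by rewrite lee_fin.
  apply: (@le_trans _ _ (\int[leb]_(t in I) (sqnorm (tuple_col v) * n%:R * S2 t)%:E)%E).
    apply: ge0_le_integral => //.
    - by move=> t _; rewrite lee_fin sqnorm_ge0.
    - by apply/measurable_EFinP; exact: msq.
    - by apply/measurable_EFinP; apply: measurable_funM => //; exact: rintegrable_meas iS2.
    - move=> t _; rewrite lee_fin.
      have -> : sqnorm (tuple_col v) * n%:R * S2 t = n%:R * S2 t * sqnorm (tuple_col v) by ring.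
      exact: CS.
  rewrite rintegral_EFin//; last exact: rintegrableZ.
  rewrite lee_fin RintegralZl//.
  have -> : sqnorm (tuple_col v) * n%:R * \int[leb]_(t in I) S2 t =
    n%:R * \int[leb]_(t in I) S2 t * sqnorm (tuple_col v) by ring.
  by rewrite ler_wpM2r ?sqnorm_ge0// lerDl.
have f0 (v : n.-tuple R) : (0 <= (rho v)%:E *
    \int[leb]_(t in I) (sqnorm (linear_policy K t (tuple_col v)))%:E)%E.
  apply: mule_ge0; first by rewrite lee_fin.
  by apply: integral_ge0 => t _; rewrite lee_fin sqnorm_ge0.
have r0 (v : n.-tuple R) : (0 <= (rho v * sqnorm (tuple_col v))%:E)%E.
  by rewrite lee_fin mulr_ge0// sqnorm_ge0.
apply: le_lt_trans (le_lebesgue_integral_tuple f0 H).2 _.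
apply: le_lt_trans (lebesgue_integral_tupleZl C0 r0) _.
by rewrite lte_mul_pinfty// ?lee_fin ltW.
Qed.

End finite_energy_L2.

(** * Lyapunov equations *)

Section matrix_norm1.
Context {R : realType}.

(** A norm that is submultiplicative, invariant under transposition, dominates the trace, and is
    integrable along a path as a finite sum of absolute values. *)
Definition norm1 p q (M : 'M[R]_(p, q)) : R := \sum_i \sum_j `|M i j|.

Lemma norm1_ge0 p q (M : 'M[R]_(p, q)) : 0 <= norm1 M.
Proof. by apply: sumr_ge0 => i _; apply: sumr_ge0. Qed.

Lemma norm1D p q (M N : 'M[R]_(p, q)) : norm1 (M + N) <= norm1 M + norm1 N.
Proof.
rewrite /norm1 -big_split ler_sum// => i _; rewrite -big_split ler_sum// => j _.
by rewrite mxE ler_normD.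
Qed.

Lemma norm1_tr p q (M : 'M[R]_(p, q)) : norm1 M^T = norm1 M.
Proof.
rewrite /norm1 exchange_big; apply: eq_bigr => i _; apply: eq_bigr => j _.
by rewrite mxE.
Qed.

Lemma norm1Z p q c (M : 'M[R]_(p, q)) : norm1 (c *: M) = `|c| * norm1 M.
Proof.
rewrite /norm1 mulr_sumr; apply: eq_bigr => i _; rewrite mulr_sumr.
by apply: eq_bigr => j _; rewrite mxE normrM.
Qed.

Lemma norm1M p q r (M : 'M[R]_(p, q)) (N : 'M[R]_(q, r)) :
  norm1 (M *m N) <= norm1 M * norm1 N.
Proof.
rewrite /norm1 mulr_suml; apply: ler_sum => i _.
apply: (@le_trans _ _ (\sum_j \sum_k `|M i k| * `|N k j|)).
  apply: ler_sum => j _; rewrite mxE (le_trans (ler_norm_sum _ _ _))//.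
  by apply: ler_sum => k _; rewrite normrM.
rewrite exchange_big mulr_suml; apply: ler_sum => k _.
rewrite -mulr_sumr ler_wpM2l//.
by rewrite [leRHS](bigD1 k)//= lerDl; apply: sumr_ge0 => l _; apply: sumr_ge0.
Qed.

Lemma le_mxtrace_norm1 p (M : 'M[R]_p) : `|\tr M| <= norm1 M.
Proof.
rewrite /mxtrace (le_trans (ler_norm_sum _ _ _))// /norm1; apply: ler_sum => i _.
by rewrite (bigD1 i)//= lerDl; apply: sumr_ge0.
Qed.

End matrix_norm1.

Section interval_facts.
Context {R : realType}.
Notation leb := (@lebesgue_measure R).
Variables (t0 t1 : R).
Notation I := (`[t0, t1]%classic : set (measurableTypeR R)).
Hypothesis t01 : t0 <= t1.

Lemma norm1_rintegrable p q (F : R -> 'M[R]_(p, q)) : mxint t0 t1 F ->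
  rintegrable leb I (fun t => norm1 (F t)).
Proof.
move=> iF; apply: rintegrable_sum => // i _; apply: rintegrable_sum => // j _.
exact: (integrable_norm (iF i j)).
Qed.

Lemma mxint_sub p q (F : R -> 'M[R]_(p, q)) s t : t0 <= s -> t <= t1 ->
  mxint t0 t1 F -> mxint s t F.
Proof. by move=> h1 h2 iF i j; exact: rintegrable_sub h1 h2 (iF i j). Qed.

Lemma norm1_integral p q (F : R -> 'M[R]_(p, q)) t : t0 <= t <= t1 ->
  mxint t0 t1 F -> norm1 (mx_integral t0 t F) <= \int[leb]_(s in I) norm1 (F s).
Proof.
move=> /andP[t0t tt1] iF.
have iFt := mxint_sub (lexx t0) tt1 iF.
have nF := norm1_rintegrable iF.
rewrite (@rintegral_split R _ t0 t t1)// ler_wpDr//.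
  by apply: Rintegral_ge0 => s _; exact: norm1_ge0.
rewrite [leRHS]rintegral_sum//; last first.
  by move=> i _; apply: rintegrable_sum => // j _; exact: (integrable_norm (iFt i j)).
apply: ler_sum => i _; rewrite rintegral_sum//; last first.
  by move=> j _; exact: (integrable_norm (iFt i j)).
by apply: ler_sum => j _; rewrite mxE; apply: le_normr_Rintegral => //; exact: (iFt i j).
Qed.

Lemma mx_integralD p q (F G : R -> 'M[R]_(p, q)) t : t <= t1 ->
  mxint t0 t1 F -> mxint t0 t1 G ->
  mx_integral t0 t (fun s => F s + G s) = mx_integral t0 t F + mx_integral t0 t G.
Proof.
move=> tt1 iF iG; apply/matrixP => i j; rewrite !mxE.
have iFt := mxint_sub (lexx t0) tt1 iF; have iGt := mxint_sub (lexx t0) tt1 iG.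
rewrite -RintegralD//; [|exact: iFt|exact: iGt].
by apply: eq_Rintegral => s _; rewrite mxE.
Qed.

Lemma mx_integral_tr p q (F : R -> 'M[R]_(p, q)) a b :
  (mx_integral a b F)^T = mx_integral a b (fun s => (F s)^T).
Proof.
by apply/matrixP => i j; rewrite !mxE; apply: eq_Rintegral => s _; rewrite mxE.
Qed.

Lemma eq_mx_integral p q (F G : R -> 'M[R]_(p, q)) a b :
  (forall t, a <= t <= b -> F t = G t) -> mx_integral a b F = mx_integral a b G.
Proof.
move=> FG; apply/matrixP => i j; rewrite !mxE; apply: eq_Rintegral => s.
by rewrite inE mem_itvcc => /FG ->.
Qed.

Lemma tr_primitive p (X F : R -> 'M[R]_p) : mxprim t0 t1 X F ->
  primitive t0 t1 (fun t => \tr (X t)) (fun t => \tr (F t)).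
Proof. by move=> pX; apply: primitive_sum => i _; exact: pX. Qed.

Lemma tr_rintegrable p (F : R -> 'M[R]_p) : mxint t0 t1 F ->
  rintegrable leb I (fun t => \tr (F t)).
Proof. by move=> iF; apply: rintegrable_sum => // i _; exact: iF. Qed.

(** Integrals ignore null sets; this is how a gain known almost everywhere is substituted into an
    equation whose solution is constrained at every time. *)
Lemma mxprim_ae p q (X F G : R -> 'M[R]_(p, q)) : mxprim t0 t1 X F ->
  mxint t0 t1 G -> {ae leb, forall t, t \in `[t0, t1] -> F t = G t} ->
  mxprim t0 t1 X G.
Proof.
move=> /mxprimE[iF XF] iG FG; apply/mxprimE; split => // t tt.
rewrite XF//; congr (_ + _); apply/matrixP => i j; rewrite !mxE /Rintegral.
have /andP[t0t tt1] := tt.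
congr fine; apply: ae_eq_integral => //.
- apply/measurable_EFinP; apply: (rintegrable_meas (mu := leb)).
  exact: (mxint_sub (lexx t0) tt1 iF).
- apply/measurable_EFinP; apply: (rintegrable_meas (mu := leb)).
  exact: (mxint_sub (lexx t0) tt1 iG).
- move: FG; apply: filterS; first exact: (ae_filter_ringOfSetsType leb).
  move=> s h; rewrite mem_itvcc => /andP[s0 st].
  by rewrite h// in_itv/= s0 (le_trans st).
Qed.

Lemma mxprim_solves_ode p q (X F : R -> 'M[R]_(p, q)) :
  mxprim t0 t1 X F -> solves_ode t0 t1 X F.
Proof.
move=> pX; have [iF XF] := (mxprimE _ _ _ _).1 pX; split.
- exact: iF.
- by move=> t; rewrite in_itv/= => tt; rewrite XF.
- move=> t; rewrite in_itv/= => /andP[at_ tb] cF i j.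
  have [dI vI] := @continuous_FTC1_closed R (fun s => F s i j) t0 t t1 tb (iF i j) at_ (cF i j).
  pose G s := X t0 i j + \int[leb]_(x in `[t0, s]) F x i j.
  have dG : is_derive t 1 G (F t i j).
    have h : is_derive t 1 (fun s => \int[leb]_(x in `[t0, s]) F x i j) (F t i j).
      exact: (DeriveDef dI (etrans (esym (derive1E _ _)) vI)).
    have := is_deriveD (is_derive_cst (X t0 i j) t 1) h.
    by rewrite add0r.
  (* The integral form describes [X] inside the interval only; an interior [t] has a neighbourhood
     contained in it. *)
  apply: near_eq_is_derive dG.
  have : t \in `]t0, t1[ by rewrite in_itv/= at_.
  move=> /near_in_itvoo; apply: filterS => s.
  rewrite in_itv/= => /andP[/ltW s0 /ltW s1].
  by rewrite /G (XF s) ?s0// !mxE.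
Qed.

End interval_facts.

Section lyapunov.
Context {R : realType}.
Notation leb := (@lebesgue_measure R).
Variables (t0 t1 : R) (n : nat) (a : R -> 'M[R]_n).
Variables (Phi Th : R -> 'M[R]_n).
Hypothesis t01 : t0 <= t1.
Hypothesis ia : mxint t0 t1 a.
Hypothesis pPhi : mxprim t0 t1 Phi (fun t => a t *m Phi t).
Hypothesis pTh : mxprim t0 t1 Th (fun t => - (Th t *m a t)).
Hypothesis Phi0 : Phi t0 = 1%:M.
Hypothesis Th0 : Th t0 = 1%:M.
Hypothesis PhiTh : forall t, t0 <= t <= t1 ->
  Th t *m Phi t = 1%:M /\ Phi t *m Th t = 1%:M.

Let bPhi := mxprim_bnd pPhi.
Let bTh := mxprim_bnd pTh.

(** Variation of constants: conjugation by [Phi] accounts for the terms in [a], and it turns the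
    density of [G] back into [f] because [Phi *m Th] is the identity. *)
Lemma lyapunov_flow (G f : R -> 'M[R]_n) :
  mxprim t0 t1 G (fun t => Th t *m f t *m (Th t)^T) ->
  mxprim t0 t1 (fun t => Phi t *m G t *m (Phi t)^T) (fun t =>
    a t *m (Phi t *m G t *m (Phi t)^T) + (Phi t *m G t *m (Phi t)^T) *m (a t)^T + f t).
Proof.
move=> pG.
apply: (eq_mxprim (mxprimM (mxprimM pPhi pG) (mxprim_tr pPhi))) => // t tt.
have [_ PT] := PhiTh tt.
have E : Phi t *m (Th t *m f t *m (Th t)^T) *m (Phi t)^T = f t.
  by rewrite !mulmxA PT mul1mx -mulmxA -trmx_mul PT trmx1 mulmx1.
rewrite mulmxDl E trmx_mul !mulmxA -!addrA; congr (_ + _); exact: addrC.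
Qed.

(** Conjugating by [Th] cancels the terms in [a] and leaves the forcing; integrating and conjugating
    back by [Phi] recovers [D]. As [D] is an arbitrary solution, this contains uniqueness. *)
Lemma lyapunov_duhamel (D f : R -> 'M[R]_n) : mxint t0 t1 f ->
  mxprim t0 t1 D (fun t => a t *m D t + D t *m (a t)^T + f t) -> D t0 = 0 ->
  forall t, t0 <= t <= t1 ->
  D t = Phi t *m mx_integral t0 t (fun s => Th s *m f s *m (Th s)^T) *m (Phi t)^T.
Proof.
move=> if_ pD D0 t tt.
have p1 := mxprimM (mxprimM pTh pD) (mxprim_tr pTh).
have p2 : mxprim t0 t1 (fun t => Th t *m D t *m (Th t)^T)
    (fun s => Th s *m f s *m (Th s)^T).
  apply: (eq_mxprim p1) => // s _.
  have E1 : (- (Th s *m a s) *m D s + Th s *m (a s *m D s + D s *m (a s)^T + f s)) *m (Th s)^T =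
      Th s *m D s *m (a s)^T *m (Th s)^T + Th s *m f s *m (Th s)^T.
    by rewrite !mulmxDr mulNmx !mulmxA !addrA addNr add0r mulmxDl.
  by rewrite E1 [(- _)^T]linearN/= trmx_mul mulmxN !mulmxA addrAC subrr add0r.
have /mxprimE[_ /(_ t tt)] := p2.
rewrite D0 mulmx0 mul0mx add0r => <-.
have [_ PT] := PhiTh tt.
by rewrite !mulmxA PT mul1mx -mulmxA -trmx_mul PT trmx1 mulmx1.
Qed.

Lemma costate_exists (W : R -> 'M[R]_n) (P1 : 'M[R]_n) : mxint t0 t1 W ->
  (forall t, t0 <= t <= t1 -> (W t)^T = W t) -> P1^T = P1 ->
  exists P : R -> 'M[R]_n,
  [/\ mxprim t0 t1 P (fun t => - ((a t)^T *m P t + P t *m a t + W t)),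
      P t1 = P1 & forall t, t0 <= t <= t1 -> (P t)^T = P t].
Proof.
move=> iW sW sP1.
pose w s := (Phi s)^T *m W s *m Phi s.
have iw : mxint t0 t1 w.
  by apply: mxint_bnd => //; apply: mxbnd_int => //; exact: mxbnd_tr.
(* [H] is the costate pulled back by the flow. At [t1] the two integrals cancel and conjugation by
   [Th t1] undoes [Phi t1], so the terminal condition is met with transition matrices started at
   [t0]. *)
pose H t := (Phi t1)^T *m P1 *m Phi t1 + mx_integral t0 t1 w - mx_integral t0 t w.
have pH : mxprim t0 t1 H (fun t => - w t).
  apply: (eq_mxprim (mxprimB (mxprim_cst t0 t1
    ((Phi t1)^T *m P1 *m Phi t1 + mx_integral t0 t1 w))
    (mxprim_integral iw))) => // t _; exact: sub0r.
have tt1 : t0 <= t1 <= t1 by rewrite t01 lexx.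
exists (fun t => (Th t)^T *m H t *m Th t); split.
- apply: (eq_mxprim (mxprimM (mxprimM (mxprim_tr pTh) pH) pTh)) => // t tt.
  have [_ PT] := PhiTh tt.
  have E : (Th t)^T *m w t *m Th t = W t.
    by rewrite /w !mulmxA -trmx_mul PT trmx1 mul1mx -mulmxA PT mulmx1.
  rewrite [(- _)^T]linearN/= trmx_mul.
  have -> : (- ((a t)^T *m (Th t)^T) *m H t + (Th t)^T *m - w t) *m Th t =
      - ((a t)^T *m ((Th t)^T *m H t *m Th t)) - W t.
    by rewrite mulmxDl mulmxN !mulNmx E !mulmxA.
  by rewrite mulmxN !mulmxA !opprD addrAC.
- have [_ PT] := PhiTh tt1.
  rewrite /H addrK !mulmxA -trmx_mul PT trmx1 mul1mx -mulmxA PT mulmx1 //.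
- move=> t tt.
  have sI s : t0 <= s <= t1 -> (mx_integral t0 s w)^T = mx_integral t0 s w.
    move=> /andP[s0 s1]; rewrite mx_integral_tr; apply: eq_mx_integral => r /andP[r0 rs].
    by rewrite /w !trmx_mul trmxK sW ?mulmxA// r0 (le_trans rs).
  rewrite !trmx_mul trmxK mulmxA; congr (_ *m _ *m _).
  rewrite /H [LHS]linearB/= [X in X - _]linearD/= !sI//.
  by rewrite !trmx_mul trmxK sP1 mulmxA.
Qed.

End lyapunov.

(** * Feasible processes *)

Section quadratic_forms.
Context {R : realType}.
Notation leb := (@lebesgue_measure R).

Lemma quadE n (M : 'M[R]_n) (v : 'cV[R]_n) :
  quad M v = \sum_i \sum_j M i j * (v i 0 * v j 0).
Proof.
rewrite /quad -mulmxA mxE; apply: eq_bigr => i _.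
rewrite mxE [X in _ * X]mxE mulr_sumr; apply: eq_bigr => j _; ring.
Qed.

Lemma quadD n (M N : 'M[R]_n) v : quad (M + N) v = quad M v + quad N v.
Proof. by rewrite /quad mulmxDr mulmxDl mxE. Qed.

Lemma quad_conj n p (M : 'M[R]_p) (A : 'M[R]_(n, p)) v :
  quad (A *m M *m A^T) v = quad M (A^T *m v).
Proof. by rewrite /quad trmx_mul trmxK !mulmxA. Qed.

Lemma quad_gram n p (A : 'M[R]_(n, p)) v : quad (A *m A^T) v = sqnorm (A^T *m v).
Proof. by rewrite /quad /sqnorm trmx_mul trmxK !mulmxA. Qed.

Lemma quad_integral_ge0 n a b (F : R -> 'M[R]_n) v : mxint a b F ->
  (forall t, 0 <= quad (F t) v) -> 0 <= quad (mx_integral a b F) v.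
Proof.
move=> iF F0; rewrite quadE.
have iFc i j : rintegrable leb `[a, b] (fun t => (v i 0 * v j 0) * F t i j).
  by apply: rintegrableZ => //; exact: iF.
have -> : \sum_i \sum_j mx_integral a b F i j * (v i 0 * v j 0) =
    \int[leb]_(t in `[a, b]) quad (F t) v.
  transitivity (\int[leb]_(t in `[a, b]) \sum_i \sum_j (v i 0 * v j 0) * F t i j).
    rewrite rintegral_sum//; last by move=> i _; exact: rintegrable_sum.
    apply: eq_bigr => i _; rewrite rintegral_sum//; apply: eq_bigr => j _.
    by rewrite mxE RintegralZl ?(mulrC (v i 0 * v j 0))//; exact: iF.
  apply: eq_Rintegral => t _; rewrite quadE; apply: eq_bigr => i _.
  by apply: eq_bigr => j _; rewrite mulrC.
exact: Rintegral_ge0.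
Qed.

(** Read row by row, the trace is a sum of quadratic forms of [S]; its sign and its vanishing are
    then governed by positive definiteness of [S]. *)
Lemma mxtrace_rows m n (G : 'M[R]_(m, n)) (S : 'M[R]_n) :
  \tr (G^T *m G *m S) = \sum_k quad S (row k G)^T.
Proof.
rewrite -mulmxA mxtrace_mulC /mxtrace; apply: eq_bigr => k _.
rewrite /quad trmxK -row_mul.
rewrite !mxE; apply: eq_bigr => j _; rewrite !mxE; congr (_ * _).
Qed.

End quadratic_forms.

Section feasible_processes.
Context {R : realType} (n m : nat) (t0 t1 : R).
Variables (A : R -> 'M[R]_n) (B : R -> 'M[R]_(n, m)) (Sigma0 : 'M[R]_n).
Context {d : measure_display} {T : measurableType d}.
Variables (Pr : probability T R).
Variables (F : R -> set (set T)) (w : R -> T -> 'cV[R]_m) (x0 : T -> 'cV[R]_n).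
Notation leb := (@lebesgue_measure R).
Notation I := (`[t0, t1]%classic : set (measurableTypeR R)).
Hypothesis ht : t0 < t1.
Hypothesis cA : mx_continuous_on t0 t1 A.
Hypothesis cB : mx_continuous_on t0 t1 B.
Hypothesis hS0 : pdmx Sigma0.
Hypothesis hF : filtration F.
Hypothesis hw : wiener_process Pr t0 t1 F w.
Hypothesis hx0 : vec_measurable (F t0) x0.
Hypothesis hx0N : normal_vector Pr Sigma0 x0.

Let t01 : t0 <= t1. Proof. exact: ltW. Qed.

Lemma gain_closed_loop_int (K : R -> 'M[R]_(m, n)) : mxsq t0 t1 K ->
  mxint t0 t1 (fun t => A t + B t *m K t).
Proof.
move=> sK; apply: mxintD; first exact/mxbnd_mxint/mxcont_bnd.
by apply: mxbnd_int; [exact: mxcont_bnd|exact: mxsq_int].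
Qed.

Lemma feasible_gain_L2 K x : feasible Pr t0 t1 F w x0 A B K x -> mxsq t0 t1 K.
Proof. by case=> mK fe _; exact: finite_energy_L2. Qed.

(** The closed-loop drift is [a *m x] with [a = A + B K] integrable, so the second-moment lemmas
    apply, and [lyapunov_flow] with forcing [B B^T] gives the equation. The product moments are kept
    beside the covariance because the running cost is an expectation of products. *)
Lemma feasible_covmx (K : R -> 'M[R]_(m, n)) (x : R -> T -> 'cV[R]_n) :
  feasible Pr t0 t1 F w x0 A B K x ->
  [/\ mxprim t0 t1 (fun t => covmx Pr (x t))
        (fun t => (A t + B t *m K t) *m covmx Pr (x t) +
                  covmx Pr (x t) *m (A t + B t *m K t)^T + B t *m (B t)^T),
      covmx Pr (x t0) = Sigma0,
      forall t, t0 <= t <= t1 -> pdmx (covmx Pr (x t)),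
      forall t, t0 <= t <= t1 -> forall i, sqintegrable Pr setT (fun o => x t o i 0) &
      forall t, t0 <= t <= t1 -> forall i j,
        eip Pr (fun o => x t o i 0) (fun o => x t o j 0) = covmx Pr (x t) i j].
Proof.
move=> fx; have sK := feasible_gain_L2 fx.
have ia := gain_closed_loop_int sK.
have [_ _ [ad cx xx0 _ hx]] := fx.
set a := fun t => A t + B t *m K t in ia.
have hx' t : t \in `[t0, t1] -> exists M : T -> 'cV[R]_n,
    ito_integral Pr B w t0 t M /\
    {ae Pr, forall o, x t o = x0 o + mx_integral t0 t (fun s => a s *m x s o) + M o}.
  move=> tt; have [M [hM E]] := hx t tt; exists M; split => //.
  apply: filterS E => o ->; congr (_ + _ + _); apply: eq_mx_integral => s _.
  by rewrite /feedback /linear_policy /a mulmxDl mulmxA.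
have [Phi [Th [pP pT P0 T0 PT]]] := transition_exists t01 ia.
have PT2 t : t0 <= t <= t1 -> Phi t *m Th t = 1%:M by move=> /PT[].
have bT := mxprim_bnd pT; have bB := mxcont_bnd cB.
pose Gf s := Th s *m B s *m (B s)^T *m (Th s)^T.
have iG : mxint t0 t1 Gf.
  apply: mxbnd_mxint; apply: mxbndM; last exact: mxbnd_tr.
  by apply: mxbndM; [exact: mxbndM|exact: mxbnd_tr].
have covE t : t0 <= t <= t1 ->
    covmx Pr (x t) = Phi t *m state_gram t0 B Sigma0 Th t *m (Phi t)^T.
  exact: (state_covmx hF hw t01 hx0 hx0N cB ia ad cx xx0 hx' pT T0 PT2).
have pG : mxprim t0 t1 (state_gram t0 B Sigma0 Th)
    (fun t => Th t *m (B t *m (B t)^T) *m (Th t)^T).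
  apply: (eq_mxprim (mxprimD (mxprim_cst t0 t1 Sigma0) (mxprim_integral iG))) => // t _.
  by rewrite add0r /Gf !mulmxA.
split.
- apply: (eq_mxprim (lyapunov_flow pP PT pG)) => t tt; rewrite covE//.
- by rewrite covE ?lexx// /state_gram mx_integral_aa addr0 P0 mul1mx trmx1 mulmx1.
- move=> t tt; rewrite covE//.
  have sG : (state_gram t0 B Sigma0 Th t)^T = state_gram t0 B Sigma0 Th t.
    rewrite /state_gram linearD/= mx_integral_tr; congr (_ + _); first by case: hS0.
    by apply: eq_mx_integral => s _; rewrite !trmx_mul !trmxK !mulmxA.
  split; first by rewrite /symmx !trmx_mul trmxK sG mulmxA.
  (* Congruence by the invertible [Phi t] preserves the positive definiteness inherited from
     [Sigma0]; the Gram integral adds a nonnegative form. *)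
  move=> v v0; rewrite quad_conj /state_gram quadD ltr_pwDl//.
    case: hS0 => _; apply.
    apply: contra_neq v0 => h.
    have [_ TP] := PT t tt.
    by rewrite -[v]mul1mx -[1%:M]trmx1 -TP trmx_mul -mulmxA h mulmx0.
  have /andP[_ tt1] := tt.
  apply: quad_integral_ge0; first exact: (mxint_sub (lexx t0) tt1 iG).
  move=> s; rewrite -[Th s *m B s *m (B s)^T *m _]mulmxA -trmx_mul quad_gram.
  exact: sqnorm_ge0.
- move=> t tt i.
  exact: (state_L2 hF hw t01 hx0 hx0N cB ia ad cx xx0 hx' pT T0 PT2 i tt).
- move=> t tt i j; rewrite covE//.
  exact: (state_moment hF hw t01 hx0 hx0N cB ia ad cx xx0 hx' pT T0 PT2 i j tt).
Qed.

(** In [cost] the expectation sits inside the time integral, so at each [t] linearity over the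
    finitely many products of coordinates suffices. *)
Lemma feasible_cost (Q : R -> 'M[R]_n) (Sigmad : 'M[R]_n) K x :
  mx_integrable_on t0 t1 Q ->
  feasible Pr t0 t1 F w x0 A B K x ->
  cost Pr t0 t1 Q Sigmad (feedback (linear_policy K) x) x =
  (2^-1 * \tr ((covmx Pr (x t1) - Sigmad) *m (covmx Pr (x t1) - Sigmad)) +
   \int[leb]_(t in I) \tr (((K t)^T *m K t + Q t) *m covmx Pr (x t)))%:E.
Proof.
move=> iQ fx; have sK := feasible_gain_L2 fx.
have [pS S0 pdS L2x Ex] := feasible_covmx fx.
have iW : mxint t0 t1 (fun t => ((K t)^T *m K t + Q t) *m covmx Pr (x t)).
  apply: mxint_bnd; last exact: mxprim_bnd pS.
  by apply: mxintD => //; apply: mxsqM => //; exact: mxsq_tr.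
rewrite /cost EFinD; congr (_ + _)%E.
rewrite -rintegral_EFin//; last exact: tr_rintegrable.
apply: eq_integral => t; rewrite inE mem_itvcc => tt.
have Lx := L2x t tt.
have ixx i j : rintegrable Pr setT (fun o => x t o i 0 * x t o j 0).
  exact: sqintegrable_mul.
set W := (K t)^T *m K t + Q t.
have WE o : sqnorm (feedback (linear_policy K) x t o) + quad (Q t) (x t o) =
    \sum_i \sum_j W i j * (x t o i 0 * x t o j 0).
  rewrite -quadE /W quadD -{2}(trmxK (K t)) quad_gram trmxK.
  by rewrite /feedback /linear_policy.
rewrite expectation.unlock.
under eq_integral do rewrite WE.
rewrite rintegral_EFin//; last first.
  by apply: rintegrable_sum => // i _; apply: rintegrable_sum => // j _; exact: rintegrableZ.
congr EFin; rewrite rintegral_sum//; last first.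
  by move=> i _; apply: rintegrable_sum => // j _; exact: rintegrableZ.
rewrite /mxtrace; apply: eq_bigr => i _.
rewrite rintegral_sum//; last by move=> j _; exact: rintegrableZ.
rewrite mxE; apply: eq_bigr => j _; rewrite RintegralZl//; last exact: ixx.
congr (_ * _).
have := Ex t tt i j; rewrite /eip => ->.
by have [sS _] := pdS t tt; rewrite -[in LHS]sS mxE.
Qed.

Lemma FmeasP t (X : T -> R) : Fmeas F t X <->
  measurable_fun (setT : set (g_sigma_algebraType (F t))) X.
Proof.
have sF : sigma_algebra setT (F t) by case: hF.
have E : (@measurable _ (g_sigma_algebraType (F t))) = F t.
  by rewrite /measurable/= sigma_algebra_id.
split=> [hX _ C mC|hX C mC]; first by rewrite setTI E; exact: hX.
by have := hX measurableT C mC; rewrite setTI E.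
Qed.

(* Perturbing the gain by [delta] perturbs the state by the pathwise solution
   of [z' = (A + B (K + delta)) z + B delta x], [z t0 = 0]. *)
Lemma feasible_perturb K delta x : feasible Pr t0 t1 F w x0 A B K x ->
  mxsq t0 t1 delta -> exists x' : R -> T -> 'cV[R]_n,
    feasible Pr t0 t1 F w x0 A B (fun t => K t + delta t) x'.
Proof.
move=> fx sd; have sK := feasible_gain_L2 fx.
have [_ _ [ad cx xx0 _ hx]] := fx.
have sK' : mxsq t0 t1 (fun t => K t + delta t) by exact: mxsqD.
have ia' := gain_closed_loop_int sK'.
set a' := fun t => A t + B t *m (K t + delta t) in ia'.
have [Phi [Th [pP pT P0 T0 PT]]] := transition_exists t01 ia'.
have bP := mxprim_bnd pP; have bT := mxprim_bnd pT; have bB := mxcont_bnd cB.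
(* Duhamel's formula for the difference process: [g] carries the forcing pulled back to [t0], which
   makes [z] explicit on each path. *)
pose g s := Th s *m B s *m delta s.
have ig : mxint t0 t1 g by apply: mxbnd_int; [exact: mxbndM|exact: mxsq_int].
have bx o : mxbnd t0 t1 (fun s => x s o) by apply: mxcont_bnd => i j; exact: cx.
have igx o : mxint t0 t1 (fun s => g s *m x s o) by exact: mxint_bnd.
pose z t o := Phi t *m mx_integral t0 t (fun s => g s *m x s o).
have pz o : mxprim t0 t1 (fun t => z t o) (fun t => a' t *m z t o + B t *m delta t *m x t o).
  apply: (eq_mxprim (mxprimM pP (mxprim_integral (igx o)))) => // t tt.
  have [_ PT'] := PT t tt.
  by rewrite /z /g !mulmxA PT' mul1mx.
have z0 o : z t0 o = 0 by rewrite /z mx_integral_aa mulmx0.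
exists (fun t o => x t o + z t o); split.
- by move=> i j; case: (sK' i j).
- by apply: L2_finite_energy => // i j; case: (sK' i j).
have driftE o t : A t *m (x t o + z t o) +
    B t *m feedback (linear_policy (fun t => K t + delta t)) (fun t o => x t o + z t o) t o
   = (A t *m x t o + B t *m feedback (linear_policy K) x t o) +
     (a' t *m z t o + B t *m delta t *m x t o).
  rewrite /feedback /linear_policy /a'; move: (z t o) (x t o) => v u.
  rewrite !(mulmxDr, mulmxDl, mulmxA) -!addrA; congr (_ + _); rewrite addrCA; congr (_ + _).
  by congr (_ + _); rewrite [LHS]addrC -addrA.
have idrift o : mxint t0 t1
    (fun t => A t *m x t o + B t *m feedback (linear_policy K) x t o).
  have -> : (fun t => A t *m x t o + B t *m feedback (linear_policy K) x t o) =
      (fun t => (A t + B t *m K t) *m x t o).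
    by apply/funext => t; rewrite /feedback /linear_policy mulmxDl mulmxA.
  by apply: mxint_bnd => //; exact: gain_closed_loop_int.
have iz o := mxprim_int (pz o).
rewrite /strong_solution; cbv zeta; split.
- move=> t; rewrite in_itv/= => tt i E mE.
  have /andP[t0t tt1] := tt.
  have xm s j : t0 <= s -> s <= t ->
      measurable_fun (setT : set (g_sigma_algebraType (F t))) (fun o => x s o j 0).
    move=> s0 st; apply/FmeasP; apply: (Fmeas_mono hF st) => C mC.
    have sI : s \in `[t0, t1] by rewrite in_itv/= s0 (le_trans st).
    exact: (ad s sI j C mC).
  suff : Fmeas F t (fun o => (x t o + z t o) i 0) by apply.
  apply/FmeasP.
  rewrite (_ : (fun o => _) = fun o => x t o i 0 + \sum_j Phi t i j *
      \sum_l \int[leb]_(s in `[t0, t]) (x s o l 0 * g s j l)); last first.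
    apply/funext => o; rewrite mxE; congr (_ + _); rewrite /z mxE.
    apply: eq_bigr => j _; congr (_ * _); rewrite mxE -rintegral_sum//.
      by apply: eq_Rintegral => s _; rewrite mxE; apply: eq_bigr => l _; rewrite mulrC.
    move=> l _; apply: rintegrable_sub (lexx t0) tt1 _.
    exact: (bmeasurable_mul (itv_meas t0 t1) (bx o l ord0) (ig j l)).
  apply: measurable_funD; first exact: xm.
  apply: measurable_sum => j; apply: measurable_funM => //.
  apply: measurable_sum => l.
  (* Each integral is a pathwise limit of left-endpoint sums that use [x] at times up to [t] only,
     so measurability for [F t] passes to the limit. *)
  have pg := primitive_sub (lexx t0) t0t tt1 (primitive_integral (ig j l)).
  have cxt o : {within `[t0, t], continuous (fun s => x s o l 0)}.
    exact: (within_cont_sub (lexx t0) tt1 (@cx o l 0)).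
  pose dg N k := \int[leb]_(s in `[t0, grid t0 t N k.+1]) g s j l -
    \int[leb]_(s in `[t0, grid t0 t N k]) g s j l.
  apply: (@measurable_fun_cvg _ (g_sigma_algebraType (F t)) R setT
    (fun N o => \sum_(k < N.+1) x (grid t0 t N (k + false)) o l 0 * dg N k)).
    move=> N; apply: measurable_sum => k; apply: measurable_funM => //.
    have /andP[h1 h2] := @grid_in R t0 t N k t0t (ltnW (ltn_ord k)).
    by rewrite addn0; apply: xm.
  move=> o _; exact: (stieltjes_cvg false t0t (cxt o) pg).
- move=> o i j; have h1 := @cx o i j.
  have hz : mx_continuous_on t0 t1 (z ^~ o) := mxprim_cont (pz o).
  have h2 := @hz i j.
  rewrite (_ : (fun t => _) = (fun t => x t o i j + z t o i j)); last first.
    by apply/funext => t; rewrite mxE.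
  by move=> s; apply: cvgD; [exact: h1|exact: h2].
- by apply: filterS xx0 => o; rewrite z0 addr0.
- apply: aeW => o.
  rewrite (_ : (fun t => _) = (fun t =>
     (A t *m x t o + B t *m feedback (linear_policy K) x t o) +
     (a' t *m z t o + B t *m delta t *m x t o))); last by apply/funext => t; exact: driftE.
  exact: mxintD.
(* The noise coefficient [B] does not involve the gain, so the same [M] serves the perturbed
   state. *)
- move=> t tI; have [M [hM E]] := hx t tI; exists M; split; first exact: hM.
  move: tI; rewrite in_itv/= => tt; have /andP[t0t tt1] := tt.
  apply: filterS E => o Eo.
  rewrite (_ : (fun t => _) = (fun t =>
     (A t *m x t o + B t *m feedback (linear_policy K) x t o) +
     (a' t *m z t o + B t *m delta t *m x t o))); last by apply/funext => s; exact: driftE.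
  have [_ zE] := (mxprimE _ _ _ _).1 (pz o).
  have {}zE : z t o = mx_integral t0 t (fun t => a' t *m z t o + B t *m delta t *m x t o).
    by rewrite (zE t tt) z0 add0r.
  rewrite (mx_integralD tt1 (idrift o) (iz o)) -zE Eo.
  by rewrite -!addrA; congr (_ + (_ + _)); rewrite addrC.
Qed.

End feasible_processes.

(** * Perturbation of the gain *)

Section perturbation.
Context {R : realType}.
Notation leb := (@lebesgue_measure R).
Variables (t0 t1 : R).
Notation I := (`[t0, t1]%classic : set (measurableTypeR R)).
Hypothesis t01 : t0 <= t1.

Lemma mxbnd_norm1 p q (M : R -> 'M[R]_(p, q)) : mxbnd t0 t1 M ->
  exists2 C, 0 <= C & forall t, t0 <= t <= t1 -> norm1 (M t) <= C.
Proof.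
move=> /mxbnd_bound[C C0 hC].
exists (\sum_(i < p) \sum_(j < q) C); first by do 2! apply: sumr_ge0 => ? _.
by move=> t tt; do 2! apply: ler_sum => ? _; exact: hC.
Qed.

Lemma norm1M3 p q r s (M : 'M[R]_(p, q)) (N : 'M[R]_(q, r)) (L : 'M[R]_(r, s)) :
  norm1 (M *m N *m L) <= norm1 M * norm1 N * norm1 L.
Proof.
by rewrite (le_trans (norm1M _ _))// ler_wpM2r ?norm1_ge0// norm1M.
Qed.

Lemma ler_rintegral (f g : R -> R) : rintegrable leb I f -> rintegrable leb I g ->
  (forall t, t0 <= t <= t1 -> f t <= g t) ->
  \int[leb]_(t in I) f t <= \int[leb]_(t in I) g t.
Proof.
by move=> hf hg fg; apply: le_Rintegral => // t; rewrite mem_itvcc => /fg.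
Qed.

(* Duhamel's formula gives [|D| <= eps L (|S| + |D|)] in the sup norm. *)
Lemma lyapunov_perturbation n (a S b : R -> 'M[R]_n) :
  mxint t0 t1 a -> mxbnd t0 t1 S -> mxint t0 t1 b ->
  exists2 C, 0 <= C & forall eps D, 0 <= eps -> eps * C <= 1 ->
    mxprim t0 t1 D (fun t => a t *m D t + D t *m (a t)^T +
      eps *: (b t *m (S t + D t) + (S t + D t) *m (b t)^T)) -> D t0 = 0 ->
    forall t, t0 <= t <= t1 -> norm1 (D t) <= eps * C.
Proof.
move=> ia bS ib.
have [Phi [Th [pP pT P0 T0 PT]]] := transition_exists t01 ia.
have bT := mxprim_bnd pT.
have [CP CP0 hCP] := mxbnd_norm1 (mxprim_bnd pP).
have [CT CT0 hCT] := mxbnd_norm1 bT.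
have [CS CS0 hCS] := mxbnd_norm1 bS.
have inb := norm1_rintegrable ib.
set be := \int[leb]_(t in I) norm1 (b t).
have be0 : 0 <= be by apply: Rintegral_ge0 => t _; exact: norm1_ge0.
(* The squares come from the conjugations by [Phi] and by [Th], the factor two from the pair of
   terms in the forcing. *)
set L := 2 * CP ^+ 2 * CT ^+ 2 * be.
have L0 : 0 <= L by rewrite /L !mulr_ge0// exprn_ge0.
(* [eps * C <= 1] forces [eps * L <= 1 / 2], so at most half of the supremum reappears on the right
   and is absorbed; the summand one secures this when [CS = 0]. *)
exists (2 * L * (CS + 1)); first by rewrite !mulr_ge0// addr_ge0.
move=> eps D eps0 epsC pD D0.
have bD := mxprim_bnd pD.
set f := fun t => eps *: (b t *m (S t + D t) + (S t + D t) *m (b t)^T).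
have bSD : mxbnd t0 t1 (fun t => S t + D t) by exact: mxbndD.
have if_ : mxint t0 t1 f.
  have h : mxint t0 t1 (fun t => b t *m (S t + D t) + (S t + D t) *m (b t)^T).
    by apply: mxintD; [exact: mxint_bnd|apply: mxbnd_int => //; exact: mxint_tr].
  move=> i j; have := rintegrableZ (itv_meas t0 t1) eps (h i j).
  by apply: eq_rintegrable => // t _; rewrite [RHS]mxE.
have [C0 C00 hC0] := mxbnd_norm1 bD.
(* Absorption requires a supremum known to be finite beforehand; continuity of [D] provides it. *)
pose X := [set norm1 (D t) | t in I].
have It0 : t0 <= t0 <= t1 by rewrite lexx.
have X0 : X (norm1 (D t0)) by exists t0 => //=; rewrite in_itv.
have supX : has_sup X.
  split; first by exists (norm1 (D t0)).
  by exists C0 => _ [t tt <-]; apply: hC0; rewrite /= in_itv in tt.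
set s := sup X.
have sX t : t0 <= t <= t1 -> norm1 (D t) <= s.
  by move=> tt; apply: (ub_le_sup supX.2); exists t => //=; rewrite in_itv.
have s0 : 0 <= s by rewrite (le_trans _ (sX t0 It0))// norm1_ge0.
have step t : t0 <= t <= t1 -> norm1 (D t) <= eps * L * (CS + s).
  move=> tt; rewrite (lyapunov_duhamel pT PT if_ pD D0 tt).
  have iTf : mxint t0 t1 (fun s => Th s *m f s *m (Th s)^T).
    by apply: mxint_bnd; [exact: mxbnd_int|exact: mxbnd_tr].
  apply: (le_trans (norm1M3 _ _ _)); rewrite norm1_tr.
  have h1 := norm1_integral tt iTf.
  have h2 : \int[leb]_(s in I) norm1 (Th s *m f s *m (Th s)^T) <=
      \int[leb]_(r in I) (CT ^+ 2 * eps * 2 * (CS + s) * norm1 (b r)).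
    apply: ler_rintegral; [exact: norm1_rintegrable|exact: rintegrableZ|].
    move=> r rr; apply: (le_trans (norm1M3 _ _ _)); rewrite norm1_tr.
    have hT := hCT r rr.
    have hf : norm1 (f r) <= eps * (2 * (CS + s) * norm1 (b r)).
      rewrite /f norm1Z ger0_norm// ler_wpM2l//.
      have hSD : norm1 (S r + D r) <= CS + s.
        by rewrite (le_trans (norm1D _ _))// lerD ?hCS ?sX.
      apply: (le_trans (norm1D _ _)).
      have e1 := norm1M (b r) (S r + D r).
      have e2 := norm1M (S r + D r) (b r)^T.
      rewrite norm1_tr in e2.
      have e3 : norm1 (S r + D r) * norm1 (b r) <= (CS + s) * norm1 (b r).
        by rewrite ler_wpM2r// norm1_ge0.
      lra.
    have -> : CT ^+ 2 * eps * 2 * (CS + s) * norm1 (b r) =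
        CT * (eps * (2 * (CS + s) * norm1 (b r))) * CT by ring.
    by apply: ler_pM => //; [rewrite mulr_ge0// norm1_ge0|exact: norm1_ge0|
       apply: ler_pM => //; exact: norm1_ge0].
  have h3 := le_trans h1 h2.
  rewrite RintegralZl// in h3; rewrite -/be in h3.
  have -> : eps * L * (CS + s) = CP * (CT ^+ 2 * eps * 2 * (CS + s) * be) * CP.
    by rewrite /L; ring.
  have hP := hCP t tt.
  by apply: ler_pM => //; [rewrite mulr_ge0// norm1_ge0|exact: norm1_ge0|
     apply: ler_pM => //; exact: norm1_ge0].
have sle : s <= eps * L * (CS + s).
  apply: ge_sup => [|_ [t tt <-]]; first by exists (norm1 (D t0)).
  by apply: step; rewrite /= in_itv in tt.
move=> t tt; apply: le_trans (sX t tt) _.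
have eL0 : 0 <= eps * L by rewrite mulr_ge0.
have h1 : 0 <= eps * L * CS by rewrite mulr_ge0.
have h2 : eps * L <= 2^-1.
  have : 2 * (eps * L) + 2 * (eps * L * CS) <= 1 by apply: le_trans epsC; lra.
  lra.
have h3 : eps * L * s <= 2^-1 * s by rewrite ler_wpM2r.
lra.
Qed.

(** In the density of [tr (P D)] the terms in [a] cancel, the trace being cyclic; as [D] starts at
    zero, only the terminal pairing remains. *)
Lemma costate_duality n (a P D W f : R -> 'M[R]_n) :
  mxprim t0 t1 P (fun t => - ((a t)^T *m P t + P t *m a t + W t)) ->
  mxprim t0 t1 D (fun t => a t *m D t + D t *m (a t)^T + f t) -> D t0 = 0 ->
  \tr (P t1 *m D t1) = \int[leb]_(t in I) (\tr (P t *m f t) - \tr (W t *m D t)).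
Proof.
move=> pP pD D0.
have [_ /(_ t1)] := tr_primitive (mxprimM pP pD).
rewrite t01 lexx D0 mulmx0 mxtrace0 add0r => -> //.
apply: eq_Rintegral => t _.
rewrite mulNmx !(mulmxDl, mulmxDr) !(mxtraceD, raddfN, raddfD)/= !mulmxA.
rewrite -[(a t)^T *m P t *m D t]mulmxA [\tr ((a t)^T *m _)]mxtrace_mulC.
ring.
Qed.

End perturbation.

(** * Exact variation of the cost and stationarity of the gain *)

Section stationarity.
Context {R : realType} (n m : nat) (t0 t1 : R).
Variables (A : R -> 'M[R]_n) (B : R -> 'M[R]_(n, m)) (Q : R -> 'M[R]_n).
Variables (Sigmad : 'M[R]_n).
Notation leb := (@lebesgue_measure R).
Notation I := (`[t0, t1]%classic : set (measurableTypeR R)).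
Hypothesis t01 : t0 <= t1.
Hypothesis cA : mx_continuous_on t0 t1 A.
Hypothesis cB : mx_continuous_on t0 t1 B.
Hypothesis iQ : mx_integrable_on t0 t1 Q.

Definition covariance_ode (K : R -> 'M[R]_(m, n)) (S : R -> 'M[R]_n) :=
  mxprim t0 t1 S (fun t => (A t + B t *m K t) *m S t +
    S t *m (A t + B t *m K t)^T + B t *m (B t)^T).

Definition covariance_cost (K : R -> 'M[R]_(m, n)) (S : R -> 'M[R]_n) : R :=
  2^-1 * \tr ((S t1 - Sigmad) *m (S t1 - Sigmad)) +
  \int[leb]_(t in I) \tr (((K t)^T *m K t + Q t) *m S t).

Lemma cost_int K S : mxsq t0 t1 K -> covariance_ode K S ->
  rintegrable leb I (fun t => \tr (((K t)^T *m K t + Q t) *m S t)).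
Proof.
move=> sK pS; apply: tr_rintegrable; apply: mxint_bnd; last exact: mxprim_bnd pS.
by apply: mxintD => //; apply: mxsqM => //; exact: mxsq_tr.
Qed.

(** The forcing carries the perturbed [S'], not [S], hence an equality without second-order
    remainder. *)
Lemma covariance_ode_diff K delta S S' :
  covariance_ode K S -> covariance_ode (fun t => K t + delta t) S' ->
  mxprim t0 t1 (fun t => S' t - S t) (fun t =>
    (A t + B t *m K t) *m (S' t - S t) + (S' t - S t) *m (A t + B t *m K t)^T +
    (B t *m delta t *m S' t + S' t *m (B t *m delta t)^T)).
Proof.
move=> pS pS'; apply: (eq_mxprim (mxprimB pS' pS)) => // t _.
rewrite mulmxDr addrA; set a := A t + B t *m K t; set b := B t *m delta t.
rewrite [(a + b)^T]linearD/= !(mulmxDl, mulmxDr) !(mulNmx, mulmxN).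
move: (a *m S' t) (a *m S t) (b *m S' t) (S' t *m a^T) (S' t *m b^T) (S t *m a^T)
  (B t *m (B t)^T) => x1 x2 x3 x4 x5 x6 x7.
by apply/matrixP => i j; rewrite !mxE; ring.
Qed.

(* The first-order term in [eps] is the Hamiltonian's derivative in the gain. *)
Lemma cost_variation K S P eps S' :
  let G t := K t + (B t)^T *m P t in
  mxsq t0 t1 K -> covariance_ode K S ->
  mxprim t0 t1 P (fun t => - ((A t + B t *m K t)^T *m P t +
    P t *m (A t + B t *m K t) + ((K t)^T *m K t + Q t))) ->
  P t1 = S t1 - Sigmad -> (forall t, t0 <= t <= t1 -> (P t)^T = P t) ->
  covariance_ode (fun t => K t + - eps *: G t) S' -> S' t0 = S t0 ->
  covariance_cost (fun t => K t + - eps *: G t) S' - covariance_cost K S =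
  2^-1 * \tr ((S' t1 - S t1) *m (S' t1 - S t1)) -
  (2 * eps - eps ^+ 2) * \int[leb]_(t in I) \tr ((G t)^T *m G t *m S' t).
Proof.
move=> G sK pS pP P1 sP pS' S0.
have bB := mxcont_bnd cB; have bP := mxprim_bnd pP.
have sG : mxsq t0 t1 G.
  by apply: mxsqD => //; apply: mxbnd_sqint; apply: mxbndM => //; exact: mxbnd_tr.
have sK' : mxsq t0 t1 (fun t => K t + - eps *: G t) by apply: mxsqD => //; exact: mxsqZ.
have iK := cost_int sK pS; have iK' := cost_int sK' pS'.
have iG : rintegrable leb I (fun t => \tr ((G t)^T *m G t *m S' t)).
  apply: tr_rintegrable; apply: mxint_bnd; last exact: mxprim_bnd pS'.
  by apply: mxsqM => //; exact: mxsq_tr.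
have D0 : S' t0 - S t0 = 0 by rewrite S0 subrr.
have dual := costate_duality t01 pP (covariance_ode_diff pS pS') D0.
have -> : (2 * eps - eps ^+ 2) * \int[leb]_(t in I) \tr ((G t)^T *m G t *m S' t) =
    \int[leb]_(t in I) ((2 * eps - eps ^+ 2) * \tr ((G t)^T *m G t *m S' t)).
  by rewrite RintegralZl.
have iZ := rintegrableZ (itv_meas t0 t1) (2 * eps - eps ^+ 2) iG.
set D := fun t => S' t - S t in dual *.
have E : \int[leb]_(t in I) \tr (((K t + - eps *: G t)^T *m (K t + - eps *: G t) + Q t) *m S' t)
   - \int[leb]_(t in I) \tr (((K t)^T *m K t + Q t) *m S t) + \tr (P t1 *m D t1) =
   - \int[leb]_(t in I) ((2 * eps - eps ^+ 2) * \tr ((G t)^T *m G t *m S' t)).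
  have idual : rintegrable leb I (fun t =>
      - ((2 * eps - eps ^+ 2) * \tr ((G t)^T *m G t *m S' t)) -
      (\tr (((K t + - eps *: G t)^T *m (K t + - eps *: G t) + Q t) *m S' t) -
       \tr (((K t)^T *m K t + Q t) *m S t))).
    by apply: rintegrableB => //; [exact: rintegrableN|exact: rintegrableB].
  have -> : \tr (P t1 *m D t1) = \int[leb]_(t in I) (
      - ((2 * eps - eps ^+ 2) * \tr ((G t)^T *m G t *m S' t)) -
      (\tr (((K t + - eps *: G t)^T *m (K t + - eps *: G t) + Q t) *m S' t) -
       \tr (((K t)^T *m K t + Q t) *m S t))).
    rewrite dual; apply: eq_Rintegral => t; rewrite inE mem_itvcc => tt.
    have GT : (G t)^T = (K t)^T + P t *m B t.
      by rewrite /G [LHS]linearD/= trmx_mul trmxK sP.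
    (* Eliminating [B^T P] through [G - K] leaves a polynomial identity in [G] and [K], in which the
       mixed traces cancel and [2 * eps - eps ^ 2] appears. *)
    have BPE : (B t)^T *m P t = G t - K t by rewrite /G addrC addKr.
    have PBE : P t *m B t = (G t)^T - (K t)^T by rewrite GT addrC addKr.
    have -> : \tr (P t *m (B t *m (- eps *: G t) *m S' t + S' t *m (B t *m (- eps *: G t))^T)) =
        - eps * (2 * \tr ((G t)^T *m G t *m S' t) - \tr ((K t)^T *m G t *m S' t)
          - \tr ((G t)^T *m K t *m S' t)).
      rewrite mulmxDr mxtraceD [\tr (P t *m (S' t *m _))]mxtrace_mulC trmx_mul.
      rewrite -(mulmxA (S' t)) [\tr (S' t *m _)]mxtrace_mulC -[_ *m (B t)^T *m P t]mulmxA.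
      rewrite BPE !mulmxA PBE [(- eps *: G t)^T]linearZ/=.
      rewrite !(mulmxBl, mulmxBr, mxtraceD, =^~ scalemxAl, =^~ scalemxAr,
        mxtraceZ, raddfN)/= !mxtraceZ.
      ring.
    rewrite /D; move: (G t) GT BPE PBE => g _ _ _.
    rewrite [(K t + _)^T]linearD/= [(- eps *: g)^T]linearZ/=.
    rewrite !(mulmxDl, mulmxDr, mulmxN, mxtraceD, =^~ scalemxAl, =^~ scalemxAr,
      mxtraceZ, raddfN)/= ?mxtraceZ.
    ring.
  rewrite [X in _ + X = _]RintegralB//; last 2 first.
  - exact: rintegrableN.
  - exact: rintegrableB.
  by rewrite rintegralN// RintegralB//; ring.
(* [P t1] is the gradient of the terminal cost at [S t1], so the linear part of this expansion
   cancels against the duality pairing and only the square of [D t1] survives. *)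
have E2 : \tr ((S' t1 - Sigmad) *m (S' t1 - Sigmad)) -
    \tr ((S t1 - Sigmad) *m (S t1 - Sigmad)) =
    2 * \tr (P t1 *m D t1) + \tr (D t1 *m D t1).
  have -> : S' t1 - Sigmad = P t1 + D t1 by rewrite P1 /D [RHS]addrC subrKA.
  rewrite -P1; move: (P t1) (D t1) => p q.
  rewrite !(mulmxDl, mulmxDr) !mxtraceD [\tr (q *m p)]mxtrace_mulC; ring.
rewrite /covariance_cost.
move: E E2; rewrite -/(D t1).
set x1 := \int[leb]_(t in I) _; set x2 := \int[leb]_(t in I) _; set x3 := \int[leb]_(t in I) _.
lra.
Qed.

End stationarity.

Section stationary_gain.
Context {R : realType} (n m : nat) (t0 t1 : R).
Variables (A : R -> 'M[R]_n) (B : R -> 'M[R]_(n, m)) (Q : R -> 'M[R]_n).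
Variables (Sigmad : 'M[R]_n).
Notation leb := (@lebesgue_measure R).
Notation I := (`[t0, t1]%classic : set (measurableTypeR R)).
Hypothesis t01 : t0 <= t1.
Hypothesis cA : mx_continuous_on t0 t1 A.
Hypothesis cB : mx_continuous_on t0 t1 B.
Hypothesis iQ : mx_integrable_on t0 t1 Q.

Lemma rintegral_eq0_ae (f : R -> R) : rintegrable leb I f ->
  (forall t, t0 <= t <= t1 -> 0 <= f t) -> \int[leb]_(t in I) f t = 0 ->
  {ae leb, forall t, t \in `[t0, t1] -> f t = 0}.
Proof.
move=> hf f0 h.
have mf : measurable_fun I (EFin \o f) by apply/measurable_EFinP; exact: rintegrable_meas hf.
have : (\int[leb]_(t in I) `|(EFin \o f) t| = 0)%E.
  rewrite -[RHS]/(0%R)%:E -h -rintegral_EFin//; apply: eq_integral => t.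
  by rewrite inE mem_itvcc => /f0 ft /=; rewrite ger0_norm.
move=> /(ae_eq_integral_abs leb (itv_meas t0 t1) mf).1 h1.
have : {ae leb, forall t, I t -> (EFin \o f) t = 0%E} by exact: h1.
apply: filterS.
by move=> t h2 tt; have [] := h2 tt.
Qed.

Lemma pdmx_quad_eq0 p (S : 'M[R]_p) v : pdmx S -> quad S v = 0 -> v = 0.
Proof.
move=> [_ pS] q0; apply: contra_eq q0 => /pS; exact: lt0r_neq0.
Qed.

Lemma pdmx_quad_ge0 p (S : 'M[R]_p) v : pdmx S -> 0 <= quad S v.
Proof.
move=> [_ pS]; have [->|/pS/ltW//] := eqVneq v 0.
by rewrite /quad trmx0 !mul0mx mxE.
Qed.

Lemma mxtrace_gram_ge0 p q (G : 'M[R]_(p, q)) S : pdmx S -> 0 <= \tr (G^T *m G *m S).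
Proof.
by move=> pS; rewrite mxtrace_rows; apply: sumr_ge0 => k _; exact: pdmx_quad_ge0.
Qed.

Lemma mxtrace_gram_eq0 p q (G : 'M[R]_(p, q)) S : pdmx S ->
  \tr (G^T *m G *m S) = 0 -> G = 0.
Proof.
move=> pS; rewrite mxtrace_rows => /eqP; rewrite psumr_eq0 => [/allP h|k _];
  last exact: pdmx_quad_ge0.
apply/row_matrixP => k; rewrite row0; apply: trmx_inj; rewrite trmx0.
by apply: (pdmx_quad_eq0 pS); apply/eqP; exact: h (mem_index_enum k).
Qed.

(** A terminal term of order [eps ^ 2] cannot offset a decrease of order [eps], so the integral of
    the [S]-weighted square of [G] must vanish. *)
Lemma stationary_gain K S P :
  let G t := K t + (B t)^T *m P t in
  mxsq t0 t1 K -> covariance_ode t0 t1 A B K S ->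
  (forall t, t0 <= t <= t1 -> pdmx (S t)) ->
  mxprim t0 t1 P (fun t => - ((A t + B t *m K t)^T *m P t +
    P t *m (A t + B t *m K t) + ((K t)^T *m K t + Q t))) ->
  P t1 = S t1 - Sigmad -> (forall t, t0 <= t <= t1 -> (P t)^T = P t) ->
  (forall eps, exists S',
    [/\ covariance_ode t0 t1 A B (fun t => K t + - eps *: G t) S', S' t0 = S t0,
        forall t, t0 <= t <= t1 -> pdmx (S' t) &
        covariance_cost t0 t1 Q Sigmad K S <=
        covariance_cost t0 t1 Q Sigmad (fun t => K t + - eps *: G t) S']) ->
  {ae leb, forall t, t \in `[t0, t1] -> K t = - ((B t)^T *m P t)}.
Proof.
move=> G sK pS pdS pP P1 sP hmin.
have bB := mxcont_bnd cB; have bP := mxprim_bnd pP.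
have sG : mxsq t0 t1 G.
  by apply: mxsqD => //; apply: mxbnd_sqint; apply: mxbndM => //; exact: mxbnd_tr.
have iGG : mxint t0 t1 (fun t => (G t)^T *m G t) by apply: mxsqM => //; exact: mxsq_tr.
have ia : mxint t0 t1 (fun t => A t + B t *m K t).
  apply: mxintD; first exact/mxbnd_mxint/mxcont_bnd.
  by apply: mxbnd_int => //; exact: mxsq_int.
have ib : mxint t0 t1 (fun t => - (B t *m G t)).
  by apply: mxintN; apply: mxbnd_int => //; exact: mxsq_int.
have [C C0 hC] := lyapunov_perturbation t01 ia (mxprim_bnd pS) ib.
have iGS : rintegrable leb I (fun t => \tr ((G t)^T *m G t *m S t)).
  by apply: tr_rintegrable; apply: mxint_bnd => //; exact: mxprim_bnd pS.
have nGG := norm1_rintegrable iGG.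
set g := \int[leb]_(t in I) norm1 ((G t)^T *m G t).
have g0 : 0 <= g by apply: Rintegral_ge0 => t _; exact: norm1_ge0.
set J0 := \int[leb]_(t in I) \tr ((G t)^T *m G t *m S t).
have J0_ge0 : 0 <= J0.
  by apply: Rintegral_ge0 => t; rewrite mem_itvcc => /pdS; exact: mxtrace_gram_ge0.
(* Optimality and the exact variation give [eps * J' <= (eps * C) ^ 2], where [eps <= 1] bounds
   [2 * eps - eps ^ 2] below by [eps]; passing from [S'] to [S] costs [eps * C * g]. *)
have small eps : 0 < eps -> eps <= 1 -> eps * C <= 1 -> J0 <= eps * (C ^+ 2 + C * g).
  move=> eps0 eps1 epsC.
  have [S' [pS' S'0 pdS' le_cost]] := hmin eps.
  have := cost_variation t01 cB iQ sK pS pP P1 sP pS' S'0; rewrite -/G.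
  set J' := \int[leb]_(t in I) _ => var.
  have J'0 : 0 <= J'.
    by apply: Rintegral_ge0 => t; rewrite mem_itvcc => /pdS'; exact: mxtrace_gram_ge0.
  have D0 : S' t0 - S t0 = 0 by rewrite S'0 subrr.
  have nD t : t0 <= t <= t1 -> norm1 (S' t - S t) <= eps * C.
    apply: (hC eps (fun t => S' t - S t) (ltW eps0) epsC) => //.
    apply: (eq_mxprim (covariance_ode_diff pS pS')) => // s _; congr (_ + _).
    rewrite subrKC mulNmx [(- _)^T]linearN/= mulmxN -scalemxAr [(_ *: (B s *m G s))^T]linearZ/=.
    by rewrite -scalemxAl -scalemxAr scalerDr !scalerN !scaleNr.
  have t1I : t0 <= t1 <= t1 by rewrite t01 lexx.
  have trD : \tr ((S' t1 - S t1) *m (S' t1 - S t1)) <= (eps * C) ^+ 2.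
    apply: (le_trans (ler_norm _)); apply: (le_trans (le_mxtrace_norm1 _)).
    apply: (le_trans (norm1M _ _)).
    by rewrite expr2 ler_pM ?norm1_ge0 ?nD.
  have iGS' : rintegrable leb I (fun t => \tr ((G t)^T *m G t *m S' t)).
    by apply: tr_rintegrable; apply: mxint_bnd => //; exact: mxprim_bnd pS'.
  have JJ : J0 <= J' + eps * C * g.
    rewrite -lerBlDl /J0 /J' -RintegralB// /g -RintegralZl//.
    apply: ler_rintegral; [exact: rintegrableB|exact: rintegrableZ|].
    move=> t tt; rewrite -raddfB/= -mulmxBr.
    apply: (le_trans (ler_norm _)); apply: (le_trans (le_mxtrace_norm1 _)).
    apply: (le_trans (norm1M _ _)); rewrite mulrC ler_wpM2r ?norm1_ge0//.
    by rewrite -opprB -scaleN1r norm1Z normrN1 mul1r nD.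
  have e1 : 0 <= 2^-1 * (eps * C) ^+ 2 - (2 * eps - eps ^+ 2) * J'.
    apply: (@le_trans _ _ (2^-1 * \tr ((S' t1 - S t1) *m (S' t1 - S t1)) - (2 * eps - eps ^+ 2) * J')).
      by rewrite -var subr_ge0.
    by rewrite lerD2r ler_wpM2l// invr_ge0.
  have e2 : eps * J' <= (2 * eps - eps ^+ 2) * J'.
    rewrite ler_wpM2r//.
    have : eps * eps <= eps * 1 by rewrite ler_wpM2l// ltW.
    by rewrite expr2; lra.
  have e3 : eps * J' <= eps * (eps * C ^+ 2).
    have -> : eps * (eps * C ^+ 2) = (eps * C) ^+ 2 by ring.
    have := sqr_ge0 (eps * C); lra.
  rewrite ler_pM2l// in e3; lra.
have J00 : J0 = 0.
  apply/eqP; rewrite eq_le J0_ge0 andbT.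
  apply/ler_addgt0Pl => e e0; rewrite addr0.
  set M := C ^+ 2 + C * g.
  have M0 : 0 <= M by rewrite addr_ge0 ?mulr_ge0// exprn_ge0.
  (* [e / (e + 1)] is below both [1] and [e]; dividing by [1 + C + M] meets [eps <= 1],
     [eps * C <= 1] and [eps * M <= e] at once. *)
  pose eps := (e / (e + 1)) / (1 + C + M).
  have den : 0 < 1 + C + M by lra.
  have q1 : 0 < e / (e + 1) by rewrite divr_gt0// addr_gt0.
  have q2 : e / (e + 1) <= 1 by rewrite ler_pdivrMr ?addr_gt0// mul1r lerDl.
  have q3 : e / (e + 1) <= e by rewrite ler_pdivrMr ?addr_gt0// mulrDr mulr1 lerDr mulr_ge0 ?ltW.
  have epsE : eps * (1 + C + M) = e / (e + 1) by rewrite /eps divfK ?gt_eqF.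
  have eps0 : 0 < eps by rewrite divr_gt0.
  have h1 : 0 <= eps * C by rewrite mulr_ge0// ltW.
  have h2 : 0 <= eps * M by rewrite mulr_ge0// ltW.
  have h3 : eps + eps * C + eps * M = e / (e + 1) by rewrite -epsE; ring.
  have := small eps eps0; rewrite -/M => s1.
  have h4 : J0 <= eps * M by apply: s1; lra.
  lra.
have fge0 t : t0 <= t <= t1 -> 0 <= \tr ((G t)^T *m G t *m S t).
  by move=> /pdS; exact: mxtrace_gram_ge0.
have := rintegral_eq0_ae iGS fge0 J00.
apply: filterS; first exact: (ae_filter_ringOfSetsType leb).
move=> t ht tt; have tt' : t0 <= t <= t1 by rewrite in_itv/= in tt.
have /eqP := mxtrace_gram_eq0 (pdS t tt') (ht tt).
by rewrite /G addr_eq0 => /eqP.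
Qed.

End stationary_gain.

(** * From the stationary gain to the coupled boundary value problem *)

Theorem proposition1 (R : realType) (n m : nat) (t0 t1 : R)
    (A : R -> 'M[R]_n) (B : R -> 'M[R]_(n, m)) (Q : R -> 'M[R]_n)
    (Sigma0 Sigmad : 'M[R]_n)
    (d : measure_display) (T : measurableType d) (Pr : probability T R)
    (F : R -> set (set T)) (w : R -> T -> 'cV[R]_m) (x0 : T -> 'cV[R]_n)
    (ht : t0 < t1)
    (* A1 *)
    (hAb : mx_bounded_on t0 t1 A) (hBb : mx_bounded_on t0 t1 B)
    (hAc : mx_continuous_on t0 t1 A) (hBc : mx_continuous_on t0 t1 B)
    (hAB : uniformly_controllable t0 t1 A B)
    (* A2 *)
    (hQ : forall t, t \in `[t0, t1] -> psdmx (Q t))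
    (hQi : mx_integrable_on t0 t1 Q)
    (* A3 *)
    (hS0 : pdmx Sigma0) (hSd : pdmx Sigmad)
    (* stochastic basis, driving noise and initial state *)
    (hF : filtration F)
    (hw : wiener_process Pr t0 t1 F w)
    (hx0 : vec_measurable (F t0) x0)
    (hx0N : normal_vector Pr Sigma0 x0)
    (* an optimal gain and the corresponding state process *)
    (Kopt : R -> 'M[R]_(m, n)) (xopt : R -> T -> 'cV[R]_n)
    (hopt : optimal Pr t0 t1 F w x0 A B Q Sigmad Kopt xopt) :
  exists Popt : R -> 'M[R]_n,
    coupled_bvp t0 t1 A B Q Sigma0 Sigmad (fun t => covmx Pr (xopt t)) Popt /\
    {ae lebesgue_measure, forall t : R, t \in `[t0, t1] ->
       Kopt t = - ((B t)^T *m Popt t) /\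
       forall o : T, feedback (linear_policy Kopt) xopt t o =
                     - ((B t)^T *m Popt t) *m xopt t o}.
Proof.
have t01 := ltW ht.
have [fx hmin] := hopt.
have sK := feasible_gain_L2 fx.
have [pS S0 pdS L2x Ex] := feasible_covmx ht hAc hBc hS0 hF hw hx0 hx0N fx.
set S := fun t => covmx Pr (xopt t) in pS pdS *.
have ia := gain_closed_loop_int hAc hBc sK.
have [Phi [Th [pPhi pTh Phi0 Th0 PT]]] := transition_exists t01 ia.
have iW : mxint t0 t1 (fun t => (Kopt t)^T *m Kopt t + Q t).
  by apply: mxintD => //; apply: mxsqM => //; exact: mxsq_tr.
have sW t : t0 <= t <= t1 -> ((Kopt t)^T *m Kopt t + Q t)^T = (Kopt t)^T *m Kopt t + Q t.
  move=> tt; rewrite [LHS]linearD/= trmx_mul trmxK; congr (_ + _).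
  by have [|sQ _] := hQ t; rewrite ?in_itv.
have t1I : t0 <= t1 <= t1 by rewrite t01 lexx.
have sP1 : (S t1 - Sigmad)^T = S t1 - Sigmad.
  by rewrite [LHS]linearB/=; have [-> _] := pdS t1 t1I; have [-> _] := hSd.
have [P [pP P1 sP]] := costate_exists t01 pPhi pTh PT iW sW sP1.
have sG : mxsq t0 t1 (fun t => Kopt t + (B t)^T *m P t).
  apply: mxsqD => //; apply: mxbnd_sqint; apply: mxbndM; last exact: mxprim_bnd pP.
  exact/mxbnd_tr/mxcont_bnd.
have KE : {ae lebesgue_measure, forall t, t \in `[t0, t1] -> Kopt t = - ((B t)^T *m P t)}.
  (* Competitors for every [eps] come from [feasible_perturb] in the direction [G], square
     integrable by [sG]; minimality is then read on covariances through [feasible_cost]. *)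
  apply: (stationary_gain t01 hAc hBc hQi sK pS pdS pP P1 sP) => eps.
  have [x' fx'] := feasible_perturb ht hAc hBc hF fx (mxsqZ (- eps) sG).
  have [pS' S'0 pdS' _ _] := feasible_covmx ht hAc hBc hS0 hF hw hx0 hx0N fx'.
  exists (fun t => covmx Pr (x' t)); split=> //; first by rewrite S'0 -S0.
  have := hmin _ _ fx'.
  rewrite (feasible_cost ht hAc hBc hS0 hF hw hx0 hx0N Sigmad hQi fx).
  by rewrite (feasible_cost ht hAc hBc hS0 hF hw hx0 hx0N Sigmad hQi fx') lee_fin.
exists P; split; last first.
  move: KE; apply: filterS; first exact: (ae_filter_ringOfSetsType lebesgue_measure).
  by move=> t Kt tt; split=> [|o]; rewrite ?/feedback ?/linear_policy Kt.
have bP := mxprim_bnd pP; have bB := mxcont_bnd hBc; have bA := mxcont_bnd hAc.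
have bBP : mxbnd t0 t1 (fun t => B t *m (B t)^T *m P t).
  by apply: mxbndM => //; apply: mxbndM => //; exact: mxbnd_tr.
have bAcl : mxbnd t0 t1 (fun t => A t - B t *m (B t)^T *m P t) by exact: mxbndB.
split=> //.
- move=> t; rewrite in_itv/= => tt; split; first exact: pdS.
  exact: sP.
(* Once the gain is replaced by its almost everywhere value, the right-hand side is bounded on the
   interval, hence integrable. *)
- apply: mxprim_solves_ode; apply: (mxprim_ae pS).
    apply: mxbnd_mxint; apply: mxbndD; last by apply: mxbndM => //; exact: mxbnd_tr.
    have bS := mxprim_bnd pS.
    by apply: mxbndD; apply: mxbndM => //; exact: mxbnd_tr.
  move: KE; apply: filterS; first exact: (ae_filter_ringOfSetsType lebesgue_measure).
  by move=> t Kt tt; rewrite Kt// mulmxN mulmxA.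
- apply: mxprim_solves_ode; apply: (mxprim_ae pP).
    apply: mxintN; apply: mxintD => //; apply: mxbnd_mxint; apply: mxbndB.
      by apply: mxbndD; apply: mxbndM => //; exact: mxbnd_tr.
    by apply: mxbndM => //; apply: mxbndM; [exact: mxbndM|exact: mxbnd_tr].
  move: KE; apply: filterS; first exact: (ae_filter_ringOfSetsType lebesgue_measure).
  move=> t Kt tt; have tt' : t0 <= t <= t1 by rewrite in_itv/= in tt.
  (* With [K = - B^T P] the two closed-loop terms each contribute [- P B B^T P], and [K^T K] cancels
     one of them, which leaves the Riccati equation. *)
  rewrite Kt// [(- ((B t)^T *m P t))^T]linearN/= trmx_mul trmxK sP//.
  rewrite [(A t + _)^T]linearD/= [(B t *m _)^T]trmx_mul [(- ((B t)^T *m P t))^T]linearN/=.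
  rewrite trmx_mul trmxK sP// !(mulmxDl, mulmxDr) !(mulmxN, mulNmx) opprK !mulmxA.
  move: (_ *m P t) (P t *m A t) (P t *m B t *m (B t)^T *m P t) => u v q.
  congr (- _); apply/matrixP => i j; rewrite !mxE; ring.
Qed.
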